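(* Consider the $n\times n$ system $\frac{dY}{dz}=A(z,t)Y$, $A(z,t)=\sum_{j\ge0}A_j(t)z^{-j}$, with $A$ holomorphic for $|z|\ge N_0$, $t\in\mathcal U_{\epsilon_0}(0)\subset\mathbb C^n$, for which there is a holomorphic invertible $G_0(t)$ on $\mathcal U_{\epsilon_0}(0)$, $G_0(0)=I$, with $G_0(t)^{-1}A_0(t)G_0(t)=\Lambda(t)=\mathrm{diag}(u_1(t),\dots,u_n(t))$, $u_a(t)=u_a(0)+t_a$, and let $\epsilon_0=\delta_0$ with $0<\delta_0<\min_{i\ne j}\delta_{ij}$ (see context). Let $\widetilde\tau$ be admissible for $\Lambda(0)$, $\tau_\nu<\widetilde\tau<\tau_{\nu+1}$. Suppose that 1) every $F_j(t)$, $j\ge1$, is holomorphic in $\mathcal U_{\epsilon_0}(0)$; and 2) for any $\widetilde\tau$-cell $c$ and any $k\in\mathbb Z$, $Y_{\nu+k\mu}(z,t;\widetilde\tau,c)$ has analytic continuation in $t$ as a single-valued holomorphic function on the whole $\mathcal U_{\epsilon_0}(0)$. Let $\mathbb S_\nu(t),\mathbb S_{\nu+\mu}(t)$ be the complete set of Stokes matrices associated with the fundamental solutions $Y_\nu(z,t),Y_{\nu+\mu}(z,t),Y_{\nu+2\mu}(z,t)$ having canonical asymptotics, for $t$ in a $\widetilde\tau$-cell of $\mathcal U_{\epsilon_0}(0)$, in the sectors $\mathcal S_\nu(t),\mathcal S_{\nu+\mu}(t),\mathcal S_{\nu+2\mu}(t)$ respectively. Then the following limits exist: $$\lim_{t\to0}\mathbb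 S_\nu(t)=\mathring{\mathbb S}_\nu,\qquad\lim_{t\to0}\mathbb S_{\nu+\mu}(t)=\mathring{\mathbb S}_{\nu+\mu},$$ where $\mathring{\mathbb S}_\nu,\mathring{\mathbb S}_{\nu+\mu}$ is the complete set of Stokes matrices of the system at $t=0$ referred to the three fundamental solutions $\mathring Y_{\nu+k\mu}(z)=\mathcal G_{\nu+k\mu}(z)z^{B_1(0)}e^{\Lambda(0)z}$, $k=0,1,2$, with asymptotics $\mathcal G_{\nu+k\mu}(z)\sim I+\sum_{j\ge1}\mathring F_jz^{-j}$ for $z\to\infty$ in $\mathcal S_{\nu+k\mu}$, where $\mathring F_j=F_j(0)$, $j\ge1$.
   Context: Notation. $\mathcal R$ is the universal covering of $\mathbb C\setminus\{0\}$; $S(\alpha,\beta)=\{z\in\mathcal R:\alpha<\arg z<\beta\}$. $|t|=\max_i|t_i|$, $\mathcal U_\epsilon(0)=\{t\in\mathbb C^n:|t|\le\epsilon\}$. The $u_a(0)$ take distinct values $\lambda_1,\dots,\lambda_s$, ordered so that $A_0(0)=\Lambda(0)=\lambda_1I_{p_1}\oplus\cdots\oplus\lambda_sI_{p_s}$. $\Delta=\{t\in\mathcal U_{\epsilon_0}(0):u_a(t)=u_b(t)\text{ for some }a\ne b\}$. Formal solution. Set $\widehat A_k(t)=G_0(t)^{-1}A_k(t)G_0(t)$ and $B_1(t)=\mathrm{diag}(\widehat A_1(t))$ (diagonal part). For $t\notin\Delta$ there is a unique formal solution $G_0(t)\big(I+\sum_{k\ge1}F_k(t)z^{-k}\big)z^{B_1(t)}e^{\Lambda(t)z}$;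 the $F_k$ are holomorphic on $\mathcal U_{\epsilon_0}(0)\setminus\Delta$. Stokes rays of $\Lambda(t)$: rays $\{z\in\mathcal R:\Re[(u_a(t)-u_b(t))z]=0\}$, $u_a(t)\ne u_b(t)$. Those of $\Lambda(0)$ have directions labelled increasingly $\cdots<\tau_\sigma<\tau_{\sigma+1}<\cdots$, $\sigma\in\mathbb Z$, with $\tau_{\sigma+\mu}=\tau_\sigma+\pi$. $\widetilde\tau$ is admissible if it is none of the $\tau_\sigma$. $\mathcal S_\sigma=S(\tau_\sigma-\pi,\tau_{\sigma+1})$. (If $s=1$ there are no such rays, $\widetilde\tau$ is arbitrary, $\mathcal S_\sigma=\mathcal R$, and the indices $\nu+k\mu$ are mere labels for $k\in\mathbb Z$.) Radius: $\delta_{ij}=\frac12\min_{\rho\in\mathbb R}|\lambda_i-\lambda_j+\rho e^{i\widetilde\eta}|$, $\widetilde\eta=\frac{3\pi}2-\widetilde\tau$, $1\le i\neq j\le s$. Cells: $X(\widetilde\tau)$ is the set of $t\in\mathcal U_{\epsilon_0}(0)$ such that, for some $a\neq b$ with $u_a(t)\ne u_b(t)$, $\arg(u_a(t)-u_b(t))=\widetilde\eta$ mod $\pi$. A $\widetilde\tau$-cell is a connected component of $\mathcal U_{\epsilon_0}(0)\setminus(\Delta\cup X(\widetilde\tau))$. Sectors: for $t\notin X(\widetilde\tau)$, $\mathcal S_{\nu+k\mu}(t)$ is the open sector containing $S(\widetilde\tau-\pi+k\pi,\widetilde\tau+k\pi)$ and extending up to the nearest Stokes rays of $\Lambda(t)$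 outside it. Solutions: for a cell $c$, $Y_{\nu+k\mu}(z,t;\widetilde\tau,c)$, $t\in c$, is the unique fundamental solution, holomorphic in $t\in c$, such that $G_0(t)^{-1}Y_{\nu+k\mu}e^{-\Lambda(t)z}z^{-B_1(t)}\sim I+\sum_{j\ge1}F_j(t)z^{-j}$ (canonical asymptotics) as $z\to\infty$ in $\mathcal S_{\nu+k\mu}(t)$. Asymptotics in an open sector means in every proper closed subsector. Under hypotheses 1) and 2), the continuation of $Y_{\nu+k\mu}(z,t;\widetilde\tau,c)$ to $\mathcal U_{\epsilon_0}(0)$ does not depend on $c$ and is denoted $Y_{\nu+k\mu}(z,t)$. Stokes matrices: $Y_{\nu+(k+1)\mu}(z,t)=Y_{\nu+k\mu}(z,t)\mathbb S_{\nu+k\mu}(t)$ and $\mathring Y_{\nu+(k+1)\mu}(z)=\mathring Y_{\nu+k\mu}(z)\mathring{\mathbb S}_{\nu+k\mu}$, $k=0,1$. *)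

(* Defs.v *)
From HB Require Import structures.
From mathcomp Require Export all_boot all_order all_algebra.
From mathcomp Require Export complex.
From mathcomp Require Export all_classical all_reals all_analysis.

Set Implicit Arguments.
Unset Strict Implicit.
Unset Printing Implicit Defensive.

Export Order.TTheory GRing.Theory Num.Theory.
Export numFieldNormedType.Exports.

Local Open Scope classical_set_scope.
Local Open Scope ring_scope.
Local Open Scope complex_scope.

(* R[i], presented as a numClosedFieldType so that it carries the topology and
   the normed-module structure that MathComp-Analysis puts on such fields;
   differentiability over it is complex differentiability. *)
Definition cplx (R : realType) : numClosedFieldType := R[i].

(* A point z of the universal covering of C \ {0} is represented by its
   logarithm w : z = cexp w, |z| = `|cexp w|, arg z = Im w, log z = w. *)
Definition cexp (R : realType) (w : cplx R) : cplx R :=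
  (expR (complex.Re w) * cos (complex.Im w)) +i*
  (expR (complex.Re w) * sin (complex.Im w)).

Definition cis (R : realType) (theta : R) : cplx R :=
  cos theta +i* sin theta.

Definition carg (R : realType) (w : cplx R) : R := complex.Im w.

Definition outside (R : realType) (N0 : R) : set (cplx R) :=
  [set z | N0%:C <= `|z| :> cplx R].

(* For a set D that need not be open: f is the restriction to D of a map that
   is complex differentiable on an open set containing D. *)
Definition holomorphic_on (R : realType) (V W : normedModType (cplx R))
    (D : set V) (f : V -> W) : Prop :=
  exists (O : set V) (g : V -> W),
    [/\ open O, D `<=` O, (forall x, O x -> differentiable g x)
      & (forall x, D x -> g x = f x)].

Section Geometry.
Variables (R : realType) (n : nat).
Local Notation C := (cplx R).
Implicit Types (u t : 'rV[C]_n).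

(* The norm of 'rV[C]_n is the sup norm max_a |t_a|. *)
Definition polydisc (eps : R) : set 'rV[C]_n :=
  [set t | `|t| <= eps%:C :> C].

Definition coalescence_locus (eps : R) (u0 : 'rV[C]_n) : set 'rV[C]_n :=
  [set t | polydisc eps t /\
    exists a b, a != b /\ (u0 + t) 0 a = (u0 + t) 0 b].

Definition has_arg (x : C) (theta : R) : Prop :=
  exists2 rho : R, 0 < rho & x = rho%:C * cis theta.

Definition eta_of (tau : R) : R := 3 * pi / 2 - tau.

Definition crossing_locus (eps : R) (u0 : 'rV[C]_n) (tau : R) : set 'rV[C]_n :=
  [set t | polydisc eps t /\
    exists a b, (u0 + t) 0 a != (u0 + t) 0 b /\
      exists m : int,
        has_arg ((u0 + t) 0 a - (u0 + t) 0 b) (eta_of tau + m%:~R * pi)].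

Definition cell_domain (eps : R) (u0 : 'rV[C]_n) (tau : R) : set 'rV[C]_n :=
  polydisc eps `\` (coalescence_locus eps u0 `|` crossing_locus eps u0 tau).

Definition is_cell (eps : R) (u0 : 'rV[C]_n) (tau : R) (c : set 'rV[C]_n) : Prop :=
  exists2 t, cell_domain eps u0 tau t &
    c = connected_component (cell_domain eps u0 tau) t.

(* theta is the direction, on the universal covering, of a Stokes ray of
   diag u. *)
Definition stokes_direction u (theta : R) : Prop :=
  exists a b, u 0 a != u 0 b /\
    complex.Re ((u 0 a - u 0 b) * cis theta) = 0.

Definition admissible u (tau : R) : Prop := ~ stokes_direction u tau.

(* The sector containing S(tau - pi + k pi, tau + k pi) and extending up to the
   nearest Stokes rays of diag u outside it: everything, if there are none. *)
Definition sector_at u (tau : R) (k : int) : set C :=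
  [set w | forall theta, stokes_direction u theta ->
     (tau + k%:~R * pi <= theta -> carg w < theta) /\
     (theta <= tau - pi + k%:~R * pi -> theta < carg w)].

End Geometry.

Section Labelling.
Variable R : realType.
Local Notation C := (cplx R).

(* tau lists increasingly the directions of the Stokes rays of diag u0, mu of
   them in each half-open interval of length pi, and tt lies strictly between
   tau nu and tau (nu + 1). *)
Definition stokes_labelling (n : nat) (u0 : 'rV[C]_n) (tau : int -> R)
    (mu nu : int) (tt : R) : Prop :=
  [/\ (forall i j : int, i < j -> tau i < tau j),
      (forall theta, stokes_direction u0 theta <->
                     exists sigma, theta = tau sigma),
      (forall sigma, tau (sigma + mu) = tau sigma + pi)
    & tau nu < tt < tau (nu + 1)].

(* S(tau_sigma - pi, tau_(sigma+1)) if Lambda(0) has s >= 2 distinct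
   eigenvalues; the whole universal covering if s = 1, when there are no Stokes
   rays and tau is meaningless. *)
Definition sector0 (s : nat) (tau : int -> R) (sigma : int) : set C :=
  [set w | (1 < s)%N -> tau sigma - pi < carg w < tau (sigma + 1)].

Definition delta_ (s : nat) (lam : 'I_s -> C) (tt : R) (i j : 'I_s) : R :=
  2^-1 * inf [set complex.Re `|lam i - lam j + rho%:C * cis (eta_of tt)|
             | rho in [set: R]].

End Labelling.

Section System.
Variables (R : realType) (n : nat).
Local Notation C := (cplx R).

(* dY/dz = A Y reads dY/dw = e^w A Y in the coordinate w = log z. *)
Definition fundamental_solution (N0 : R) (A : C -> 'M[C]_n)
    (Y : C -> 'M[C]_n) : Prop :=
  forall w : C, outside N0 (cexp w) ->
    is_derive w 1 Y (cexp w *: (A (cexp w) *m Y w)) /\ Y w \in unitmx.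

Definition hatA (G0 : 'M[C]_n) (Aj : 'M[C]_n) : 'M[C]_n :=
  invmx G0 *m Aj *m G0.

(* The diagonal entries of B_1 = diag (G_0^-1 A_1 G_0). *)
Definition B1 (G0 A1 : 'M[C]_n) : 'rV[C]_n := \row_a hatA G0 A1 a a.

(* z^D for D = diag b. *)
Definition zpow (b : 'rV[C]_n) (w : C) : 'M[C]_n :=
  diag_mx (\row_a cexp (b 0 a * w)).

(* e^(D z) for D = diag u. *)
Definition expz (u : 'rV[C]_n) (w : C) : 'M[C]_n :=
  diag_mx (\row_a cexp (u 0 a * cexp w)).

(* Coefficients of I + sum_(k >= 1) F_k z^-k. *)
Definition with_id (F : nat -> 'M[C]_n) (k : nat) : 'M[C]_n :=
  if k is 0%N then 1%:M else F k.

(* G_0 P(z) z^(B_1) e^(Lambda z), with P = I + sum_(k >= 1) F_k z^-k, solves the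
   system with coefficients A_j as a formal series: P' + P (B_1 / z + Lambda) =
   (sum_j G_0^-1 A_j G_0 z^-j) P, compared at every power z^-m. *)
Definition formal_solution (Aj : nat -> 'M[C]_n) (G0 : 'M[C]_n)
    (u : 'rV[C]_n) (F : nat -> 'M[C]_n) : Prop :=
  let P := with_id F in
  forall m : nat,
    (if m is k.+1 then P k *m diag_mx (B1 G0 (Aj 1%N)) - k%:R *: P k else 0)
      + P m *m diag_mx u
    = \sum_(j < m.+1) hatA G0 (Aj j) *m P (m - j)%N.

(* M ~ I + sum_(j >= 1) F_j z^-j as z -> oo in the open sector D, that is,
   uniformly in every closed subsector alpha <= arg z <= beta of D. *)
Definition asymptotic_in (D : set C) (F : nat -> 'M[C]_n)
    (M : C -> 'M[C]_n) : Prop :=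
  forall (alpha beta : R),
    (forall w : C, alpha <= carg w <= beta -> D w) ->
    forall N : nat, exists K r : R, 0 < r /\
      forall w : C, alpha <= carg w <= beta -> outside r (cexp w) ->
        `|M w - (1%:M + \sum_(1 <= j < N.+1) (cexp w) ^- j *: F j)|
          <= K%:C * `|cexp w| ^- N.+1.

(* Y e^(- Lambda z) z^(- B_1) *)
Definition strip (u b : 'rV[C]_n) (Y : C -> 'M[C]_n) (w : C) : 'M[C]_n :=
  Y w *m expz (- u) w *m zpow (- b) w.

Definition canonical_solution (N0 : R) (A : C -> 'M[C]_n)
    (G0 : 'M[C]_n) (u b : 'rV[C]_n) (F : nat -> 'M[C]_n) (D : set C)
    (Y : C -> 'M[C]_n) : Prop :=
  fundamental_solution N0 A Y /\
  asymptotic_in D F (fun w => invmx G0 *m strip u b Y w).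

Definition stokes_matrix (N0 : R) (Y Y' : C -> 'M[C]_n) (S : 'M[C]_n) : Prop :=
  forall w : C, outside N0 (cexp w) -> Y' w = Y w *m S.

End System.

(* Main.v *)
(* With P the truncation at order N of I + sum_k F_k z^-k, put
   y = P^-1 G_0^-1 Y e^(- Lambda z) z^(- B_1). In the coordinate w = log z it solves
   y' = [e^w Lambda + B_1, y] + R with |R| <= K e^(- N Re w) |y|, where K does not
   depend on t near 0: the F_k are holomorphic at 0, and Cauchy's estimates
   control the A_j(t). For t in a cell the closed half-plane between the
   directions ttau + k pi - pi and ttau + k pi lies in S_(nu + k mu)(t), so y tends
   to I at both ends of every line z = e^(i theta) r (tan phi - i),
   theta = ttau + k pi. Integrating the entry (a, b) from the end towards which
   Re((u_a - u_b) z) increases gives |y - I| <= K' |z|^(-M) in closed subsectors of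
   the open half-plane, with K' independent of t. This bound passes to the limit
   t -> 0 within a cell, which exists by hypothesis 2) and solves the system at
   t = 0. There no Stokes ray lies between the half-plane and the sides of
   S_(nu + k mu), and integration along logarithmic spirals extends the asymptotics
   to this sector. Solutions with given asymptotics in a closed half-plane being
   unique, the limit is the same for all cells. Hence Y_k^-1 Y_(k+1), taken at one
   z, converges along each cell, and only finitely many cells come near t = 0: a
   cell is determined there by the signs of Re((u_a - u_b) e^(i ttau)). *)

Require Import Defs.
From mathcomp Require Import ring lra zify.
Import Normc.

Set Implicit Arguments.
Unset Strict Implicit.
Unset Printing Implicit Defensive.

Local Open Scope classical_set_scope.
Local Open Scope ring_scope.
Local Open Scope complex_scope.

(** * Moduli and matrix norms *)

Section Modulus.
Variable R : realType.
Local Notation C := (cplx R).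
Implicit Types x y z w : C.

(** As t tends to 0, the differences u_a - u_b inside one block tend to 0 in uncontrolled
    directions, and so do the constants in the asymptotics at t escape control. Hence no estimate
    may rest on a lower bound for |u_a - u_b|, and the asymptotics at t may enter only
    qualitatively. Lines parallel to the edge of the half-plane meet both demands: on them Re((u_a -
    u_b) z) is affine in the position, so it is monotone however small u_a - u_b is, and the decay
    at the ends only kills a boundary term whose size is irrelevant. What is left of the integrating
    factor is the power z^(b_a - b_b); with B a bound for these differences, it costs a number of
    powers of |z| depending on B alone, and N is arbitrary. The factor |y| in the remainder is
    absorbed: the supremum S of |z|^(-B) |y| over a line satisfies S <= n + S/2, once it is known to
    be finite. Spirals need instead that Re((u_a - u_b) z) has no zero in the sector unless u_a =
    u_b, and so are reserved for t = 0. Integrals are replaced by the mean value inequality. *)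

Definition cn (z : C) : R := normc z.

(** The norm of [cplx R] is itself complex-valued. Estimates are carried by the real number [cn z]
    instead, so that they are inequalities in the ordered field [R]. *)
Lemma normE z : `|z| = (cn z)%:C :> C.
Proof. by []. Qed.

Lemma cn_le z (a : R) : (`|z| <= a%:C :> C) = (cn z <= a).
Proof. by rewrite normE; exact: lecR. Qed.

Lemma cn_lt z (a : R) : (`|z| < a%:C :> C) = (cn z < a).
Proof. by rewrite normE; exact: ltcR. Qed.

Lemma cn_ge z (a : R) : (a%:C <= `|z| :> C) = (a <= cn z).
Proof. by rewrite normE; exact: lecR. Qed.

Lemma cn_ge0 z : 0 <= cn z.
Proof. by rewrite -cn_ge; exact: normr_ge0. Qed.

Lemma cn0 : cn 0 = 0.
Proof. exact: normc0. Qed.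

Lemma cn1 : cn 1 = 1.
Proof. exact: normc1. Qed.

Lemma cnM x y : cn (x * y) = cn x * cn y.
Proof. exact: normcM. Qed.

Lemma cnD x y : cn (x + y) <= cn x + cn y.
Proof. exact: le_normcD. Qed.

Lemma cnN x : cn (- x) = cn x.
Proof. exact: normcN. Qed.

Lemma cnB x y : cn (x - y) <= cn x + cn y.
Proof. by rewrite -(cnN y); exact: cnD. Qed.

Lemma cn_distC x y : cn (x - y) = cn (y - x).
Proof. by rewrite -cnN opprB. Qed.

Lemma cnV x : cn x^-1 = (cn x)^-1.
Proof. exact: normcV. Qed.

Lemma cnX x m : cn (x ^+ m) = cn x ^+ m.
Proof. by elim: m => [|m IH]; rewrite ?expr0 ?cn1// !exprS cnM IH. Qed.

Lemma cn_eq0 x : (cn x == 0) = (x == 0).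
Proof. by apply/eqP/eqP => [|->]; [exact: eq0_normc | exact: cn0]. Qed.

Lemma cn_gt0 x : (0 < cn x) = (x != 0).
Proof. by rewrite lt_def cn_ge0 andbT cn_eq0. Qed.

Lemma cn_real (a : R) : cn a%:C = `|a|.
Proof. by rewrite /cn /= expr0n /= addr0 sqrtr_sqr. Qed.

Lemma cn_nat m : cn m%:R = m%:R.
Proof.
have -> : (m%:R : C) = (m%:R : R)%:C by rewrite rmorph_nat.
by rewrite cn_real ger0_norm.
Qed.

Lemma cn_sum (I : Type) (r : seq I) (P : pred I) (F : I -> C) :
  cn (\sum_(i <- r | P i) F i) <= \sum_(i <- r | P i) cn (F i).
Proof.
elim/big_rec2 : _ => [|i y1 y2 _ h]; first by rewrite cn0.
by apply: le_trans (cnD _ _) _; rewrite lerD2l.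
Qed.

Lemma ReD x y : complex.Re (x + y) = complex.Re x + complex.Re y.
Proof. by case: x y => ? ? [? ?]. Qed.

Lemma ImD x y : complex.Im (x + y) = complex.Im x + complex.Im y.
Proof. by case: x y => ? ? [? ?]. Qed.

Lemma ReN x : complex.Re (- x) = - complex.Re x.
Proof. by case: x. Qed.

Lemma ImN x : complex.Im (- x) = - complex.Im x.
Proof. by case: x. Qed.

Lemma ReM x y : complex.Re (x * y) =
  complex.Re x * complex.Re y - complex.Im x * complex.Im y.
Proof. by case: x y => ? ? [? ?]. Qed.

Lemma ImM x y : complex.Im (x * y) =
  complex.Re x * complex.Im y + complex.Im x * complex.Re y.
Proof. by case: x y => ? ? [? ?]. Qed.

Lemma cplx_eqP x y :
  complex.Re x = complex.Re y -> complex.Im x = complex.Im y -> x = y.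
Proof. by case: x y => ? ? [? ?] /= -> ->. Qed.

Lemma sqr_cn x : cn x ^+ 2 = complex.Re x ^+ 2 + complex.Im x ^+ 2.
Proof. by case: x => a b; rewrite /cn /= sqr_sqrtr // addr_ge0 ?sqr_ge0. Qed.

Lemma Re_le_cn x : `|complex.Re x| <= cn x.
Proof.
rewrite -(@ler_pXn2r _ 2)// ?nnegrE ?normr_ge0 ?cn_ge0//.
by rewrite real_normK ?num_real// sqr_cn lerDl sqr_ge0.
Qed.

Lemma Im_le_cn x : `|complex.Im x| <= cn x.
Proof.
rewrite -(@ler_pXn2r _ 2)// ?nnegrE ?normr_ge0 ?cn_ge0//.
by rewrite real_normK ?num_real// sqr_cn lerDr sqr_ge0.
Qed.

Lemma cn_le_ReIm x : cn x <= `|complex.Re x| + `|complex.Im x|.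
Proof.
rewrite -(@ler_pXn2r _ 2)// ?nnegrE ?cn_ge0 ?addr_ge0//.
rewrite sqr_cn sqrrD !real_normK ?num_real//.
by rewrite addrAC lerDl mulrn_wge0 // mulr_ge0.
Qed.

Lemma cn_cexp w : cn (cexp w) = expR (complex.Re w).
Proof.
apply/eqP; rewrite -(@eqrXn2 _ 2)// ?cn_ge0 ?expR_ge0//.
by rewrite sqr_cn /= !exprMn -mulrDr cos2Dsin2 mulr1.
Qed.

Lemma cexpD x y : cexp (x + y) = cexp x * cexp y.
Proof.
case: x y => a b [c d]; apply: cplx_eqP; rewrite ?ReM ?ImM /= expRD ?cosD ?sinD; ring.
Qed.

Lemma cexp0 : cexp (0 : C) = 1.
Proof. by apply: cplx_eqP; rewrite /= expR0 ?cos0 ?sin0 ?mulr1 ?mulr0. Qed.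

Lemma cexp_neq0 x : cexp x != 0.
Proof. by rewrite -cn_gt0 cn_cexp expR_gt0. Qed.

Lemma cexpN x : cexp (- x) = (cexp x)^-1.
Proof.
apply: (mulfI (cexp_neq0 x)).
by rewrite -cexpD subrr cexp0 divff // cexp_neq0.
Qed.

Lemma cexpXn x m : cexp (m%:R * x) = cexp x ^+ m.
Proof.
elim: m => [|m IH]; first by rewrite mul0r cexp0 expr0.
by rewrite -natr1 mulrDl mul1r cexpD IH exprSr.
Qed.

Lemma outsideE (r : R) w : outside r (cexp w) = (r <= expR (complex.Re w)).
Proof. by rewrite /outside /= cn_ge cn_cexp. Qed.

Lemma outside_ln (r : R) w : 0 < r -> outside r (cexp w) = (ln r <= complex.Re w).
Proof. by move=> r0; rewrite outsideE -[r in LHS]lnK ?posrE // ler_expR. Qed.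

End Modulus.

Section MatrixNorm.
Variable R : realType.
Local Notation C := (cplx R).

(* The l1 norm of the entries: unlike the sup norm of the library it is
   submultiplicative. *)
Definition nm p q (M : 'M[C]_(p, q)) : R := \sum_i \sum_j cn (M i j).

Lemma nm_ge0 p q (M : 'M[C]_(p, q)) : 0 <= nm M.
Proof. by apply: sumr_ge0 => i _; apply: sumr_ge0 => j _; exact: cn_ge0. Qed.

Lemma nm0 p q : nm (0 : 'M[C]_(p, q)) = 0.
Proof. by rewrite /nm big1// => i _; rewrite big1// => j _; rewrite mxE cn0. Qed.

Lemma nmD p q (M N : 'M[C]_(p, q)) : nm (M + N) <= nm M + nm N.
Proof.
rewrite /nm -big_split /=; apply: ler_sum => i _.
rewrite -big_split /=; apply: ler_sum => j _.
by rewrite mxE; exact: cnD.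
Qed.

Lemma nmN p q (M : 'M[C]_(p, q)) : nm (- M) = nm M.
Proof. by apply: eq_bigr => i _; apply: eq_bigr => j _; rewrite mxE cnN. Qed.

Lemma nmB p q (M N : 'M[C]_(p, q)) : nm (M - N) <= nm M + nm N.
Proof. by rewrite -(nmN N); exact: nmD. Qed.

Lemma nm_distC p q (M N : 'M[C]_(p, q)) : nm (M - N) = nm (N - M).
Proof. by rewrite -nmN opprB. Qed.

Lemma nmZ p q a (M : 'M[C]_(p, q)) : nm (a *: M) = cn a * nm M.
Proof.
rewrite /nm mulr_sumr; apply: eq_bigr => i _; rewrite mulr_sumr.
by apply: eq_bigr => j _; rewrite mxE cnM.
Qed.

Lemma nm_entry p q (M : 'M[C]_(p, q)) i j : cn (M i j) <= nm M.
Proof.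
rewrite /nm (bigD1 i) //= (bigD1 j) //= -addrA lerDl addr_ge0 //.
  by apply: sumr_ge0 => k _; exact: cn_ge0.
by apply: sumr_ge0 => k _; apply: sumr_ge0 => l _; exact: cn_ge0.
Qed.

Lemma nmM p q r (M : 'M[C]_(p, q)) (N : 'M[C]_(q, r)) :
  nm (M *m N) <= nm M * nm N.
Proof.
rewrite {1 2}/nm mulr_suml; apply: ler_sum => i _.
apply: (@le_trans _ _ (\sum_j \sum_k cn (M i k) * cn (N k j))).
  apply: ler_sum => j _; rewrite mxE.
  apply: le_trans (cn_sum _ _ _) _.
  by apply: ler_sum => k _; rewrite cnM.
rewrite exchange_big /= mulr_suml; apply: ler_sum => k _.
rewrite -mulr_sumr ler_wpM2l ?cn_ge0 //.
rewrite /nm (bigD1 k) //= lerDl.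
by apply: sumr_ge0 => l _; apply: sumr_ge0 => ? _; exact: cn_ge0.
Qed.

Lemma nm_sum p q (I : Type) (r : seq I) (P : pred I) (F : I -> 'M[C]_(p, q)) :
  nm (\sum_(i <- r | P i) F i) <= \sum_(i <- r | P i) nm (F i).
Proof.
elim/big_rec2 : _ => [|i y1 y2 _ h]; first by rewrite nm0.
by apply: le_trans (nmD _ _) _; rewrite lerD2l.
Qed.

Lemma nm1 n : nm (1%:M : 'M[C]_n) = n%:R.
Proof.
rewrite /nm (eq_bigr (fun=> 1)) ?sumr_const ?card_ord // => i _.
rewrite (bigD1 i) //= mxE eqxx cn1 big1 ?addr0 // => j ji.
by rewrite mxE eq_sym (negPf ji) cn0.
Qed.

Lemma nm_eq0 p q (M : 'M[C]_(p, q)) : nm M <= 0 -> M = 0.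
Proof.
move=> h; apply/matrixP => i j; rewrite mxE; apply/eqP; rewrite -cn_eq0.
by rewrite eq_le cn_ge0 andbT; apply: le_trans h; exact: nm_entry.
Qed.

Lemma nm_le_entry p q (M : 'M[C]_(p, q)) (e : R) :
  (forall i j, cn (M i j) <= e) -> nm M <= (p * q)%:R * e.
Proof.
move=> h; apply: (@le_trans _ _ (\sum_(i < p) \sum_(j < q) e)).
  by apply: ler_sum => i _; apply: ler_sum => j _.
by rewrite sumr_const card_ord sumr_const card_ord -mulrnA mulr_natl mulnC.
Qed.

Lemma entry_le_norm p q (M : 'M[C]_(p, q)) i j : (`|M i j| <= `|M| :> C).
Proof.
rewrite [leRHS]/Num.norm /= mx_normE.
have -> : `|M i j| = (`|M i j|%:nng)%:num :> C by [].
rewrite num_le.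
by apply/bigmax_geP; right => /=; exists (i, j).
Qed.

Lemma norm_le_nm p q (M : 'M[C]_(p, q)) : (`|M| <= (nm M)%:C :> C).
Proof.
have [->|M0] := eqVneq M 0; first by rewrite nm0 normr0.
have [|[i j]] := @mx_norm_neq0 _ _ _ M; first by rewrite -[mx_norm M]/(`|M|) normr_eq0.
by rewrite -[mx_norm M]/(`|M|) => -> /=; rewrite cn_le; exact: nm_entry.
Qed.

Lemma nm_le_norm p q (M : 'M[C]_(p, q)) (e : R) :
  (`|M| <= e%:C :> C) -> nm M <= (p * q)%:R * e.
Proof.
by move=> h; apply: nm_le_entry => i j; rewrite -cn_le; apply: le_trans h; exact: entry_le_norm.
Qed.

Lemma real_norm p q (M : 'M[C]_(p, q)) : exists2 a : R, 0 <= a & `|M| = a%:C :> C.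
Proof.
have := normr_ge0 M; case: (`|M|) => a b; rewrite lecE /= => /andP[/eqP -> a0].
by exists a.
Qed.

End MatrixNorm.

(** * Derivatives of matrix functions and paths *)

Section Derivatives.
Variable R : realType.
Local Notation C := (cplx R).

Lemma posC (e : C) : 0 < e -> exists2 r : R, 0 < r & e = r%:C.
Proof.
case: e => a b; rewrite ltcE /= => /andP[/eqP -> a0].
by exists a.
Qed.

(** This form has no division by [h], so [h = 0] is no exception in later estimates; a general field
    [K] covers real and complex derivatives at once. *)
Lemma is_derive_epsP (K : numFieldType) (W : normedModType K) (f : K -> W) (w : K) (d : W) :
  is_derive w 1 f d <->
  forall e : K, 0 < e -> exists2 dl : K, 0 < dl &
    forall h : K, `|h| < dl -> `|f (w + h) - f w - h *: d| <= e * `|h|.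
Proof.
have key : (h^-1 *: (f (h *: 1 + w) - f w) @[h --> (0 : K)^'] --> d) <->
  forall e : K, 0 < e -> exists2 dl : K, 0 < dl &
    forall h : K, `|h| < dl -> `|f (w + h) - f w - h *: d| <= e * `|h|.
  split.
    move=> /cvgrPdist_le H e /H /nbhs_ballP[dl /= dl0 Hd].
    exists dl => // h hd.
    have [->|h0] := eqVneq h 0.
      by rewrite addr0 subrr scale0r subr0 !normr0 mulr0.
    have := Hd h; rewrite /ball /= sub0r normrN => /(_ hd h0) /=.
    have -> : f (w + h) - f w - h *: d = - (h *: (d - h^-1 *: (f (h *: 1 + w) - f w))).
      rewrite [h *: 1]mulr1 [h + w]addrC; move: (f (w + h) - f w) => k.
      by rewrite scalerBr scalerA divff // scale1r opprB.
    by rewrite normrN normrZ [e * _]mulrC => ?; rewrite ler_wpM2l.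
  move=> H; apply/cvgrPdist_le => e e0.
  have [dl dl0 Hd] := H e e0.
  apply/nbhs_ballP; exists dl => //= h; rewrite /ball /= sub0r normrN => hd h0.
  have -> : d - h^-1 *: (f (h *: 1 + w) - f w) =
      - (h^-1 *: (f (w + h) - f w - h *: d)).
    rewrite [h *: 1]mulr1 [h + w]addrC; move: (f (w + h) - f w) => k.
    by rewrite scalerBr scalerA mulVf // scale1r opprB.
  rewrite normrN normrZ normfV ler_pdivrMl ?normr_gt0 // [`|h| * _]mulrC.
  exact: Hd.
rewrite -key; split=> [[fd <-]|H]; first exact: fd.
by apply: DeriveDef; [exact: cvgP H | exact: cvg_lim H].
Qed.

Lemma is_derive_edP (W : normedModType C) (f : C -> W) (w : C) (d : W) :
  is_derive w 1 f d <->
  forall e : R, 0 < e -> exists2 dl : R, 0 < dl &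
    forall h : C, cn h < dl -> `|f (w + h) - f w - h *: d| <= e%:C * `|h| :> C.
Proof.
rewrite is_derive_epsP; split=> H.
  move=> e e0; have [|_ /posC[dl dl0 ->] Hd] := H e%:C; first by rewrite ltcR.
  by exists dl => // h hd; apply: Hd; exact: (etrans (cn_lt _ _) hd).
move=> _ /posC[e e0 ->]; have [dl dl0 Hd] := H e e0.
by exists dl%:C => [|h hd]; [rewrite ltcR | apply: Hd; rewrite -cn_lt].
Qed.

Lemma is_deriveP (f : C -> C) (w d : C) :
  is_derive w 1 f d <->
  forall e : R, 0 < e -> exists2 dl : R, 0 < dl &
    forall h : C, cn h < dl -> cn (f (w + h) - f w - h * d) <= e * cn h.
Proof.
rewrite is_derive_edP; split=> H e /H [dl dl0 Hd]; exists dl => // h /Hd.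
  by rewrite [`|h|]normE -rmorphM /= cn_le.
by rewrite [`|h|]normE -rmorphM /= cn_le.
Qed.

Definition mder p q (f : C -> 'M[C]_(p, q)) (w : C) (D : 'M[C]_(p, q)) :=
  forall i j, is_derive w 1 (fun w => f w i j) (D i j).

Lemma mderP p q (f : C -> 'M[C]_(p, q)) (w : C) D : is_derive w 1 f D <-> mder f w D.
Proof.
split.
  move=> /is_derive_edP H i j; apply/is_derive_edP => e /H[dl dl0 Hd].
  exists dl => // h /Hd; apply: le_trans.
  by have := entry_le_norm (f (w + h) - f w - h *: D) i j; rewrite !mxE.
move=> H; apply/is_derive_edP => e e0.
have pq0 : 0 < (p * q).+1%:R :> R by rewrite ltr0n.
have : forall ij : 'I_p * 'I_q, exists dl : R, 0 < dl /\ forall h : C, cn h < dl ->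
    cn ((f (w + h) - f w - h *: D) ij.1 ij.2) <= e / (p * q).+1%:R * cn h.
  case=> i j; have [|dl dl0 Hd] := (is_deriveP _ _ _).1 (H i j) (e / (p * q).+1%:R).
    by rewrite divr_gt0.
  by exists dl; split=> // h /Hd; rewrite !mxE.
move=> /choice[dl Hdl].
exists (\big[Order.min/1]_(ij : 'I_p * 'I_q) dl ij).
  by apply/bigmin_gtP; split=> // ij _; exact: (Hdl ij).1.
move=> h /bigmin_gtP[_ hd].
apply: le_trans (norm_le_nm _) _.
rewrite [`|h|]normE -rmorphM /= lecR.
apply: (@le_trans _ _ ((p * q)%:R * (e / (p * q).+1%:R * cn h))).
  by apply: nm_le_entry => i j; exact: ((Hdl (i, j)).2 h (hd (i, j) isT)).
rewrite !mulrA ler_wpM2r ?cn_ge0 // ler_pdivrMr // mulrC ler_pM2l //.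
by rewrite ler_nat.
Qed.

Lemma is_derive_contP (f : C -> C) (w d : C) : is_derive w 1 f d ->
  forall e : R, 0 < e -> exists2 dl : R, 0 < dl &
    forall h : C, cn h < dl -> cn (f (w + h) - f w) <= e.
Proof.
move=> /is_deriveP H e e0.
have [dl dl0 Hd] := H 1 ltr01.
have K0 : 0 < 1 + cn d by rewrite ltr_pwDl ?cn_ge0.
exists (Order.min dl (e / (1 + cn d))); first by rewrite lt_min dl0 divr_gt0.
move=> h; rewrite lt_min => /andP[/Hd h1 h2].
rewrite -(subrK (h * d) (f _ - _)).
apply: le_trans (cnD _ _) _; rewrite cnM.
move: h2; rewrite ltr_pdivlMr // => h2; nra.
Qed.

Lemma is_derive_compC (f g : C -> C) (w a b : C) :
  is_derive (g w) 1 f a -> is_derive w 1 g b ->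
  is_derive w 1 (fun w => f (g w)) (a * b).
Proof.
move=> fa gb; apply/is_deriveP => e e0.
have /is_deriveP Hf := fa; have /is_deriveP Hg := gb.
have B0 : 0 < 1 + cn b by rewrite ltr_pwDl ?cn_ge0.
have A0 : 0 < 1 + cn a by rewrite ltr_pwDl ?cn_ge0.
have e10 : 0 < e / 2 / (1 + cn b) by rewrite !divr_gt0.
have [d1 d10 H1] := Hf _ e10.
(* The bound 1 makes the increment of [g] at most [(1 + cn b) * cn h]; the other bound is the share
   of [e] left after multiplication by [a]. *)
have e20 : 0 < Order.min 1 (e / 2 / (1 + cn a)) by rewrite lt_min ltr01 !divr_gt0.
have [d2 d20 H2] := Hg _ e20.
have [d3 d30 H3] := is_derive_contP gb (divr_gt0 d10 (ltr0Sn R 1)).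
exists (Order.min d2 d3); first by rewrite lt_min d20.
move=> h; rewrite lt_min => /andP[hd2 hd3].
have /H1 : cn (g (w + h) - g w) < d1.
  by apply: le_lt_trans (H3 h hd3) _; lra.
rewrite [g w + _]addrC subrK; set k := g (w + h) - g w => h1.
have := H2 h hd2; rewrite -/k => h2.
have h0 := cn_ge0 h.
have h2a : cn (k - h * b) <= e / 2 / (1 + cn a) * cn h.
  by apply: le_trans h2 _; rewrite ler_wpM2r // ge_min lexx orbT.
have kb : cn k <= (1 + cn b) * cn h.
  rewrite -(subrK (h * b) k); apply: le_trans (cnD _ _) _; rewrite cnM.
  have : cn (k - h * b) <= 1 * cn h.
    by apply: le_trans h2 _; rewrite ler_wpM2r // ge_min lexx.
  lra.
have -> : f (g (w + h)) - f (g w) - h * (a * b) =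
  (f (g (w + h)) - f (g w) - k * a) + (k - h * b) * a by ring.
apply: le_trans (cnD _ _) _; rewrite cnM.
have : e / 2 / (1 + cn b) * cn k <= e / 2 * cn h.
  by rewrite -[X in _ <= X * _](divfK (lt0r_neq0 B0)) -[leRHS]mulrA ler_wpM2l // ltW.
have : cn (k - h * b) * cn a <= e / 2 * cn h.
  apply: le_trans (_ : e / 2 / (1 + cn a) * cn h * (1 + cn a) <= _).
    by apply: ler_pM; rewrite ?cn_ge0 // lerDr.
  by rewrite mulrAC divfK ?lt0r_neq0.
lra.
Qed.

Lemma real_der_edP (f : R -> R) (x d : R) :
  is_derive x 1 f d <->
  forall e : R, 0 < e -> exists2 dl : R, 0 < dl &
    forall h : R, `|h| < dl -> `|f (x + h) - f x - h * d| <= e * `|h|.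
Proof. exact: is_derive_epsP. Qed.

(** [cexp] is built from real functions, so its derivative is computed by hand only at 0; [cexpD]
    carries it to every other point. *)
Lemma is_derive_cexp0 : is_derive (0 : C) 1 (@cexp R) 1.
Proof.
apply/is_deriveP => e e0.
have e4 : 0 < e / 8 by rewrite divr_gt0.
have [d1 d10 H1] := (real_der_edP _ _ _).1 (is_derive_expR (0 : R)) _ e4.
have [d2 d20 H2] := (real_der_edP _ _ _).1 (is_derive_cos (0 : R)) _ e4.
have [d3 d30 H3] := (real_der_edP _ _ _).1 (is_derive_sin (0 : R)) _ e4.
(* This radius absorbs the term [x * sin y], which is of second order in [h]. *)
pose d5 : R := Order.min 1 (e / 8).
exists (Order.min d1 (Order.min d2 (Order.min d3 d5))).
  by rewrite !lt_min d10 d20 d30 e4 ltr01.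
move=> h; rewrite !lt_min => /and5P[h1 h2 h3 h5 h6].
have Re := Re_le_cn h; have Im := Im_le_cn h.
set n := cn h in h1 h2 h3 h5 h6 Re Im *.
set x := complex.Re h in Re; set y := complex.Im h in Im.
have := H1 x (le_lt_trans Re h1); have := H2 y (le_lt_trans Im h2).
have := H3 y (le_lt_trans Im h3).
rewrite !add0r expR0 cos0 sin0 oppr0 mulr0 !mulr1 ?addr0 ?subr0 => hs hc he.
apply: le_trans (cn_le_ReIm _) _.
have -> : complex.Re (cexp h - cexp 0 - h) =
   (expR x - 1 - x) * cos y + (1 + x) * (cos y - 1).
  by rewrite cexp0 !ReD !ReN /= -/x -/y; ring.
have -> : complex.Im (cexp h - cexp 0 - h) =
   (expR x - 1 - x) * sin y + x * sin y + (sin y - y).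
  by rewrite cexp0 !ImD !ImN /= -/x -/y; ring.
have cosy : `|cos y| <= 1 by rewrite ler_norml cos_geN1 cos_le1.
have siny : `|sin y| <= 1 by rewrite ler_norml sin_geN1 sin_le1.
have x1 : `|1 + x| <= 2 by apply: le_trans (ler_normD _ _) _; rewrite normr1; lra.
have n0 : 0 <= n := cn_ge0 h.
have hs2 : `|sin y| <= (1 + e / 8) * n.
  rewrite -(subrK y (sin y)); apply: le_trans (ler_normD _ _) _.
  have : e / 8 * `|y| <= e / 8 * n by rewrite ler_wpM2l // ltW.
  lra.
have a1 : `|expR x - 1 - x| <= e / 8 * n.
  by apply: le_trans he _; rewrite ler_wpM2l // ltW.
have a2 : `|cos y - 1| <= e / 8 * n.
  by apply: le_trans hc _; rewrite ler_wpM2l // ltW.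
have a3 : `|sin y - y| <= e / 8 * n.
  by apply: le_trans hs _; rewrite ler_wpM2l // ltW.
have b1 : `|(expR x - 1 - x) * cos y| <= e / 8 * n.
  by rewrite normrM -[leRHS]mulr1; apply: ler_pM.
have b2 : `|(1 + x) * (cos y - 1)| <= 2 * (e / 8 * n).
  by rewrite normrM; apply: ler_pM.
have b3 : `|(expR x - 1 - x) * sin y| <= e / 8 * n.
  by rewrite normrM -[leRHS]mulr1; apply: ler_pM.
have b4 : `|x * sin y| <= 2 * (e / 8 * n).
  rewrite normrM; apply: le_trans (_ : n * ((1 + e / 8) * n) <= _).
    by apply: ler_pM.
  have : n * n <= e / 8 * n by rewrite ler_wpM2r // ltW.
  have : e / 8 * n * n <= e / 8 * n by rewrite ler_piMr ?mulr_ge0 // ltW.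
  lra.
have := ler_normD ((expR x - 1 - x) * cos y) ((1 + x) * (cos y - 1)).
have := ler_normD ((expR x - 1 - x) * sin y + x * sin y) (sin y - y).
have := ler_normD ((expR x - 1 - x) * sin y) (x * sin y).
have : 0 <= e / 8 * n by rewrite mulr_ge0 // ltW.
lra.
Qed.

End Derivatives.

(** * Mean value inequalities along paths *)

Section Paths.
Variable R : realType.
Local Notation C := (cplx R).

Lemma is_derive_cexp (w : C) : is_derive w 1 (@cexp R) (cexp w).
Proof.
apply/is_deriveP => e e0.
have W0 : 0 < cn (cexp w) by rewrite cn_cexp expR_gt0.
have [d d0 Hd] := (is_deriveP _ _ _).1 (is_derive_cexp0 R) _ (divr_gt0 e0 W0).
exists d => // h /Hd; rewrite add0r cexp0 mulr1 => H.
have -> : cexp (w + h) - cexp w - h * cexp w = cexp w * (cexp h - 1 - h).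
  by rewrite cexpD; ring.
rewrite cnM; apply: le_trans (ler_wpM2l (cn_ge0 _) H) _.
by rewrite mulrA [_ * (e / _)]mulrC divfK // lt0r_neq0.
Qed.

(** Multiplying by a constant [e] and taking the real part turns a complex function on a path into a
    real function of one variable, to which the real mean value theorem applies. *)
Lemma path_derive (g : C -> C) (g' e : C) (pr pi : R -> R) (dr di s : R) :
  is_derive s 1 pr dr -> is_derive s 1 pi di ->
  is_derive ((pr s +i* pi s) : C) 1 g g' ->
  is_derive s 1 (fun s => complex.Re (e * g (pr s +i* pi s)))
    (complex.Re (e * (g' * (dr +i* di)))).
Proof.
move=> Hr Hi Hg; apply/real_der_edP => eps eps0.
pose M := 1 + cn e; pose N := 1 + cn g'; pose Q := 1 + `|dr| + `|di|.
have M0 : 0 < M by rewrite ltr_pwDl ?cn_ge0.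
have N0 : 0 < N by rewrite ltr_pwDl ?cn_ge0.
have Q0 : 0 < Q by rewrite /Q -addrA ltr_pwDl ?addr_ge0.
have Q1 : 0 < Q + 1 by lra.
have e10 : 0 < eps / (2 * M * (Q + 1)) by do ?[apply: divr_gt0 | apply: mulr_gt0].
have [d1 d10 H1] := (is_deriveP _ _ _).1 Hg _ e10.
pose e2 := Order.min 1 (eps / (2 * M * N)) / 2.
have e20 : 0 < e2 by rewrite divr_gt0 // lt_min ltr01; do ?[apply: divr_gt0 | apply: mulr_gt0].
have e21 : 2 * e2 <= 1 by rewrite /e2 mulrC divfK // ge_min lexx.
have e22 : 2 * e2 * (M * N) <= eps / 2.
  rewrite /e2 [2 * _]mulrC divfK //.
  apply: le_trans (_ : eps / (2 * M * N) * (M * N) <= _).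
    by apply: ler_wpM2r; [rewrite mulr_ge0 // ltW | rewrite ge_min lexx orbT].
  have -> : eps / (2 * M * N) * (M * N) = eps / 2 by field; rewrite !lt0r_neq0.
  by [].
have [d2 d20 H2] := (real_der_edP _ _ _).1 Hr _ e20.
have [d3 d30 H3] := (real_der_edP _ _ _).1 Hi _ e20.
have d40 : 0 < d1 / (Q + 1) by exact: divr_gt0.
exists (Order.min d2 (Order.min d3 (d1 / (Q + 1)))); first by rewrite !lt_min d20 d30.
move=> h; rewrite !lt_min => /and3P[/H2 h2 /H3 h3 h4].
pose k : C := (pr (s + h) - pr s) +i* (pi (s + h) - pi s).
pose l : C := dr +i* di.
have kl : cn (k - h%:C * l) <= 2 * e2 * `|h|.
  apply: le_trans (cn_le_ReIm _) _.
  have -> : complex.Re (k - h%:C * l) = pr (s + h) - pr s - h * dr.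
    by rewrite /= mul0r subr0.
  have -> : complex.Im (k - h%:C * l) = pi (s + h) - pi s - h * di.
    by rewrite /= mul0r addr0.
  lra.
have cnl : cn l <= Q - 1.
  by apply: le_trans (cn_le_ReIm _) _; rewrite /= /Q; lra.
have ck : cn k <= (Q + 1) * `|h|.
  rewrite -(subrK (h%:C * l) k); apply: le_trans (cnD _ _) _.
  rewrite cnM cn_real.
  have : 2 * e2 * `|h| <= 1 * `|h| by rewrite ler_wpM2r.
  have : `|h| * cn l <= `|h| * (Q - 1) by rewrite ler_wpM2l.
  have := normr_ge0 h; lra.
have kd : cn k < d1.
  by apply: le_lt_trans ck _; rewrite mulrC -ltr_pdivlMr.
have := H1 k kd.
have -> : (pr s +i* pi s : C) + k = (pr (s + h) +i* pi (s + h)).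
  by rewrite /k; apply: cplx_eqP; rewrite /= addrC subrK.
set G1 := g (pr (s + h) +i* pi (s + h)); set G0 := g (pr s +i* pi s) => H.
have -> : complex.Re (e * G1) - complex.Re (e * G0) - h * complex.Re (e * (g' * l)) =
   complex.Re (e * ((G1 - G0 - k * g') + (k - h%:C * l) * g')).
  have -> : h * complex.Re (e * (g' * l)) = complex.Re (h%:C * (e * (g' * l)) : C).
    by rewrite [in RHS]ReM /= mul0r subr0.
  rewrite -!ReN -!ReD; congr complex.Re; ring.
apply: le_trans (Re_le_cn _) _; rewrite cnM.
have A1 : cn (G1 - G0 - k * g') <= eps / (2 * M) * `|h|.
  apply: le_trans H _.
  apply: le_trans (ler_wpM2l (ltW e10) ck) _.
  rewrite le_eqVlt; apply/orP; left; apply/eqP; field.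
  by rewrite !lt0r_neq0.
have A2 : cn ((k - h%:C * l) * g') <= 2 * e2 * `|h| * N.
  by rewrite cnM; apply: ler_pM; rewrite ?cn_ge0 // /N lerDr.
apply: le_trans (ler_wpM2l (cn_ge0 _) (cnD _ _)) _.
apply: le_trans (_ : M * (eps / (2 * M) * `|h| + 2 * e2 * `|h| * N) <= _).
  by apply: ler_pM; rewrite ?cn_ge0 ?addr_ge0 ?cn_ge0 ?lerD // /M lerDr.
rewrite mulrDr.
have -> : M * (eps / (2 * M) * `|h|) = eps / 2 * `|h| by field; rewrite lt0r_neq0.
have : 2 * e2 * (M * N) * `|h| <= eps / 2 * `|h| by rewrite ler_wpM2r.
have -> : 2 * e2 * (M * N) * `|h| = M * (2 * e2 * `|h| * N) by ring.
lra.
Qed.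

Lemma MVT_derivable (f df : R -> R) (a b : R) : a <= b ->
  (forall s, a <= s <= b -> is_derive s 1 f (df s)) ->
  exists2 c, a <= c <= b & f b - f a = df c * (b - a).
Proof.
move=> ab H; have [s|s|c cab E] := @MVT_segment R f df a b ab.
- by rewrite in_itv /= => /andP[/ltW s1 /ltW s2]; apply: H; rewrite s1.
- move: s; apply: derivable_within_continuous => s; rewrite in_itv /=.
  by move=> /H [].
by exists c => //; move: cab; rewrite in_itv.
Qed.

(** Let [e] be the conjugate of the total increment D. Then Re(e D) = |D|^2, while the mean value
    theorem bounds it by |D| times [A * (b - a)]. *)
Lemma mean_value_path (g g' : C -> C) (pr pi dr di : R -> R) (a b A : R) :
  a <= b ->
  (forall s, a <= s <= b -> [/\ is_derive s 1 pr (dr s), is_derive s 1 pi (di s),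
     is_derive (pr s +i* pi s : C) 1 g (g' (pr s +i* pi s)) &
     cn (g' (pr s +i* pi s) * (dr s +i* di s)) <= A]) ->
  cn (g (pr b +i* pi b) - g (pr a +i* pi a)) <= A * (b - a).
Proof.
move=> ab H; set D := g _ - g _.
have [D0|D0] := eqVneq D 0.
  rewrite D0 cn0 mulr_ge0 ?subr_ge0 //.
  have [|_ _ _] := H a; first by rewrite lexx.
  by apply: le_trans; exact: cn_ge0.
pose e : C := conjc D.
have [|c cab E] := @MVT_derivable (fun s => complex.Re (e * g (pr s +i* pi s)))
   (fun s => complex.Re (e * (g' (pr s +i* pi s) * (dr s +i* di s)))) a b ab.
  by move=> s /H[h1 h2 h3 _]; exact: path_derive.
have cne : cn e = cn D by rewrite /e; case: (D) => x y; rewrite /cn /= sqrrN.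
have : complex.Re (e * D) = cn D ^+ 2.
  by rewrite sqr_cn /e; case: (D) => x y /=; ring.
rewrite /D mulrBr ReD ReN E => E2.
have D1 : 0 < cn D by rewrite cn_gt0.
rewrite -(ler_pM2l D1) -expr2 -E2 [leRHS]mulrA ler_wpM2r ?subr_ge0 //.
apply: le_trans (ler_norm _) _; apply: le_trans (Re_le_cn _) _.
rewrite cnM cne ler_wpM2l ?cn_ge0 //.
by have [] := H c cab.
Qed.

Lemma is_derive_line (x d s : R) : is_derive s 1 (fun s : R => x + s * d) d.
Proof.
apply/real_der_edP => e e0; exists 1 => // h _.
have -> : x + (s + h) * d - (x + s * d) - h * d = 0 by ring.
by rewrite normr0 mulr_ge0 // ltW.
Qed.

Definition seg (w d : C) (s : R) : C :=
  (complex.Re w + s * complex.Re d) +i* (complex.Im w + s * complex.Im d).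

Lemma segE w d s : seg w d s = w + s%:C * d.
Proof. by apply: cplx_eqP; rewrite ?ReD ?ImD ?ReM ?ImM /= !mul0r ?subr0 ?addr0. Qed.

Lemma seg0 w d : seg w d 0 = w.
Proof. by rewrite segE mul0r addr0. Qed.

Lemma seg1 w d : seg w d 1 = w + d.
Proof. by rewrite segE mul1r. Qed.

Lemma mean_value_seg (g g' : C -> C) (w d : C) (A : R) :
  (forall s, 0 <= s <= 1 ->
     is_derive (seg w d s) 1 g (g' (seg w d s)) /\ cn (g' (seg w d s) * d) <= A) ->
  cn (g (w + d) - g w) <= A.
Proof.
move=> H; rewrite -(seg1 w d) -{2}(seg0 w d).
have := @mean_value_path g g' (fun s => complex.Re w + s * complex.Re d)
  (fun s => complex.Im w + s * complex.Im d) (fun=> complex.Re d)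
  (fun=> complex.Im d) 0 1 A ler01.
rewrite subr0 mulr1; apply=> s /H[h1 h2]; split => //.
- exact: is_derive_line.
- exact: is_derive_line.
by case: (d) h2.
Qed.

Lemma sqr_sum_le (I : finType) (a : I -> R) :
  (\sum_i a i) ^+ 2 <= #|I|%:R * \sum_i a i ^+ 2.
Proof.
have -> : #|I|%:R * \sum_i a i ^+ 2 = \sum_i \sum_j (a i ^+ 2 + a j ^+ 2) / 2.
  transitivity (\sum_i (#|I|%:R * a i ^+ 2 + \sum_j a j ^+ 2) / 2).
    rewrite -mulr_suml big_split /= -mulr_sumr sumr_const mulr_natl; lra.
  by apply: eq_bigr => i _; rewrite -mulr_suml big_split /= sumr_const mulr_natl.
rewrite expr2 mulr_suml; apply: ler_sum => i _.
rewrite mulr_sumr; apply: ler_sum => j _.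
by have := sqr_ge0 (a i - a j); rewrite sqrrB; lra.
Qed.

End Paths.

(** * Gronwall's inequality on a segment *)

Section Gronwall.
Variable R : realType.
Local Notation C := (cplx R).

(** [nm] is not differentiable, so the inequality is run on the sum [E] of the squared moduli of the
    entries: E' <= K E, hence E(s) e^(-K s) does not increase. [G] is chosen before [f]: one
    constant serves the solutions for all t near 0. *)
Lemma gronwall p q (L : R) : exists2 G : R, 0 <= G &
  forall (f D : C -> 'M[C]_(p, q)) (w d : C),
    (forall s : R, 0 <= s <= 1 -> mder f (seg w d s) (D (seg w d s)) /\
       nm (D (seg w d s)) * cn d <= L * nm (f (seg w d s))) ->
    nm (f (w + d)) <= G * nm (f w).
Proof.
pose I : finType := ('I_p * 'I_q)%type.
(* The 2 comes from differentiating squares, [#|I|] from the Cauchy-Schwarz inequality between [nm]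
   and [E]. *)
pose K : R := 2 * `|L| * #|I|%:R.
have K0 : 0 <= K by rewrite /K !mulr_ge0.
(* Any [G >= 0] with [#|I| * expR K <= G ^+ 2] works; this one avoids a square root. *)
exists (1 + #|I|%:R * expR K); first by rewrite addr_ge0 ?mulr_ge0 ?expR_ge0.
move=> f D w d H.
pose E (s : R) : R := \sum_(i : I) cn (f (seg w d s) i.1 i.2) ^+ 2.
have nmE (M : 'M[C]_(p, q)) : nm M = \sum_(i : I) cn (M i.1 i.2).
  by rewrite /nm pair_big.
pose E' (s : R) : R := \sum_(i : I) 2 * (complex.Re (f (seg w d s) i.1 i.2) *
    complex.Re (D (seg w d s) i.1 i.2 * d) +
    complex.Im (f (seg w d s) i.1 i.2) * complex.Im (D (seg w d s) i.1 i.2 * d)).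
have E0 s : 0 <= E s by apply: sumr_ge0 => i _; exact: sqr_ge0.
have dE (s : R) : 0 <= s <= 1 -> is_derive s 1 E (E' s).
  move=> /H[h _].
  have hi (i : I) : is_derive s 1 (fun s : R => cn (f (seg w d s) i.1 i.2) ^+ 2)
    (2 * (complex.Re (f (seg w d s) i.1 i.2) * complex.Re (D (seg w d s) i.1 i.2 * d) +
    complex.Im (f (seg w d s) i.1 i.2) * complex.Im (D (seg w d s) i.1 i.2 * d))).
    have hr := @path_derive R (fun w => f w i.1 i.2) _ 1 _ _ _ _ s
      (is_derive_line (complex.Re w) (complex.Re d) s)
      (is_derive_line (complex.Im w) (complex.Im d) s) (h i.1 i.2).
    (* Multiplication by -i turns the imaginary part into a real part. *)
    have him := @path_derive R (fun w => f w i.1 i.2) _ (0 -i* 1) _ _ _ _ s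
      (is_derive_line (complex.Re w) (complex.Re d) s)
      (is_derive_line (complex.Im w) (complex.Im d) s) (h i.1 i.2).
    have -> : (fun s : R => cn (f (seg w d s) i.1 i.2) ^+ 2) =
      (fun s : R => complex.Re (1 * f (seg w d s) i.1 i.2)) * (fun s : R => complex.Re (1 * f (seg w d s) i.1 i.2))
      + (fun s : R => complex.Re ((0 -i* 1) * f (seg w d s) i.1 i.2)) * (fun s : R => complex.Re ((0 -i* 1) * f (seg w d s) i.1 i.2)).
      apply/funext => x; rewrite sqr_cn !fctE /=.
      by rewrite !ReM /= mul1r; ring.
    have := is_deriveD (is_deriveM hr hr) (is_deriveM him him); move/is_derive_eq; apply.
    rewrite !ReM /= /GRing.scale /= !mul1r !mul0r; case: (d) => dx dy /=.
    by ring.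
  have -> : E = \sum_(i : I) (fun s : R => cn (f (seg w d s) i.1 i.2) ^+ 2).
    by apply/funext => x; rewrite fct_sumE.
  rewrite /E'; elim: (index_enum I) => [|i r IH].
    by rewrite !big_nil; exact: is_derive_cst.
  by rewrite !big_cons; apply: is_deriveD.
pose F (s : R) := E s * expR (- (K * s)).
have dF (s : R) : 0 <= s <= 1 -> is_derive s 1 F (expR (- (K * s)) * (E' s - K * E s)).
  move=> /dE hE.
  have he : is_derive s 1 (fun s : R => expR (- (K * s))) (- K * expR (- (K * s))).
    have h1 : is_derive s 1 (fun s : R => - (K * s)) (- K).
      have := is_derive_line 0 (- K) s.
      by under eq_fun do rewrite add0r mulrN mulrC.
    have := @is_derive1_comp R expR (fun s : R => - (K * s)) s _ _ (is_derive_expR _) h1.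
    by move/is_derive_eq; apply; rewrite mulrC.
  have := is_deriveM hE he.
  move/is_derive_eq; apply; rewrite /GRing.scale /=; ring.
have Cauchy s : nm (f (seg w d s)) ^+ 2 <= #|I|%:R * E s.
  by rewrite nmE; exact: sqr_sum_le.
have E'le (s : R) : 0 <= s <= 1 -> E' s <= K * E s.
  move=> /H[_ h].
  apply: (@le_trans _ _ (\sum_(i : I) 2 * (cn (f (seg w d s) i.1 i.2) * (`|L| * nm (f (seg w d s)))))).
    apply: ler_sum => i _; rewrite ler_pM2l //.
    apply: le_trans (_ : complex.Re (conjc (f (seg w d s) i.1 i.2) * (D (seg w d s) i.1 i.2 * d) : C) <= _).
      by rewrite [leRHS]ReM; case: (f _ _ _) => x y /=; rewrite mulNr opprK.
    apply: le_trans (ler_norm _) _; apply: le_trans (Re_le_cn _) _.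
    rewrite cnM.
    have -> : cn (conjc (f (seg w d s) i.1 i.2)) = cn (f (seg w d s) i.1 i.2).
      by case: (f _ _ _) => x y; rewrite /cn /= sqrrN.
    rewrite ler_wpM2l ?cn_ge0 // cnM.
    apply: le_trans (_ : nm (D (seg w d s)) * cn d <= _).
      by rewrite ler_wpM2r ?cn_ge0 // nm_entry.
    by apply: le_trans h _; rewrite ler_wpM2r ?nm_ge0 // ler_norm.
  rewrite -mulr_sumr -mulr_suml -nmE.
  have -> : 2 * (nm (f (seg w d s)) * (`|L| * nm (f (seg w d s)))) =
    2 * `|L| * nm (f (seg w d s)) ^+ 2 by ring.
  by rewrite /K -[leRHS]mulrA ler_wpM2l ?mulr_ge0.
have [c c01] := MVT_derivable ler01 dF.
rewrite subr0 mulr1 /F mulr0 oppr0 expR0 !mulr1 => FE.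
have F10 : E 1 * expR (- K) <= E 0.
  by rewrite -subr_le0 FE mulr_ge0_le0 ?expR_ge0 // subr_le0 E'le.
have E10 : E 1 <= expR K * E 0.
  by rewrite -ler_pdivrMl ?expR_gt0 // -expRN mulrC.
have nn0 := nm_ge0 (f w).
have E0le : E 0 <= nm (f w) ^+ 2.
  rewrite /E seg0 expr2 nmE mulr_suml; apply: ler_sum => i _.
  rewrite expr2 ler_wpM2l ?cn_ge0 // (bigD1 i) //= lerDl.
  by apply: sumr_ge0 => ? _; exact: cn_ge0.
rewrite -(@ler_pXn2r _ 2) ?nnegrE ?nm_ge0 ?mulr_ge0 ?addr_ge0 ?mulr_ge0 ?expR_ge0 //.
rewrite -(seg1 w d); apply: le_trans (Cauchy 1) _.
apply: le_trans (_ : #|I|%:R * expR K * nm (f w) ^+ 2 <= _).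
  rewrite -mulrA ler_wpM2l //; apply: le_trans E10 _.
  by rewrite ler_wpM2l ?expR_ge0.
rewrite exprMn ler_wpM2r ?sqr_ge0 //.
have : 0 <= #|I|%:R * expR K by rewrite mulr_ge0 ?expR_ge0.
nra.
Qed.

End Gronwall.

Section MatrixDerivatives.
Variable R : realType.
Local Notation C := (cplx R).

Lemma mder_edP p q (f : C -> 'M[C]_(p, q)) (w : C) D :
  mder f w D <-> forall e : R, 0 < e -> exists2 dl : R, 0 < dl &
    forall h : C, cn h < dl -> nm (f (w + h) - f w - h *: D) <= e * cn h.
Proof.
split=> H.
  have /is_derive_edP H2 := (mderP _ _ _).2 H.
  move=> e e0; have N0 : 0 < (p * q).+1%:R :> R by rewrite ltr0n.
  have [dl dl0 Hd] := H2 _ (divr_gt0 e0 N0).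
  exists dl => // h /Hd; rewrite [`|h|]normE -rmorphM /= => /nm_le_norm.
  move/le_trans; apply; rewrite mulrA ler_wpM2r ?cn_ge0 //.
  by rewrite mulrCA ger_pMr // ler_pdivrMr // mul1r ler_nat.
move=> i j; apply/is_deriveP => e /H[dl dl0 Hd]; exists dl => // h /Hd.
apply: le_trans.
by have := nm_entry (f (w + h) - f w - h *: D) i j; rewrite !mxE.
Qed.

Lemma mder_cont p q (f : C -> 'M[C]_(p, q)) (w : C) D : mder f w D ->
  forall e : R, 0 < e -> exists2 dl : R, 0 < dl &
    forall h : C, cn h < dl -> nm (f (w + h) - f w) <= e.
Proof.
move=> /mder_edP H e e0.
have [dl dl0 Hd] := H 1 ltr01.
have K0 : 0 < 1 + nm D by rewrite ltr_pwDl ?nm_ge0.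
exists (Order.min dl (e / (1 + nm D))); first by rewrite lt_min dl0 divr_gt0.
move=> h; rewrite lt_min => /andP[/Hd h1 h2].
rewrite -(subrK (h *: D) (f _ - _)).
apply: le_trans (nmD _ _) _; rewrite nmZ.
move: h2; rewrite ltr_pdivlMr // => h2; nra.
Qed.

Lemma mder_eq p q (f : C -> 'M[C]_(p, q)) w D D' :
  mder f w D -> D = D' -> mder f w D'.
Proof. by move=> ? <-. Qed.

Lemma mder_cst p q (M : 'M[C]_(p, q)) w : mder (fun=> M) w 0.
Proof. by move=> i j; rewrite mxE; exact: is_derive_cst. Qed.

Lemma mderD p q (f g : C -> 'M[C]_(p, q)) w F G : mder f w F -> mder g w G ->
  mder (fun w => f w + g w) w (F + G).
Proof.
move=> hf hg i j; rewrite mxE.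
under eq_fun do rewrite mxE.
exact: (is_deriveD (hf i j) (hg i j)).
Qed.

Lemma mderN p q (f : C -> 'M[C]_(p, q)) w F : mder f w F ->
  mder (fun w => - f w) w (- F).
Proof.
move=> hf i j; rewrite mxE.
under eq_fun do rewrite mxE.
exact: (is_deriveN (hf i j)).
Qed.

Lemma mderM p q r (f : C -> 'M[C]_(p, q)) (g : C -> 'M[C]_(q, r)) w F G :
  mder f w F -> mder g w G ->
  mder (fun w => f w *m g w) w (F *m g w + f w *m G).
Proof.
move=> hf hg i j.
have -> : (fun x => (f x *m g x) i j) =
  \sum_(k < q) ((fun x => f x i k) * (fun x => g x k j)).
  by apply/funext => x; rewrite fct_sumE mxE.
apply: is_derive_eq.
  apply: is_derive_sum => k; exact: (is_deriveM (hf i k) (hg k j)).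
rewrite !mxE -big_split /=; apply: eq_bigr => k _.
by rewrite /GRing.scale /= addrC [g w k j * _]mulrC.
Qed.

Lemma mder_diag n (f : C -> 'rV[C]_n) w D : mder f w D ->
  mder (fun w => diag_mx (f w)) w (diag_mx D).
Proof.
move=> H i j; rewrite mxE; have [->|ij] := eqVneq i j.
  rewrite mulr1n; under eq_fun do rewrite mxE eqxx mulr1n.
  exact: H.
rewrite mulr0n; under eq_fun do rewrite mxE (negPf ij) mulr0n.
exact: is_derive_cst.
Qed.

(** If K M = 0 then K = - K (M - 1), so the norm of K is at most half of itself. The same
    absorption, in Q = 1 - (M - 1) Q, bounds the inverse. *)
Lemma unit_near1 n (M : 'M[C]_n) : nm (M - 1%:M) <= 1 / 2 ->
  M \in unitmx /\ nm (invmx M) <= 2 * n%:R.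
Proof.
move=> h.
have U : M \in unitmx.
  rewrite -row_free_unit -kermx_eq0; apply/eqP; set K := kermx M.
  have : K *m M = 0 by exact: mulmx_ker.
  rewrite -{1}(subrK 1%:M M) mulmxDr mulmx1 => /eqP; rewrite addrC addr_eq0 => /eqP E.
  have : nm K <= nm K * (1 / 2).
    by rewrite {1}E nmN; apply: le_trans (nmM _ _) _; rewrite ler_wpM2l ?nm_ge0.
  by have := nm_ge0 K => h1 h2; apply: nm_eq0; lra.
split=> //; set Q := invmx M.
have E : Q = 1%:M - (M - 1%:M) *m Q.
  by rewrite mulmxBl mul1mx mulmxV // opprB addrC subrK.
have : nm Q <= n%:R + 1 / 2 * nm Q.
  rewrite {1}E; apply: le_trans (nmB _ _) _; rewrite nm1 lerD2l.
  by apply: le_trans (nmM _ _) _; rewrite ler_wpM2r ?nm_ge0.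
by lra.
Qed.

Lemma mder_inv n (f : C -> 'M[C]_n) w D (d K : R) : 0 < d ->
  (forall h, cn h < d -> f (w + h) \in unitmx /\ nm (invmx (f (w + h))) <= K) ->
  mder f w D ->
  mder (fun w => invmx (f w)) w (- (invmx (f w) *m D *m invmx (f w))).
Proof.
move=> d0 HK Hf; apply/mder_edP => e e0.
have U0 : f w \in unitmx by have [] := HK 0; rewrite ?cn0 ?addr0.
set Q := invmx (f w).
pose K' := 1 + `|K| * nm Q; pose K2 := 1 + `|K| * nm Q * nm (D *m Q).
have K'0 : 0 < K' by rewrite ltr_pwDl // mulr_ge0 ?nm_ge0.
have K20 : 0 < K2 by rewrite ltr_pwDl // !mulr_ge0 ?nm_ge0.
have e10 : 0 < e / 2 / K' by rewrite !divr_gt0.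
have e20 : 0 < e / 2 / K2 by rewrite !divr_gt0.
have [d1 d10 H1] := (mder_edP _ _ _).1 Hf _ e10.
have [d2 d20 H2] := mder_cont Hf e20.
exists (Order.min d (Order.min d1 d2)); first by rewrite !lt_min d0 d10.
move=> h; rewrite !lt_min => /and3P[/HK[U hK] /H1 h1 /H2 h2].
have {}hK : nm (invmx (f (w + h))) <= `|K| by apply: le_trans hK _; exact: ler_norm.
set Qh := invmx (f (w + h)) in hK *.
have E1 : Qh - Q = - (Qh *m (f (w + h) - f w) *m Q).
  rewrite mulmxBr mulmxBl mulVmx // mul1mx -mulmxA mulmxV // mulmx1 opprB //.
have -> : Qh - Q - h *: - (Q *m D *m Q) =
    - (Qh *m (f (w + h) - f w - h *: D) *m Q) - (h *: ((Qh - Q) *m (D *m Q))).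
  have -> : Qh *m (f (w + h) - f w - h *: D) *m Q = - (Qh - Q) - h *: (Qh *m D *m Q).
    by rewrite E1 opprK mulmxBr mulmxBl -scalemxAr -scalemxAl.
  have -> : (Qh - Q) *m (D *m Q) = Qh *m D *m Q - Q *m D *m Q.
    by rewrite mulmxBl !mulmxA.
  move: (Qh *m D *m Q) (Q *m D *m Q) => U1 U2.
  by apply/matrixP => i j; rewrite !mxE; ring.
apply: le_trans (nmB _ _) _; rewrite nmN nmZ.
have b1 : nm (Qh *m (f (w + h) - f w - h *: D) *m Q) <= e / 2 * cn h.
  apply: le_trans (nmM _ _) _.
  apply: le_trans (ler_wpM2r (nm_ge0 _) (nmM _ _)) _.
  apply: le_trans (_ : `|K| * (e / 2 / K' * cn h) * nm Q <= _).
    by rewrite ler_wpM2r ?nm_ge0 //; apply: ler_pM; rewrite ?nm_ge0.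
  have -> : `|K| * (e / 2 / K' * cn h) * nm Q = e / 2 / K' * cn h * (`|K| * nm Q) by ring.
  apply: le_trans (_ : e / 2 / K' * cn h * K' <= _).
    apply: ler_wpM2l; last by rewrite lerDr.
    exact: (mulr_ge0 (ltW e10) (cn_ge0 h)).
  by rewrite mulrAC divfK ?lt0r_neq0.
have b2 : nm ((Qh - Q) *m (D *m Q)) <= e / 2.
  apply: le_trans (nmM _ _) _.
  apply: le_trans (_ : (`|K| * (e / 2 / K2) * nm Q) * nm (D *m Q) <= _).
    rewrite ler_wpM2r ?nm_ge0 // E1 nmN.
    apply: le_trans (nmM _ _) _; rewrite ler_wpM2r ?nm_ge0 //.
    by apply: le_trans (nmM _ _) _; apply: ler_pM; rewrite ?nm_ge0.
  have -> : `|K| * (e / 2 / K2) * nm Q * nm (D *m Q) = e / 2 / K2 * (`|K| * nm Q * nm (D *m Q)) by ring.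
  apply: le_trans (_ : e / 2 / K2 * K2 <= _).
    by apply: ler_wpM2l; [exact: ltW | rewrite lerDr].
  by rewrite divfK ?lt0r_neq0.
have := ler_wpM2l (cn_ge0 h) b2; lra.
Qed.

End MatrixDerivatives.

(** * Limits of solutions of linear systems *)

Section LimitOfSolutions.
Variables (R : realType) (n : nat).
Local Notation C := (cplx R).

Lemma Re_seg (w d : C) (s : R) :
  complex.Re (seg w d s) = complex.Re w + s * complex.Re d.
Proof. by []. Qed.

Lemma seg_Re_ge (x0 : R) (w d : C) (s : R) : 0 <= s <= 1 ->
  x0 <= complex.Re w -> x0 <= complex.Re (w + d) -> x0 <= complex.Re (seg w d s).
Proof. by rewrite ReD Re_seg => /andP[s0 s1] h1 h2; nra. Qed.

Lemma seg_in_ball (w d : C) (s : R) : 0 <= s <= 1 -> cn (s%:C * d) <= cn d.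
Proof.
move=> /andP[s0 s1]; rewrite cnM cn_real ger0_norm //.
by rewrite ler_piMl ?cn_ge0.
Qed.

Lemma mean_value_seg_mx p q (f D : C -> 'M[C]_(p, q)) (w d : C) (A : R) :
  (forall s : R, 0 <= s <= 1 -> mder f (seg w d s) (D (seg w d s)) /\
     nm (D (seg w d s)) <= A) ->
  nm (f (w + d) - f w) <= (p * q)%:R * (A * cn d).
Proof.
move=> H; apply: nm_le_entry => i j; rewrite !mxE.
apply: (@mean_value_seg R (fun w => f w i j) (fun w => D w i j)) => s /H[h1 h2].
split; first exact: h1.
rewrite cnM ler_wpM2r ?cn_ge0 //; apply: le_trans h2; exact: nm_entry.
Qed.

Definition tends (T : Type) p q (F : set_system T) (f : T -> 'M[C]_(p, q)) (l : 'M[C]_(p, q)) :=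
  forall e : R, 0 < e -> F [set t | nm (f t - l) <= e].

(** Pointwise convergence suffices. Gronwall bounds all [Y t] near [w] by one constant, so they are
    Lipschitz there with one constant, and the mean value inequality makes their first-order Taylor
    remainders at [w] small uniformly in [t]. On the boundary Re w = x0 only increments into the
    half-plane are controlled. *)
Lemma limit_solution (T : Type) (F : set_system T) (FF : ProperFilter F)
  (x0 : R) (Y a : T -> C -> 'M[C]_n) (a0 L : C -> 'M[C]_n) :
  F [set t | forall w : C, x0 <= complex.Re w -> mder (Y t) w (a t w *m Y t w)] ->
  (forall w : C, x0 <= complex.Re w -> forall e : R, 0 < e -> exists2 dl : R, 0 < dl &
     F [set t | forall h, cn h < dl -> x0 <= complex.Re (w + h) ->
        nm (a t (w + h) - a0 w) <= e]) ->
  (forall w : C, x0 <= complex.Re w -> tends F (Y^~ w) (L w)) ->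
  forall w : C, x0 <= complex.Re w -> forall e : R, 0 < e -> exists2 dl : R, 0 < dl &
    forall h, cn h < dl -> x0 <= complex.Re (w + h) ->
      nm (L (w + h) - L w - h *: (a0 w *m L w)) <= e * cn h.
Proof.
move=> HY Ha HL w wx e e0.
pose N : R := (n * n).+1%:R.
have N0 : 0 < N by rewrite ltr0n.
have N1 : (n * n)%:R <= N by rewrite ler_nat.
have [d1 d10 H1] := Ha w wx 1 ltr01.
pose K := nm (a0 w) + 1.
have K0 : 0 < K by rewrite ltr_wpDl ?nm_ge0.
have [G G0 HG] := gronwall n n K.
pose B := G * (nm (L w) + 1).
have B0 : 0 <= B by rewrite mulr_ge0 // addr_ge0 ?nm_ge0.
pose e1 := e / 8 / N / (1 + B); pose e2 := e / 8 / N / (1 + nm (a0 w)).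
have e10 : 0 < e1 by rewrite !divr_gt0 // ltr_pwDl.
have e20 : 0 < e2 by rewrite !divr_gt0 // ltr_pwDl ?nm_ge0.
have [d2 d20 H2] := Ha w wx e1 e10.
pose d3 := e2 / (1 + N * (K * B)).
have KB0 : 0 <= K * B by apply: mulr_ge0 => //; exact: ltW.
have NKB0 : 0 <= N * (K * B) by apply: mulr_ge0 => //; exact: ltW.
have S0 : 0 < 1 + N * (K * B) by apply: ltr_pwDl.
have d30 : 0 < d3 by exact: divr_gt0.
exists (Order.min 1 (Order.min d1 (Order.min d2 d3))); first by rewrite !lt_min ltr01 d10 d20.
move=> h; rewrite !lt_min => /and4P[h1 hd1 hd2 hd3] hx.
have [->|h0] := eqVneq h 0.
  by rewrite addr0 subrr scale0r subr0 nm0 cn0 mulr0.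
have ch0 : 0 < cn h by rewrite cn_gt0.
(* [t] is chosen after [h], so replacing [Y t] by [L] at the two points [w] and [w + h] may be
   required to cost only a fraction of [e * cn h]. *)
pose e4 := Order.min 1 (Order.min e2 (e / 8 * cn h)).
have e40 : 0 < e4 by rewrite !lt_min ltr01 e20 mulr_gt0 // divr_gt0.
have : F [set t | [/\ (forall w : C, x0 <= complex.Re w -> mder (Y t) w (a t w *m Y t w)),
    (forall h, cn h < d1 -> x0 <= complex.Re (w + h) -> nm (a t (w + h) - a0 w) <= 1),
    (forall h, cn h < d2 -> x0 <= complex.Re (w + h) -> nm (a t (w + h) - a0 w) <= e1),
    nm (Y t w - L w) <= e4 & nm (Y t (w + h) - L (w + h)) <= e4]].
  have A4 := HL w wx _ e40; have A5 := HL _ hx _ e40.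
  by near=> t; split; near: t.
move=> /filter_ex[t [Yt at1 at2 Yw Yh]].
have Yw1 : nm (Y t w) <= nm (L w) + 1.
  rewrite -(subrK (L w) (Y t w)) addrC; apply: le_trans (nmD _ _) _.
  by rewrite lerD2l; apply: le_trans Yw _; rewrite ge_min lexx.
have aK k : cn k < d1 -> x0 <= complex.Re (w + k) -> nm (a t (w + k)) <= K.
  move=> /at1 H /H; rewrite /K => {}H.
  rewrite -(subrK (a0 w) (a t _)) addrC; apply: le_trans (nmD _ _) _.
  by rewrite lerD2l.
have YB k : cn k < Order.min 1 d1 -> x0 <= complex.Re (w + k) -> nm (Y t (w + k)) <= B.
  rewrite lt_min => /andP[k1 k2] kx.
  apply: le_trans (_ : G * nm (Y t w) <= _); last by rewrite ler_wpM2l.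
  apply: (HG (Y t) (fun w => a t w *m Y t w)) => s s01.
  have sx := seg_Re_ge s01 wx kx.
  split; first exact: Yt.
  apply: le_trans (_ : nm (a t (seg w k s) *m Y t (seg w k s)) * 1 <= _).
    by rewrite ler_wpM2l ?nm_ge0 // ltW.
  rewrite mulr1; apply: le_trans (nmM _ _) _; rewrite ler_wpM2r ?nm_ge0 //.
  rewrite segE; apply: aK; last by rewrite -segE.
  by apply: le_lt_trans (seg_in_ball w k s01) _.
have Ylip k : cn k < Order.min 1 d1 -> x0 <= complex.Re (w + k) ->
    nm (Y t (w + k) - Y t w) <= N * (K * B * cn k).
  move=> kd kx; apply: le_trans (_ : (n * n)%:R * (K * B * cn k) <= _); last first.
    by apply: ler_wpM2r => //; apply: mulr_ge0 => //; exact: cn_ge0.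
  apply: (mean_value_seg_mx (D := fun w => a t w *m Y t w)) => s s01.
  have sx := seg_Re_ge s01 wx kx.
  have sk := le_lt_trans (seg_in_ball w k s01) kd.
  split; first exact: Yt.
  apply: le_trans (nmM _ _) _; rewrite segE; apply: ler_pM; rewrite ?nm_ge0 //.
    apply: aK; last by rewrite -segE.
    by move: sk; rewrite lt_min => /andP[].
  by apply: YB; rewrite -?segE.
pose D := a0 w *m L w.
have main : nm (Y t (w + h) - Y t w - h *: D) <= (n * n)%:R * (3 * (e / 8 / N) * cn h).
  have -> : Y t (w + h) - Y t w - h *: D =
     (Y t (w + h) + - ((w + h) *: D)) - (Y t w + - (w *: D)).
    move: (Y t (w + h)) (Y t w) (D) => Y1 Y2 D1.
    by apply/matrixP => i j; rewrite !mxE; ring.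
  apply: (mean_value_seg_mx (f := fun z => Y t z + - (z *: D))
    (D := fun z => a t z *m Y t z + - D)) => s s01.
  have sx := seg_Re_ge s01 wx hx.
  have sk := seg_in_ball w h s01.
  split.
    apply: mderD; first exact: Yt.
    apply: mderN; apply/mder_edP => e' e'0; exists 1 => // k _.
    set X := (X in nm X); have -> : X = 0.
      by rewrite /X; move: (D) => D1; apply/matrixP => i j; rewrite !mxE; ring.
    by rewrite nm0; apply: mulr_ge0; [exact: ltW | exact: cn_ge0].
  rewrite segE; set k := s%:C * h; rewrite segE -/k in sx; rewrite -/k in sk.
  have k1 : cn k < Order.min 1 d1 by apply: le_lt_trans sk _; rewrite lt_min h1.
  have -> : a t (w + k) *m Y t (w + k) + - D = (a t (w + k) - a0 w) *m Y t (w + k) +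
     a0 w *m (Y t (w + k) - Y t w) + a0 w *m (Y t w - L w).
    rewrite mulmxBl !mulmxBr -/D.
    by move: (a t _ *m _) (D) (a0 w *m _) (a0 w *m _) => M1 M2 M3 M4;
      apply/matrixP => i j; rewrite !mxE; ring.
  have b1 : nm ((a t (w + k) - a0 w) *m Y t (w + k)) <= e / 8 / N.
    apply: le_trans (nmM _ _) _.
    apply: le_trans (_ : e1 * (1 + B) <= _); last by rewrite divfK // lt0r_neq0 // ltr_pwDl.
    apply: ler_pM; rewrite ?nm_ge0 //.
      by apply: at2 => //; exact: le_lt_trans sk hd2.
    by apply: le_trans (YB _ k1 sx) _; rewrite lerDr.
  have c2 : nm (Y t (w + k) - Y t w) <= e2.
    apply: le_trans (Ylip _ k1 sx) _.
    apply: le_trans (_ : (1 + N * (K * B)) * d3 <= _).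
      have : cn k <= d3 by exact: le_trans sk (ltW hd3).
      by rewrite mulrA; have := cn_ge0 k; nra.
    by rewrite mulrC divfK // lt0r_neq0.
  have b0 : nm (a0 w) * e2 <= e / 8 / N.
    apply: le_trans (_ : (1 + nm (a0 w)) * e2 <= _); first by rewrite ler_wpM2r ?lerDr // ltW.
    by rewrite mulrC divfK // lt0r_neq0 // ltr_pwDl ?nm_ge0.
  have b2 : nm (a0 w *m (Y t (w + k) - Y t w)) <= e / 8 / N.
    apply: le_trans (nmM _ _) _; apply: le_trans b0; exact: (ler_wpM2l (nm_ge0 _) c2).
  have b3 : nm (a0 w *m (Y t w - L w)) <= e / 8 / N.
    apply: le_trans (nmM _ _) _; apply: le_trans b0; apply: (ler_wpM2l (nm_ge0 _)).
    by apply: le_trans Yw _; rewrite !ge_min lexx orbT.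
  apply: le_trans (nmD _ _) _; apply: le_trans (lerD (nmD _ _) (lexx _)) _.
  apply: le_trans (lerD (lerD b1 b2) b3) _; move: (e / 8 / N) => z; lra.
have main2 : nm (Y t (w + h) - Y t w - h *: D) <= 3 * (e / 8) * cn h.
  apply: le_trans main _.
  apply: le_trans (_ : N * (3 * (e / 8 / N) * cn h) <= _).
    by rewrite ler_wpM2r // !mulr_ge0 ?cn_ge0 // ?invr_ge0 ltW.
  by rewrite le_eqVlt; apply/orP; left; apply/eqP; field; rewrite lt0r_neq0.
have e4e : e4 <= e / 8 * cn h by rewrite !ge_min lexx !orbT.
have -> : L (w + h) - L w - h *: D =
   (Y t (w + h) - Y t w - h *: D) - (Y t (w + h) - L (w + h)) + (Y t w - L w).
  set A1 := Y t (w + h); set A2 := Y t w; set A3 := L (w + h); set A4 := L w.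
  move: A1 A2 A3 A4 (D) => A1 A2 A3 A4 D1.
  by apply/matrixP => i j; rewrite !mxE; ring.
apply: le_trans (nmD _ _) _; apply: le_trans (lerD (nmB _ _) (lexx _)) _.
move: main2 Yw Yh e4e; nra.
Unshelve. all: by end_near. Qed.

(* Left of Re w = x0 the first-order Taylor polynomial at the nearest boundary
   point, so that the derivative at boundary points is two-sided. *)
Definition extend (x0 : R) (L D : C -> 'M[C]_n) (w : C) : 'M[C]_n :=
  if x0 <= complex.Re w then L w
  else let p : C := x0 +i* complex.Im w in L p + (w - p) *: D p.

Lemma extendE x0 L D w : x0 <= complex.Re w -> extend x0 L D w = L w.
Proof. by rewrite /extend => ->. Qed.

Lemma mder_extend (x0 : R) (L D : C -> 'M[C]_n) :
  (forall w : C, x0 <= complex.Re w -> forall e : R, 0 < e -> exists2 dl : R, 0 < dl &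
    forall h, cn h < dl -> x0 <= complex.Re (w + h) ->
      nm (L (w + h) - L w - h *: D w) <= e * cn h) ->
  (forall w : C, x0 <= complex.Re w -> forall e : R, 0 < e -> exists2 dl : R, 0 < dl &
    forall h, cn h < dl -> x0 <= complex.Re (w + h) ->
      nm (D (w + h) - D w) <= e) ->
  forall w : C, x0 <= complex.Re w -> mder (extend x0 L D) w (D w).
Proof.
move=> HL HD w wx; apply/mder_edP => e e0.
have e20 : 0 < e / 2 by rewrite divr_gt0.
have [d1 d10 H1] := HL w wx _ e20.
have [d2 d20 H2] := HD w wx _ e20.
have [wx1|wx1] := ltP x0 (complex.Re w).
  exists (Order.min d1 (complex.Re w - x0)); first by rewrite lt_min d10 subr_gt0.
  move=> h; rewrite lt_min => /andP[hd1 hx].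
  have hR : x0 <= complex.Re (w + h).
    by have := Re_le_cn h; rewrite ler_norml ReD => /andP[? _]; lra.
  rewrite !extendE //; apply: le_trans (H1 h hd1 hR) _.
  by rewrite ler_wpM2r ?cn_ge0 //; lra.
have {wx1}wE : complex.Re w = x0 by apply/eqP; rewrite eq_le wx1.
exists (Order.min d1 d2); first by rewrite lt_min d10.
move=> h; rewrite lt_min => /andP[hd1 hd2].
rewrite (extendE _ _ wx) /extend; case: ifPn => [hR|_].
  apply: le_trans (H1 h hd1 hR) _.
  by rewrite ler_wpM2r ?cn_ge0 //; lra.
(* [w] is on the boundary line here, and [w + k] is the boundary point nearest to [w + h]. *)
pose k : C := 0 +i* complex.Im h.
have -> : (x0 +i* complex.Im (w + h) : C) = w + k.
  by apply: cplx_eqP; rewrite ?ReD ?ImD /= ?addr0 ?wE.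
have kh : cn k <= cn h.
  apply: le_trans (cn_le_ReIm _) _; rewrite /= normr0 add0r; exact: Im_le_cn.
have hkh : cn (h - k) <= cn h.
  apply: le_trans (cn_le_ReIm _) _; rewrite ReD ImD ReN ImN /= subrr normr0 subr0 addr0.
  exact: Re_le_cn.
have kR : x0 <= complex.Re (w + k) by rewrite ReD /= addr0.
have -> : L (w + k) + (w + h - (w + k)) *: D (w + k) - L w - h *: D w =
  (L (w + k) - L w - k *: D w) + (h - k) *: (D (w + k) - D w).
  move: (L (w + k)) (L w) (D (w + k)) (D w) => A1 A2 A3 A4.
  by apply/matrixP => i j; rewrite !mxE; ring.
apply: le_trans (nmD _ _) _; rewrite nmZ.
have a1 := H1 k (le_lt_trans kh hd1) kR.
have a2 := H2 k (le_lt_trans kh hd2) kR.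
have : cn (h - k) * nm (D (w + k) - D w) <= cn h * (e / 2).
  by apply: ler_pM; rewrite ?cn_ge0 ?nm_ge0.
have : e / 2 * cn k <= e / 2 * cn h by rewrite ler_wpM2l // ltW.
lra.
Qed.

End LimitOfSolutions.

(** * Estimates for the reduced system *)

Section ReducedSystem.
Variables (R : realType) (n : nat).
Local Notation C := (cplx R).

Definition reduced_ode (u b : 'rV[C]_n) (x0 : R) (y Rm : C -> 'M[C]_n) :=
  forall w : C, x0 <= complex.Re w ->
    mder y w (diag_mx (cexp w *: u + b) *m y w - y w *m diag_mx (cexp w *: u + b) + Rm w).

Variables (u b : 'rV[C]_n) (x0 : R) (y Rm : C -> 'M[C]_n).
Hypothesis ode : reduced_ode u b x0 y Rm.

(* Logarithm of the integrating factor of the entry (i, j) of the reduced system,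
   normalized to vanish at w0. *)
Definition phase (i j : 'I_n) (w0 w : C) : C :=
  (u 0 i - u 0 j) * (cexp w0 - cexp w) + (b 0 i - b 0 j) * (w0 - w).

(** A commutator with a diagonal matrix acts on each entry as a scalar, and the identity commutes
    with it, so the entries of [y - 1] satisfy scalar equations whose integrating factor is
    [cexp (phase i j w0 w)]. *)
Lemma entry_derive (i j : 'I_n) (w0 w : C) : x0 <= complex.Re w ->
  is_derive w 1 (fun w => (y w - 1%:M) i j * cexp (phase i j w0 w))
    (Rm w i j * cexp (phase i j w0 w)).
Proof.
move=> wx; have hy := ode wx i j.
have h1 : is_derive w 1 (fun w => (y w - 1%:M) i j)
    ((cexp w * (u 0 i - u 0 j) + (b 0 i - b 0 j)) * (y w - 1%:M) i j + Rm w i j).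
  under eq_fun do rewrite !mxE.
  have := is_deriveB hy (is_derive_cst ((i == j)%:R : C) w 1).
  move/is_derive_eq; apply; rewrite subr0 mul_diag_mx mul_mx_diag !mxE.
  have [->|ij] := eqVneq i j; first by rewrite !subrr; ring.
  by rewrite mulr0n; ring.
have h2 : is_derive w 1 (phase i j w0)
    (- ((u 0 i - u 0 j) * cexp w + (b 0 i - b 0 j))).
  have := is_deriveD (is_deriveM (is_derive_cst (u 0 i - u 0 j) w 1)
    (is_deriveB (is_derive_cst (cexp w0) w 1) (is_derive_cexp w)))
    (is_deriveM (is_derive_cst (b 0 i - b 0 j) w 1)
      (is_deriveB (is_derive_cst w0 w 1) (is_derive_id w 1))).
  move/is_derive_eq; apply; rewrite /GRing.scale /=; ring.
have h3 := is_derive_compC (is_derive_cexp _) h2.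
have := is_deriveM h1 h3; move/is_derive_eq; apply; rewrite /GRing.scale /=; ring.
Qed.

Lemma cn_phase (i j : 'I_n) (w0 w : C) (q : R) :
  complex.Re ((u 0 i - u 0 j) * cexp w0) <= complex.Re ((u 0 i - u 0 j) * cexp w) ->
  complex.Re ((b 0 i - b 0 j) * (w0 - w)) <= q ->
  cn (cexp (phase i j w0 w)) <= expR q.
Proof.
move=> h1 h2; rewrite cn_cexp ler_expR /phase ReD -[q]add0r; apply: lerD => //.
by rewrite mulrBr ReD ReN subr_le0.
Qed.

(** The starting point is the one at which the estimate is wanted. Re((u_i - u_j) z) is least there,
    so the exponential in the integrating factor has modulus at most 1 along the path and only the
    power z^(b_i - b_j), measured by [p] and [q], remains. No bound on u_i - u_j enters. *)
Lemma transport (i j : 'I_n) (pr pi dr di : R -> R) (s0 s1 q A : R) :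
  s0 <= s1 ->
  (forall s, s0 <= s <= s1 -> [/\ is_derive s 1 pr (dr s), is_derive s 1 pi (di s)
     & x0 <= pr s]) ->
  (forall s, s0 <= s <= s1 ->
     complex.Re ((u 0 i - u 0 j) * cexp (pr s0 +i* pi s0)) <=
     complex.Re ((u 0 i - u 0 j) * cexp (pr s +i* pi s))) ->
  (forall s, s0 <= s <= s1 -> exists2 p,
     complex.Re ((b 0 i - b 0 j) * ((pr s0 +i* pi s0) - (pr s +i* pi s))) <= p &
     cn (Rm (pr s +i* pi s) i j) * expR p * cn (dr s +i* di s : C) <= A) ->
  complex.Re ((b 0 i - b 0 j) * ((pr s0 +i* pi s0) - (pr s1 +i* pi s1))) <= q ->
  cn ((y (pr s0 +i* pi s0) - 1%:M) i j) <=
  cn ((y (pr s1 +i* pi s1) - 1%:M) i j) * expR q + A * (s1 - s0).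
Proof.
move=> s01 Hpath Hc HR Hq.
set w0 : C := pr s0 +i* pi s0; set w1 : C := pr s1 +i* pi s1.
pose g (w : C) := (y w - 1%:M) i j * cexp (phase i j w0 w).
have g0 : g w0 = (y w0 - 1%:M) i j.
  by rewrite /g /phase !subrr !mulr0 addr0 cexp0 mulr1.
have main : cn (g w1 - g w0) <= A * (s1 - s0).
  apply: (@mean_value_path R g (fun w => Rm w i j * cexp (phase i j w0 w)) pr pi dr di) => //.
  move=> s ss; have [h1 h2 h3] := Hpath s ss; split => //.
    exact: entry_derive.
  have [p hp hA] := HR s ss; apply: le_trans hA.
  rewrite !cnM ler_wpM2r ?cn_ge0 // ler_wpM2l ?cn_ge0 //.
  by apply: cn_phase => //; exact: Hc.
rewrite -g0; have -> : g w0 = g w1 - (g w1 - g w0) by ring.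
apply: le_trans (cnB _ _) _; apply: lerD => //.
rewrite cnM ler_wpM2l ?cn_ge0 //; apply: cn_phase => //.
by apply: Hc; rewrite s01 lexx.
Qed.

End ReducedSystem.

(** * Integration along lines parallel to the edge of a half-plane *)

Section LineEstimate.
Variables (R : realType).
Local Notation C := (cplx R).

Lemma sin_le_id (x : R) : 0 <= x -> sin x <= x.
Proof.
move=> x0; have [c _] := MVT_derivable x0 (fun s _ => is_derive_sin s).
rewrite sin0 !subr0 => ->; by rewrite ler_piMl // cos_le1.
Qed.

Lemma cos_le_dist (x : R) : x <= pi / 2 -> cos x <= pi / 2 - x.
Proof.
move=> xp; rewrite -[x in cos x](subKr (pi / 2)) cosB cos_pihalf sin_pihalf mul0r add0r mul1r.
by apply: sin_le_id; rewrite subr_ge0.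
Qed.

Lemma cisD (a b : R) : cis (a + b) = cis a * cis b.
Proof. by apply: cplx_eqP; rewrite ?ReM ?ImM /= ?cosD ?sinD; ring. Qed.

Lemma cexpE (w : C) : cexp w = (expR (complex.Re w))%:C * cis (complex.Im w).
Proof. by apply: cplx_eqP; rewrite ?ReM ?ImM /= !mul0r ?subr0 ?addr0. Qed.

(* In the coordinate w = log z, gre and gim parametrize the line
   z = e^(i th0) r (sg tan phi - i); sg = 1 or -1 is its orientation. *)
Definition gre (r phi : R) : R := ln r - ln (cos phi).
Definition gim (th0 sg phi : R) : R := th0 - pi / 2 + sg * phi.

Lemma is_derive_gre (r phi : R) : 0 < cos phi -> is_derive phi 1 (gre r) (tan phi).
Proof.
move=> c0; have h1 := is_derive1_comp (is_derive1_ln c0) (is_derive_cos phi).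
have := is_deriveB (is_derive_cst (ln r) phi 1) h1.
by move/is_derive_eq; apply; rewrite sub0r mulrN opprK /tan mulrC.
Qed.

Lemma is_derive_gim (th0 sg phi : R) : is_derive phi 1 (gim th0 sg) sg.
Proof.
have := is_derive_line (th0 - pi / 2) sg phi.
by under eq_fun do rewrite [_ * sg]mulrC.
Qed.

Lemma gre_ge (r phi : R) : 0 < cos phi -> ln r <= gre r phi.
Proof. by move=> c0; rewrite lerDl oppr_ge0 ln_le0 // cos_le1. Qed.

Lemma expR_gre (r phi : R) : 0 < r -> 0 < cos phi ->
  expR (gre r phi) = r / cos phi.
Proof. by move=> r0 c0; rewrite expRB !lnK. Qed.

Lemma cos_sg (sg phi : R) : sg ^+ 2 = 1 -> cos (sg * phi) = cos phi.
Proof.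
move=> /eqP; rewrite sqrf_eq1 => /orP[]/eqP ->; first by rewrite mul1r.
by rewrite mulN1r cosN.
Qed.

Lemma sin_sg (sg phi : R) : sg ^+ 2 = 1 -> sin (sg * phi) = sg * sin phi.
Proof.
move=> /eqP; rewrite sqrf_eq1 => /orP[]/eqP ->; first by rewrite !mul1r.
by rewrite !mulN1r sinN.
Qed.

(** The result is affine in tan phi, hence monotone along the line for every [c], even an
    arbitrarily small one; [sg] can be chosen so that it increases. *)
Lemma Re_line (c : C) (th0 sg r phi : R) : 0 < r -> 0 < cos phi -> sg ^+ 2 = 1 ->
  complex.Re (c * cexp (gre r phi +i* gim th0 sg phi)) =
  r * (sg * complex.Re (c * cis th0) * tan phi + complex.Im (c * cis th0)).
Proof.
move=> r0 c0 sg2.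
rewrite cexpE /= /gim !cisD expR_gre //.
have -> : cis (- (pi / 2)) = (0 -i* 1) :> C.
  by rewrite /cis cosN sinN cos_pihalf sin_pihalf.
have -> : cis (sg * phi) = (cos phi +i* (sg * sin phi)) :> C.
  by rewrite /cis cos_sg // sin_sg.
rewrite /tan /cis; case: c => c1 c2 /=; field.
by rewrite lt0r_neq0.
Qed.

Lemma tan_mono (p0 p1 : R) : - (pi / 2) < p0 -> p0 <= p1 -> p1 < pi / 2 ->
  tan p0 <= tan p1.
Proof.
move=> h0 h01 h1.
have c0 : 0 < cos p0 by apply: cos_gt0_pihalf; lra.
have c1 : 0 < cos p1 by apply: cos_gt0_pihalf; lra.
rewrite -subr_ge0 /tan; have -> : sin p1 / cos p1 - sin p0 / cos p0 =
  sin (p1 - p0) / (cos p1 * cos p0).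
  by rewrite sinB; field; rewrite !lt0r_neq0.
rewrite divr_ge0 ?mulr_ge0 ?(ltW c0) ?(ltW c1) //.
by apply: sin_ge0_pi; have := pi_gt0 R; lra.
Qed.

Lemma nm_diag n (v : 'rV[C]_n) : nm (diag_mx v) <= nm v.
Proof.
rewrite /nm big_ord1; apply: ler_sum => i _.
rewrite (bigD1 i) //= mxE eqxx mulr1n big1 ?addr0 // => j ji.
by rewrite mxE eq_sym (negPf ji) mulr0n cn0.
Qed.

(** A crude bound, whose constant depends on [u]. It serves only to know that the suprema taken
    below are finite. *)
Lemma ode_growth n (u b : 'rV[C]_n) (x0 xl xr K rho : R) (N : nat) (y Rm : C -> 'M[C]_n) :
  reduced_ode u b x0 y Rm -> x0 <= xl -> 0 <= xl -> 0 <= K ->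
  (forall w : C, x0 <= complex.Re w ->
     nm (Rm w) <= K * expR (- N%:R * complex.Re w) * nm (y w)) ->
  exists2 G : R, 0 <= G & forall w0 w : C,
    xl <= complex.Re w0 <= xr -> xl <= complex.Re w <= xr -> cn (w - w0) <= rho ->
    nm (y w) <= G * nm (y w0).
Proof.
move=> ode x0l xl0 K0 Rb.
pose L := (2 * (expR xr * nm u + nm b) + K) * rho.
have [G G0 HG] := gronwall n n L.
exists G => // w0 w /andP[w0l w0r] /andP[wl wr] wd.
have E : w = w0 + (w - w0) by rewrite addrC subrK.
rewrite {1}E; apply: (HG y (fun w => diag_mx (cexp w *: u + b) *m y w - y w *m diag_mx (cexp w *: u + b) + Rm w)).
move=> s s01; set z := seg w0 (w - w0) s.
have zl : xl <= complex.Re z by apply: seg_Re_ge; rewrite -?E.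
have zr : complex.Re z <= xr.
  by rewrite /z Re_seg ReD ReN; case/andP: s01 => s0 s1; nra.
split; first by apply: ode; exact: le_trans x0l zl.
rewrite [L * _]mulrAC; apply: ler_pM; rewrite ?cn_ge0 ?nm_ge0 //.
have dn : nm (diag_mx (cexp z *: u + b)) <= expR xr * nm u + nm b.
  apply: le_trans (nm_diag _) _; apply: le_trans (nmD _ _) _.
  by rewrite lerD2r nmZ cn_cexp ler_wpM2r ?nm_ge0 // ler_expR.
have Rz : nm (Rm z) <= K * nm (y z).
  apply: le_trans (Rb _ (le_trans x0l zl)) _.
  rewrite ler_wpM2r ?nm_ge0 // ler_piMr // -[leRHS]expR0 ler_expR mulNr oppr_le0.
  by rewrite mulr_ge0 //; exact: le_trans xl0 zl.
have m1 : nm (diag_mx (cexp z *: u + b) *m y z) <= (expR xr * nm u + nm b) * nm (y z).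
  by apply: le_trans (nmM _ _) _; rewrite ler_wpM2r ?nm_ge0.
have m2 : nm (y z *m diag_mx (cexp z *: u + b)) <= (expR xr * nm u + nm b) * nm (y z).
  by apply: le_trans (nmM _ _) _; rewrite mulrC ler_wpM2r ?nm_ge0.
apply: le_trans (nmD _ _) _; apply: le_trans (lerD (nmB _ _) (lexx _)) _.
apply: le_trans (lerD (lerD m1 m2) Rz) _.
by rewrite -!mulrDl ler_wpM2r ?nm_ge0 // mulr_natl mulr2n.
Qed.

Section Line.
Variables (n : nat) (u b : 'rV[C]_n) (x0 : R) (y Rm : C -> 'M[C]_n).
Variables (B K th0 r : R) (N : nat).
Hypothesis ode : reduced_ode u b x0 y Rm.
Hypotheses (r0 : 0 < r) (xr : x0 <= ln r) (lr0 : 0 <= ln r) (K0 : 0 <= K) (B0 : 0 <= B).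
Hypothesis Rb : forall w : C, x0 <= complex.Re w ->
  nm (Rm w) <= K * expR (- N%:R * complex.Re w) * nm (y w).
Hypothesis bB : forall i j, cn (b 0 i - b 0 j) <= B.
Variables (K' r' : R).
Hypothesis K'0 : 0 <= K'.
(** [K'] and [r'] may depend on the solution in an uncontrolled way: they do not enter the final
    bound. The exponent [B + 1] is one more than the growth of the integrating factor at the far end
    of the line. *)
Hypothesis decay : forall w : C, th0 - pi <= complex.Im w <= th0 ->
  r' <= complex.Re w -> nm (y w - 1%:M) <= K' * expR (- (B + 1) * complex.Re w).
Hypothesis BN : 2 * B + 1 <= N%:R.

Let pt (sg phi : R) : C := gre r phi +i* gim th0 sg phi.

Lemma Re_beta i j (w w' : C) (q : R) : 0 <= complex.Re w -> 0 <= complex.Re w' ->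
  `|complex.Im w - complex.Im w'| <= q ->
  complex.Re ((b 0 i - b 0 j) * (w - w')) <=
  B * (complex.Re w + complex.Re w' + q).
Proof.
move=> w0 w'0 hq.
apply: le_trans (ler_norm _) _; apply: le_trans (Re_le_cn _) _; rewrite cnM.
apply: ler_pM; rewrite ?cn_ge0 //; apply: le_trans (cn_le_ReIm _) _.
rewrite ReD ImD ReN ImN; apply: lerD => //.
by apply: le_trans (ler_normB _ _) _; rewrite !ger0_norm.
Qed.

(** Balance of the powers of |z| under the integral: -N from the remainder, B from the weighted
    bound on y, B from z^(b_i - b_j), 1 from the length element. The exponent is at most 0, so |z|
    may be replaced by its least value r. The power of |z| at the starting point gives the factor
    [expR (B * gre r phi0)], and pi bounds the range of phi. *)
Lemma line_entry (S : R) (i j : 'I_n) (sg phi0 : R) :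
  (forall sg phi, sg ^+ 2 = 1 -> - (pi / 2) < phi < pi / 2 ->
     nm (y (pt sg phi)) <= S * expR (B * gre r phi)) ->
  sg ^+ 2 = 1 -> 0 <= sg * complex.Re ((u 0 i - u 0 j) * cis th0) ->
  - (pi / 2) < phi0 < pi / 2 ->
  cn ((y (pt sg phi0) - 1%:M) i j) <=
  pi * expR (pi * B) * K * expR (- (N%:R - 2 * B - 1) * ln r) * S * expR (B * gre r phi0).
Proof.
move=> HS sg2 sgc /andP[p0 p1].
have pip := pi_gt0 R.
have sgn : `|sg| = 1 by apply/eqP; rewrite -sqrp_eq1 // real_normK ?num_real // sg2.
have cpos phi : phi0 <= phi -> phi < pi / 2 -> 0 < cos phi.
  by move=> h1 h2; apply: cos_gt0_pihalf; lra.
have c00 : 0 < cos phi0 by exact: cpos.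
have S0 : 0 <= S.
  have := le_trans (nm_ge0 _) (HS sg phi0 sg2 _); rewrite pmulr_lge0 ?expR_gt0 //.
  by apply; rewrite p0.
set A := expR (pi * B) * K * expR (- (N%:R - 2 * B - 1) * ln r) * S * expR (B * gre r phi0).
have A0 : 0 <= A by rewrite /A !mulr_ge0 ?expR_ge0.
have -> : pi * expR (pi * B) * K * expR (- (N%:R - 2 * B - 1) * ln r) * S * expR (B * gre r phi0) = A * pi.
  by rewrite /A; ring.
(* The line is cut at [phi1]. The boundary term there is a constant times 1/|z| = cos phi1 / r,
   which vanishes as phi1 tends to pi/2. *)
have step (phi1 : R) : phi0 <= phi1 -> phi1 < pi / 2 -> r' <= gre r phi1 ->
   cn ((y (pt sg phi0) - 1%:M) i j) <=
     K' * expR (B * (gre r phi0 + pi)) * (cos phi1 / r) + A * pi.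
  move=> h01 h1 hr.
  have im_dist phi : phi0 <= phi -> phi <= phi1 -> `|gim th0 sg phi0 - gim th0 sg phi| <= pi.
    move=> ? ?; rewrite /gim.
    have -> : th0 - pi / 2 + sg * phi0 - (th0 - pi / 2 + sg * phi) = sg * (phi0 - phi) by ring.
    by rewrite normrM sgn mul1r ler_norml; lra.
  have gp phi : phi0 <= phi -> phi <= phi1 -> 0 <= gre r phi.
    by move=> ? ?; apply: le_trans lr0 _; apply: gre_ge; apply: cpos; lra.
  have c1 := cpos _ h01 h1.
  apply: le_trans (@transport R n u b x0 y Rm ode i j (gre r) (gim th0 sg) tan (fun=> sg)
     phi0 phi1 (B * (gre r phi0 + gre r phi1 + pi)) A h01 _ _ _ _) _.
  - move=> s /andP[s0 s1]; have cs : 0 < cos s by apply: cpos; lra.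
    split; [exact: is_derive_gre | exact: is_derive_gim | ].
    by apply: le_trans xr _; exact: gre_ge.
  - move=> s /andP[s0 s1]; have cs : 0 < cos s by apply: cpos; lra.
    rewrite !Re_line // ler_pM2l // lerD2r; apply: ler_wpM2l => //.
    by apply: tan_mono; lra.
  - move=> s /andP[s0 s1]; have cs : 0 < cos s by apply: cpos; lra.
    exists (B * (gre r phi0 + gre r s + pi)).
      by apply: Re_beta => /=; [exact: gp | exact: gp | exact: im_dist].
    have gs := gre_ge r cs.
    (* The speed in the coordinate w is 1 / cos s, and r >= 1. *)
    have dpt : cn (tan s +i* sg : C) <= expR (gre r s).
      rewrite -(@ler_pXn2r _ 2) ?nnegrE ?cn_ge0 ?expR_ge0 //.
      rewrite sqr_cn /= sg2 expR_gre // addrC -cos2_tan2 ?lt0r_neq0 //.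
      rewrite exprMn exprVn ler_peMl ?invr_ge0 ?exprn_ge0 ?(ltW cs) //.
      by rewrite exprn_ege1 //; rewrite -[1]expR0 -[r]lnK // ler_expR.
    apply: le_trans (_ : K * expR (- N%:R * gre r s) * (S * expR (B * gre r s)) *
       expR (B * (gre r phi0 + gre r s + pi)) * expR (gre r s) <= _).
      apply: ler_pM; rewrite ?mulr_ge0 ?cn_ge0 ?expR_ge0 //.
      apply: ler_wpM2r; first exact: expR_ge0.
      apply: le_trans (nm_entry _ _ _) _.
      apply: le_trans (Rb _) _; first exact: le_trans xr gs.
      apply: ler_wpM2l; first by rewrite mulr_ge0 ?expR_ge0.
      by apply: HS => //; lra.
    have -> : K * expR (- N%:R * gre r s) * (S * expR (B * gre r s)) *
       expR (B * (gre r phi0 + gre r s + pi)) * expR (gre r s) =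
       K * S * expR (- N%:R * gre r s + B * gre r s + B * (gre r phi0 + gre r s + pi) + gre r s).
      by rewrite !expRD; ring.
    have -> : A = K * S * expR (pi * B + - (N%:R - 2 * B - 1) * ln r + B * gre r phi0).
      by rewrite /A !expRD; ring.
    rewrite ler_wpM2l ?mulr_ge0 // ler_expR.
    have : (N%:R - 2 * B - 1) * ln r <= (N%:R - 2 * B - 1) * gre r s.
      by rewrite ler_wpM2l // -addrA -opprD subr_ge0.
    move: (N%:R : R) (ln r) (gre r s) (gre r phi0) => N' l g g0; lra.
  - by apply: Re_beta => /=; [exact: gp | exact: gp | exact: im_dist].
  apply: lerD; last by rewrite ler_wpM2l //; lra.
  apply: le_trans (_ : K' * expR (- (B + 1) * gre r phi1) * expR (B * (gre r phi0 + gre r phi1 + pi)) <= _).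
    rewrite ler_wpM2r ?expR_ge0 //; apply: le_trans (nm_entry _ _ _) _.
    apply: decay => //=; rewrite /gim.
    move: sg2 => /eqP; rewrite sqrf_eq1 => /orP[]/eqP ->; lra.
  have -> : cos phi1 / r = expR (- gre r phi1).
    by rewrite expRN expR_gre // invf_div.
  rewrite -!mulrA -!expRD ler_wpM2l // ler_expR; lra.
apply/ler_addgt0Pr => eta eta0.
pose K2 := K' * expR (B * (gre r phi0 + pi)) / r.
have K20 : 0 <= K2 by rewrite /K2 divr_ge0 ?mulr_ge0 ?expR_ge0 // ltW.
(* Three demands on the cut pi/2 - dl: it lies beyond [phi0], it has reached the region of decay,
   and its boundary term is at most [eta]. *)
pose dl := Order.min (pi / 2 - phi0) (Order.min (r * expR (- r')) (eta / (1 + K2))) / 2.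
have dl0 : 0 < dl.
  by rewrite divr_gt0 // !lt_min subr_gt0 p1 mulr_gt0 ?expR_gt0 // divr_gt0 // ltr_pwDl.
have : 2 * dl <= Order.min (pi / 2 - phi0) (Order.min (r * expR (- r')) (eta / (1 + K2))).
  by rewrite mulrC divfK.
rewrite !le_min => /and3P[d1 d2 d3].
have hcos : cos (pi / 2 - dl) <= dl by apply: le_trans (cos_le_dist _) _; lra.
have h01 : phi0 <= pi / 2 - dl by lra.
have h1 : pi / 2 - dl < pi / 2 by lra.
have c1 := cpos _ h01 h1.
have hr : r' <= gre r (pi / 2 - dl).
  rewrite -ler_expR expR_gre // ler_pdivlMr // mulrC -ler_pdivlMr ?expR_gt0 //.
  by rewrite -expRN; lra.
apply: le_trans (step _ h01 h1 hr) _; rewrite addrC lerD2l.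
have -> : K' * expR (B * (gre r phi0 + pi)) * (cos (pi / 2 - dl) / r) = K2 * cos (pi / 2 - dl).
  by rewrite /K2; ring.
apply: le_trans (_ : (1 + K2) * dl <= _).
  by apply: ler_pM => //; [exact: ltW | rewrite lerDr].
rewrite mulrC -ler_pdivlMr ?ltr_pwDl //; lra.
Qed.

Lemma line_bounded : exists M : R, forall sg phi, sg ^+ 2 = 1 ->
  - (pi / 2) < phi < pi / 2 -> nm (y (pt sg phi)) <= M.
Proof.
have pip := pi_gt0 R.
have [G G0 HG] := ode_growth r' (`|r'| + `|ln r| + pi) ode xr lr0 K0 Rb.
pose w0 : C := ln r +i* (th0 - pi / 2).
exists ((K' + n%:R) + G * nm (y w0)) => sg phi sg2 /andP[p0 p1].
have c0 : 0 < cos phi by apply: cos_gt0_pihalf; lra.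
have gl := gre_ge r c0.
have imd : `|sg * phi| <= pi / 2.
  move: sg2 => /eqP; rewrite sqrf_eq1 => /orP[]/eqP ->; rewrite ler_norml; lra.
have [hr|hr] := leP r' (gre r phi).
  apply: le_trans (_ : K' + n%:R <= _); last by rewrite lerDl mulr_ge0 ?nm_ge0.
  rewrite -(subrK 1%:M (y _)); apply: le_trans (nmD _ _) _; rewrite nm1 lerD2r.
  apply: le_trans (@decay (pt sg phi) _ hr) _.
    by rewrite /= /gim; move: imd; rewrite ler_norml; lra.
  rewrite ler_piMr // -[1]expR0 ler_expR /= mulNr oppr_le0.
  by apply: mulr_ge0; [rewrite addr_ge0 | exact: le_trans gl].
apply: le_trans (_ : G * nm (y w0) <= _); last by rewrite lerDr addr_ge0.
apply: HG; [by rewrite lexx /=; exact: le_trans gl (ltW hr) | by rewrite gl ltW|].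
apply: le_trans (cn_le_ReIm _) _; rewrite ReD ImD ReN ImN /= /gim.
apply: lerD; last first.
  have -> : th0 - pi / 2 + sg * phi - (th0 - pi / 2) = sg * phi by ring.
  by apply: le_trans imd _; lra.
rewrite ger0_norm ?subr_ge0 //.
by have := ler_norm r'; have := normr_ge0 (ln r); have := lr0; lra.
Qed.

(** Absorption: [S] is the supremum of the weighted norm of y over both orientations of the line.
    The entry estimates bound y - 1 by [kap * S] times the weight, so S <= n + kap S, and S <= 2 n
    since S is finite and kap <= 1/2. *)
Lemma line_bound :
  let kap := (n * n)%:R * (pi * expR (pi * B) * K * expR (- (N%:R - 2 * B - 1) * ln r)) in
  kap <= 1 / 2 -> forall sg phi, sg ^+ 2 = 1 -> - (pi / 2) < phi < pi / 2 ->
  nm (y (pt sg phi) - 1%:M) <= kap * (2 * n%:R) * expR (B * gre r phi).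
Proof.
move=> kap kap2.
have pip := pi_gt0 R.
have kap0 : 0 <= kap by rewrite /kap !mulr_ge0 ?expR_ge0 // ltW.
have [M HM] := line_bounded.
pose E : set R := [set v | exists sg phi, [/\ sg ^+ 2 = 1, - (pi / 2) < phi < pi / 2 &
   v = nm (y (pt sg phi)) * expR (- (B * gre r phi))]].
have E0 : E !=set0.
  exists (nm (y (pt 1 0)) * expR (- (B * gre r 0))), 1, 0; split => //.
    by rewrite expr1n.
  by apply/andP; split; lra.
have gp phi : - (pi / 2) < phi < pi / 2 -> 0 <= gre r phi.
  by move=> h; apply: le_trans lr0 _; apply: gre_ge; exact: cos_gt0_pihalf.
have EM : ubound E M.
  move=> _ [sg [phi [sg2 hp ->]]]; apply: le_trans (HM sg phi sg2 hp).
  by rewrite ler_piMr ?nm_ge0 // -[leRHS]expR0 ler_expR oppr_le0 mulr_ge0 // gp.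
pose S := sup E.
have HS sg phi : sg ^+ 2 = 1 -> - (pi / 2) < phi < pi / 2 ->
     nm (y (pt sg phi)) <= S * expR (B * gre r phi).
  move=> sg2 hp; rewrite -ler_pdivrMr ?expR_gt0 // -expRN.
  by apply: ub_le_sup; [exists M | exists sg, phi].
have HD sg phi : sg ^+ 2 = 1 -> - (pi / 2) < phi < pi / 2 ->
     nm (y (pt sg phi) - 1%:M) <= kap * S * expR (B * gre r phi).
  move=> sg2 hp; rewrite /kap -!mulrA; apply: nm_le_entry => i j.
  have [sg' sg'2 sgc] : exists2 sg' : R, sg' ^+ 2 = 1 &
      0 <= sg' * complex.Re ((u 0 i - u 0 j) * cis th0).
    have [h|h] := leP 0 (complex.Re ((u 0 i - u 0 j) * cis th0)).
      by exists 1; rewrite ?expr1n // mul1r.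
    by exists (-1); rewrite ?sqrrN ?expr1n // mulN1r oppr_ge0 ltW.
  (* The same point seen with the other orientation: each entry is integrated towards the end that
     suits the sign of its own Re((u_i - u_j) e^(i th0)). *)
  have -> : pt sg phi = pt sg' (sg' * (sg * phi)).
    rewrite /pt /gre !cos_sg // /gim mulrA -expr2 sg'2 mul1r //.
  have ce : gre r phi = gre r (sg' * (sg * phi)) by rewrite /gre !cos_sg.
  rewrite ce; have := @line_entry S i j sg' (sg' * (sg * phi)) HS sg'2 sgc.
  rewrite -!mulrA; apply.
  move: sg2 sg'2 hp => /eqP; rewrite sqrf_eq1 => /orP[]/eqP -> /eqP;
    rewrite sqrf_eq1 => /orP[]/eqP ->; lra.
have S2 : S <= n%:R + kap * S.
  apply: ge_sup => // _ [sg [phi [sg2 hp ->]]].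
  have w0 : expR (- (B * gre r phi)) <= 1.
    by rewrite -[leRHS]expR0 ler_expR oppr_le0 mulr_ge0 // gp.
  rewrite expRN ler_pdivrMr ?expR_gt0 //.
  rewrite -(subrK 1%:M (y _)); apply: le_trans (nmD _ _) _; rewrite nm1 addrC mulrDl.
  apply: lerD; last exact: HD.
  by rewrite ler_peMr // -[leLHS]expR0 ler_expR mulr_ge0 // gp.
have S0 : 0 <= S.
  have /andP hp : - (pi / 2) < (0 : R) /\ (0 : R) < pi / 2 by split; lra.
  have := le_trans (nm_ge0 _) (HS 1 0 (expr1n _ _) hp); rewrite pmulr_lge0 ?expR_gt0 //.
have S3 : S <= 2 * n%:R.
  have : kap * S <= 1 / 2 * S by rewrite ler_wpM2r.
  move: S2; move: (kap * S) (n%:R : R) => a c; lra.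
move=> sg phi sg2 hp; apply: le_trans (HD sg phi sg2 hp) _.
by rewrite ler_wpM2r ?expR_ge0 // ler_wpM2l.
Qed.

End Line.
End LineEstimate.

Section SectorEstimates.
Variables (R : realType) (n : nat).
Local Notation C := (cplx R).

Definition remainder_bound (x0 K : R) (N : nat) (y Rm : C -> 'M[C]_n) :=
  forall w : C, x0 <= complex.Re w ->
    nm (Rm w) <= K * expR (- N%:R * complex.Re w) * nm (y w).

Lemma sin_le_cos (eps phi : R) : 0 < eps -> eps <= pi / 2 ->
  - (pi / 2) + eps <= phi <= pi / 2 - eps -> sin eps <= cos phi.
Proof.
move=> e0 ep /andP[h1 h2]; have pip := pi_gt0 R.
rewrite -cos_norm -[`|phi|](subKr (pi / 2)) cosB cos_pihalf sin_pihalf mul0r add0r mul1r.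
have np : `|phi| <= pi / 2 - eps by rewrite ler_norml; lra.
have np0 := normr_ge0 phi.
by rewrite leNgt ltr_sin ?in_itv /= -?leNgt //; lra.
Qed.

(** [X1] and [K1] are fixed before [u], [b] and [y], so the bound is uniform in t; the constants of
    the assumed decay stay behind the quantifier. A distance [eps] from the edge is kept so that the
    distance of z to the edge is comparable with |z|. *)
Lemma half_plane_estimate (N : nat) (B K x0 eps : R) :
  0 <= B -> 0 <= K -> 0 <= x0 -> 0 < eps -> eps <= pi / 2 -> 2 * B + 2 <= N%:R ->
  exists X1 K1 : R, forall (u b : 'rV[C]_n) (y Rm : C -> 'M[C]_n) (th0 : R),
    reduced_ode u b x0 y Rm -> remainder_bound x0 K N y Rm ->
    (forall i j, cn (b 0 i - b 0 j) <= B) ->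
    (exists K' r' : R, 0 <= K' /\ forall w : C, th0 - pi <= complex.Im w <= th0 ->
       r' <= complex.Re w -> nm (y w - 1%:M) <= K' * expR (- (B + 1) * complex.Re w)) ->
    forall w : C, X1 <= complex.Re w -> th0 - pi + eps <= complex.Im w <= th0 - eps ->
      nm (y w - 1%:M) <= K1 * expR (- (N%:R - 3 * B - 1) * complex.Re w).
Proof.
move=> B0 K0 x00 e0 ep BN; have pip := pi_gt0 R.
have q0 : 0 < sin eps by apply: sin_gt0_pi; lra.
set q := sin eps in q0.
pose C0 := (n * n)%:R * (pi * expR (pi * B) * K).
have C00 : 0 <= C0 by rewrite /C0 !mulr_ge0 ?expR_ge0 // ltW.
have lnC : 0 <= ln (2 * C0 + 1) by rewrite ln_ge0 // lerDr mulr_ge0.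
have lnq : ln q <= 0 by rewrite ln_le0 // sin_le1.
pose M : R := N%:R - 2 * B - 1.
have M1 : 1 <= M by rewrite /M; move: (N%:R : R) BN => N' BN; lra.
(* With this [X1], ln r exceeds x0 + ln (2 C0 + 1). The first summand puts the line inside the
   domain, the second makes [kap] at most 1/2. *)
exists (- ln q + x0 + ln (2 * C0 + 1)), (2 * n%:R * C0 * expR (- M * ln q)).
move=> u b y Rm th0 ode Rb bB [K' [r' [K'0 dec]]] w wX /andP[w1 w2].
pose phi := complex.Im w - th0 + pi / 2.
have p1 : - (pi / 2) + eps <= phi <= pi / 2 - eps by rewrite /phi; lra.
have cq : q <= cos phi by exact: sin_le_cos.
have c0 : 0 < cos phi by exact: lt_le_trans cq.
(* The line through z parallel to the edge of the half-plane lies at distance |z| cos phi from the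
   origin. *)
pose r := expR (complex.Re w) * cos phi.
have r0 : 0 < r by rewrite mulr_gt0 ?expR_gt0.
have lr : ln r = complex.Re w + ln (cos phi) by rewrite lnM ?posrE ?expR_gt0 // expRK.
have lc : ln q <= ln (cos phi) by rewrite ler_ln ?posrE.
have xr : x0 <= ln r by rewrite lr; lra.
have lr0 : 0 <= ln r by exact: le_trans xr.
have NE : expR (- M * ln r) <= expR (- ln (2 * C0 + 1)).
  rewrite ler_expR.
  have : 1 * ln r <= M * ln r by exact: ler_wpM2r.
  by rewrite lr; lra.
have D0 : 0 < 2 * C0 + 1 by rewrite ltr_wpDl // mulr_ge0.
pose kap := (n * n)%:R * (pi * expR (pi * B) * K * expR (- M * ln r)).
have kapE : kap = C0 * expR (- M * ln r) by rewrite /kap /C0 !mulrA.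
have kap2 : kap <= 1 / 2.
  rewrite kapE; apply: le_trans (ler_wpM2l C00 NE) _.
  rewrite expRN lnK ?posrE // ler_pdivrMr //; lra.
have BN1 : 2 * B + 1 <= N%:R by apply: le_trans BN; rewrite lerD2l ler1n.
have := @line_bound R n u b x0 y Rm B K th0 r N ode r0 xr lr0 K0 B0 Rb bB K' r' K'0 dec BN1 kap2 1 phi.
rewrite expr1n; move=> /(_ erefl).
have greE : gre r phi = complex.Re w by rewrite /gre lr addrK.
have gimE : gim th0 1 phi = complex.Im w by rewrite /gim /phi; ring.
have wE : (gre r phi +i* gim th0 1 phi : C) = w by rewrite greE gimE; case: (w).
rewrite wE greE => H; apply: le_trans (H _) _; first by lra.
rewrite -/M -/kap kapE.
apply: le_trans (_ : C0 * expR (- M * (complex.Re w + ln q)) * (2 * n%:R) * expR (B * complex.Re w) <= _).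
  rewrite !ler_wpM2r ?expR_ge0 // ler_wpM2l // ler_expR !mulNr lerN2 ler_wpM2l //.
    by apply: le_trans M1.
  by rewrite lr lerD2l.
rewrite le_eqVlt; apply/orP; left; apply/eqP.
have -> : - (N%:R - 3 * B - 1) * complex.Re w = - M * complex.Re w + B * complex.Re w.
  by rewrite /M; ring.
by rewrite mulrDr !expRD; ring.
Qed.

Lemma cis_seg_derive (c : C) (th1 sg : R) (s : R) :
  is_derive s 1 (fun s => complex.Re (c * cis (th1 + sg * s)))
     (complex.Re (c * cis (th1 + sg * s) * (0 +i* sg))).
Proof.
have h : (fun s => complex.Re (c * cis (th1 + sg * s))) =
  (fun s : R => complex.Re (c * cexp ((0 + s * 0) +i* (th1 + s * sg)))).
  by apply/funext => x; rewrite cexpE /= mulr0 addr0 expR0 mul1r [x * sg]mulrC.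
have := path_derive c (is_derive_line 0 0 s) (is_derive_line th1 sg s) (is_derive_cexp _).
rewrite -h; move/is_derive_eq; apply.
by rewrite cexpE /= mulr0 addr0 expR0 mul1r mulrA [s * sg]mulrC.
Qed.

(* The direction kap - i sg of the coordinate w is that of a logarithmic spiral in
   the z-plane along which Re (c z) increases. *)
Lemma spiral_rate (c : C) (th1 sg Dl : R) : 0 <= Dl -> sg ^+ 2 = 1 ->
  (c = 0 \/ forall s, 0 <= s <= Dl -> complex.Re (c * cis (th1 + sg * s)) != 0) ->
  exists kap : R, forall s, 0 <= s <= Dl ->
    0 <= complex.Re (c * cis (th1 + sg * s) * (kap -i* sg)).
Proof.
move=> D0 sg2 [->|H].
  by exists 0 => s _; rewrite !mul0r.
pose f (s : R) := complex.Re (c * cis (th1 + sg * s)).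
have fc : {within `[0, Dl], continuous f}.
  by apply: derivable_within_continuous => s _; have [] := cis_seg_derive c th1 sg s.
have [m m0 Hm] : exists2 m : R, 0 < m & forall s, 0 <= s <= Dl -> m <= `|f s|.
  have nc : {within `[0, Dl], continuous (fun s => `|f s|)}.
    by move=> s; apply: continuous_comp; [exact: fc | exact: norm_continuous].
  have [s0 s0D Hs] := EVT_min D0 nc.
  exists `|f s0|; first by rewrite normr_gt0; apply: H; move: s0D; rewrite in_itv.
  by move=> s sD; apply: Hs; rewrite in_itv.
have sgn : (forall s, 0 <= s <= Dl -> 0 < f s) \/ (forall s, 0 <= s <= Dl -> f s < 0).
  have f0 : f 0 != 0 by apply: H; rewrite lexx.
  have key s : 0 <= s <= Dl -> ~ (Num.min (f 0) (f s) <= 0 <= Num.max (f 0) (f s)).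
    move=> /andP[s0 sD] hm.
    have fcs : {within `[0, s], continuous f}.
      apply: continuous_subspaceW fc => x /=; rewrite !in_itv /= => /andP[-> /le_trans]; exact.
    have [x] := IVT s0 fcs hm; rewrite in_itv /= => /andP[x0 xs] fx.
    by have := H x; rewrite x0 (le_trans xs sD) -/(f x) fx eqxx => /(_ isT).
  case: (ltgtP (f 0) 0) f0 => // hf _; [right|left] => s sD.
    rewrite ltNge; apply/negP => fs; apply: (key s sD).
    by rewrite ge_min (ltW hf) le_max fs orbT.
  rewrite ltNge; apply/negP => fs; apply: (key s sD).
  by rewrite ge_min fs le_max (ltW hf) orbT.
(* On the compact arc |Re(c e^(i theta))| >= m, so [kap] times it dominates the contribution of the
   imaginary part, which is at most [cn c]. The sign of the rate follows the constant sign of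
   [f]. *)
pose kap := cn c / m.
have kb s : cn c <= kap * `|f s| \/ ~ (0 <= s <= Dl).
  have [sD|sD] := boolP (0 <= s <= Dl); last by right; apply/negP.
  left; rewrite /kap mulrAC ler_pdivlMr // ler_wpM2l ?cn_ge0 //; exact: Hm.
have bIm s : `|sg * complex.Im (c * cis (th1 + sg * s))| <= cn c.
  have sgn1 : `|sg| = 1 by apply/eqP; rewrite -sqrp_eq1 // real_normK ?num_real // sg2.
  rewrite normrM sgn1 mul1r; apply: le_trans (Im_le_cn _) _; rewrite cnM.
  have -> : cn (cis (th1 + sg * s)) = 1.
    by apply/eqP; rewrite -sqrp_eq1 ?cn_ge0 // sqr_cn /= cos2Dsin2.
  by rewrite mulr1.
case: sgn => sgn; [exists kap | exists (- kap)] => s sD; rewrite ReM /= [_ * - sg]mulrN opprK;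
  have := bIm s; rewrite ler_norml => /andP[b1 b2]; have := sgn s sD;
  case: (kb s) => // kbs; have := kbs; rewrite -/(f s) => + fs.
  rewrite (gtr0_norm fs) => h; move: b1 h; rewrite [sg * _]mulrC mulrC; lra.
rewrite (ltr0_norm fs) => h; move: b1 h; rewrite [sg * _]mulrC; lra.
Qed.

End SectorEstimates.

(** * Extension of estimates along logarithmic spirals *)

Section SpiralExtension.
Variables (R : realType) (n : nat).
Local Notation C := (cplx R).
Variables (u b : 'rV[C]_n) (y Rm : C -> 'M[C]_n).
Variables (N : nat) (B K x0 M th1 sg Dl K1 X1 : R).
Hypotheses (ode : reduced_ode u b x0 y Rm) (Rb : remainder_bound x0 K N y Rm).
Hypotheses (x00 : 0 <= x0) (K0 : 0 <= K) (B0 : 0 <= B) (D0 : 0 <= Dl) (K10 : 0 <= K1).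
Hypothesis bB : forall i j, cn (b 0 i - b 0 j) <= B.
Hypothesis sg2 : sg ^+ 2 = 1.
Hypotheses (M0 : 0 <= M) (MN : M <= N%:R) (N1 : 1 <= N%:R :> R).
Hypothesis base : forall w : C, complex.Im w = th1 -> X1 <= complex.Re w ->
  nm (y w - 1%:M) <= K1 * expR (- M * complex.Re w).

Section Rate.
Variables (kap : 'I_n -> 'I_n -> R) (Kap : R).
Hypothesis kapP : forall i j s, 0 <= s <= Dl ->
  0 <= complex.Re ((u 0 i - u 0 j) * cis (th1 + sg * s) * (kap i j -i* sg)).
Hypothesis kapK : forall i j, `|kap i j| <= Kap.
Hypothesis Kap0 : 0 <= Kap.

Let q := B * ((Kap + 1) * Dl).

(** After time [s] the spiral from [w] meets the direction [th1], where [base] applies. In the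
    coordinate w its length is at most (Kap + 1) Dl, so z^(b_i - b_j) changes by at most the factor
    [expR q] and no power of |z| is lost. *)
Lemma spiral_entry (S xi : R) (i j : 'I_n) (w : C) (s : R) : 0 <= S ->
  x0 <= xi -> X1 <= xi ->
  0 <= s <= Dl -> complex.Im w = th1 + sg * s ->
  (forall s', 0 <= s' <= s -> xi <= complex.Re w + s' * kap i j /\
     nm (y ((complex.Re w + s' * kap i j) +i* (complex.Im w + s' * - sg))) <= S) ->
  cn ((y w - 1%:M) i j) <=
    K1 * expR (- M * xi) * expR q + K * (Kap + 1) * expR q * S * expR (- N%:R * xi) * Dl.
Proof.
move=> S0 xi0 xi1 /andP[s0 sD] wI H.
have sgn : `|sg| = 1 by apply/eqP; rewrite -sqrp_eq1 // real_normK ?num_real // sg2.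
pose pr s' := complex.Re w + s' * kap i j.
pose pi s' := complex.Im w + s' * - sg.
have w0E : (pr 0 +i* pi 0 : C) = w by rewrite /pr /pi !mul0r !addr0; case: (w).
have piE s' : pi s' = th1 + sg * (s - s') by rewrite /pi wI; ring.
set A := K * (Kap + 1) * expR q * S * expR (- N%:R * xi).
have A0 : 0 <= A.
  by rewrite /A !mulr_ge0 ?expR_ge0 // addr_ge0.
have qP s' : 0 <= s' <= s -> complex.Re ((b 0 i - b 0 j) * ((pr 0 +i* pi 0) - (pr s' +i* pi s'))) <= q.
  move=> /andP[s'0 s's].
  apply: le_trans (ler_norm _) _; apply: le_trans (Re_le_cn _) _; rewrite cnM.
  apply: ler_pM; rewrite ?cn_ge0 //; apply: le_trans (cn_le_ReIm _) _.
  rewrite ReD ImD ReN ImN /= /pr /pi.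
  have -> : complex.Re w + 0 * kap i j - (complex.Re w + s' * kap i j) = - (s' * kap i j) by ring.
  have -> : complex.Im w + 0 * - sg - (complex.Im w + s' * - sg) = s' * sg by ring.
  rewrite normrN !normrM sgn mulr1 (ger0_norm s'0).
  have -> : s' * `|kap i j| + s' = (`|kap i j| + 1) * s' by ring.
  apply: ler_pM; [by rewrite addr_ge0 | exact: s'0 | by rewrite lerD2r |].
  exact: le_trans sD.
have := @transport R n u b x0 y Rm ode i j pr pi (fun=> kap i j) (fun=> - sg) 0 s q A s0.
rewrite w0E subr0 => T; apply: le_trans (T _ _ _ _) _.
- move=> s' /H[h1 _]; split; [exact: is_derive_line | exact: is_derive_line | ].
  exact: le_trans h1.
- move=> s' /andP[s'0 s's]; rewrite -w0E.
  have dF (x : R) : 0 <= x <= s' -> is_derive x 1 (fun x => complex.Re ((u 0 i - u 0 j) * cexp (pr x +i* pi x)))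
     (complex.Re ((u 0 i - u 0 j) * (cexp (pr x +i* pi x) * (kap i j +i* - sg)))).
    move=> _; apply: path_derive; [exact: is_derive_line | exact: is_derive_line | exact: is_derive_cexp].
  have [x /andP[hx0 hxs] E] := MVT_derivable s'0 dF.
  rewrite -subr_ge0 E subr0 mulr_ge0 // cexpE /=.
  have -> : (u 0 i - u 0 j) * ((expR (pr x))%:C * cis (pi x) * (kap i j -i* sg)) =
     (expR (pr x))%:C * ((u 0 i - u 0 j) * cis (pi x) * (kap i j -i* sg)) :> C by ring.
  rewrite ReM /= mul0r subr0 mulr_ge0 ?expR_ge0 // piE; apply: kapP; lra.
- move=> s' s's; exists q; first by move: (qP s' s's); rewrite w0E.
  have [h1 h2] := H s' s's.
  apply: le_trans (_ : K * expR (- N%:R * xi) * S * expR q * (Kap + 1) <= _); last first.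
    by rewrite le_eqVlt; apply/orP; left; apply/eqP; rewrite /A; ring.
  apply: ler_pM; rewrite ?mulr_ge0 ?cn_ge0 ?expR_ge0 //; last first.
    apply: le_trans (cn_le_ReIm _) _; rewrite /= normrN sgn lerD2r //.
  apply: ler_wpM2r; first exact: expR_ge0.
  apply: le_trans (nm_entry _ _ _) _; apply: le_trans (Rb _) _; first exact: le_trans h1.
  apply: ler_pM; rewrite ?mulr_ge0 ?nm_ge0 ?expR_ge0 //.
  apply: ler_wpM2l => //; rewrite ler_expR /= !mulNr lerN2.
  by apply: ler_wpM2l.
- by have := qP s; rewrite w0E; apply; rewrite s0 lexx.
apply: lerD; last exact: ler_wpM2l.
apply: ler_wpM2r; first exact: expR_ge0.
have [|h1 _] := H s; first by rewrite s0 lexx.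
apply: le_trans (nm_entry _ _ _) _; apply: le_trans (base _ _) _.
- by rewrite /= piE subrr mulr0 addr0.
- exact: le_trans h1.
apply: ler_wpM2l => //; rewrite ler_expR /= !mulNr lerN2; exact: ler_wpM2l.
Qed.

Lemma spiral_extension_rate : exists K2 X2 : R, forall (w : C) (s : R), 0 <= s <= Dl ->
  complex.Im w = th1 + sg * s -> X2 <= complex.Re w ->
  nm (y w - 1%:M) <= K2 * expR (- M * complex.Re w).
Proof.
have sgn : `|sg| = 1 by apply/eqP; rewrite -sqrp_eq1 // real_normK ?num_real // sg2.
pose C0 := (n * n)%:R * (K * (Kap + 1) * expR q * Dl).
have C00 : 0 <= C0 by rewrite /C0 !mulr_ge0 ?expR_ge0 // addr_ge0.
have D1 : 0 < 2 * C0 + 1 by rewrite ltr_wpDl // mulr_ge0.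
have lnC : 0 <= ln (2 * C0 + 1) by rewrite ln_ge0 // lerDr mulr_ge0.
pose X3 := Num.max x0 X1 + ln (2 * C0 + 1).
have x03 : x0 <= X3 by apply: le_trans (_ : Num.max x0 X1 <= _); rewrite ?le_max ?lexx // lerDl.
have x13 : X1 <= X3 by apply: le_trans (_ : Num.max x0 X1 <= _); rewrite ?le_max ?lexx ?orbT // lerDl.
have X30 : 0 <= X3 by exact: le_trans x03.
have C0X : C0 * expR (- N%:R * X3) <= 1 / 2.
  apply: le_trans (_ : C0 * expR (- ln (2 * C0 + 1)) <= _).
    apply: ler_wpM2l => //; rewrite ler_expR mulNr lerN2.
    apply: le_trans (_ : 1 * X3 <= _); last exact: ler_wpM2r.
    by rewrite mul1r lerDr; apply: le_trans x00 _; rewrite le_max lexx.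
  by rewrite expRN lnK ?posrE // ler_pdivrMr //; lra.
pose S1 := 2 * (n%:R + (n * n)%:R * (K1 * expR q)).
have S10 : 0 <= S1 by rewrite /S1 !(mulr_ge0, addr_ge0) ?expR_ge0.
(* Different entries follow different spirals, so the supremum of |y| is taken over a region stable
   under all of them: its sides have slope [Kap], the largest rate. The cut-off [L] makes it
   bounded, hence the supremum finite; the resulting bound [S1] is free of [L]. *)
pose inT L w s := [/\ 0 <= s <= Dl, complex.Im w = th1 + sg * s,
   X3 <= complex.Re w - Kap * s & complex.Re w + Kap * s <= L].
have inT_path L (w : C) s i j s' : inT L w s -> 0 <= s' <= s ->
   inT L ((complex.Re w + s' * kap i j) +i* (complex.Im w + s' * - sg)) (s - s').
  move=> [/andP[s0 sD] wI h1 h2] /andP[s'0 s's]; split => /=; first by lra.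
  - by rewrite wI; ring.
  - have := kapK i j; rewrite ler_norml => /andP[k1 k2]; nra.
  - have := kapK i j; rewrite ler_norml => /andP[k1 k2]; nra.
have inT_Re L (w : C) s : inT L w s -> X3 <= complex.Re w <= L.
  move=> [/andP[s0 sD] _ h1 h2].
  have : 0 <= Kap * s by exact: mulr_ge0.
  lra.
have bound L (w : C) s : inT L w s -> nm (y w) <= S1.
  move=> wT.
  have XL : X3 <= L by have /andP[h1 h2] := inT_Re _ _ _ wT; exact: le_trans h2.
  pose E : set R := [set v | exists w' s', inT L w' s' /\ v = nm (y w')].
  have E0 : E !=set0 by exists (nm (y w)), w, s.
  have [G G0 HG] := ode_growth L (L - X3 + Dl) ode x03 X30 K0 Rb.
  have EU : ubound E (G * nm (y (X3 +i* th1))).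
    move=> _ [w' [s' [wT' ->]]]; apply: HG => /=; [by rewrite lexx|exact: inT_Re wT'|].
    have /andP[h1 h2] := inT_Re _ _ _ wT'.
    have [/andP[s0 sD] wI _ _] := wT'.
    apply: le_trans (cn_le_ReIm _) _; rewrite ReD ImD ReN ImN /=.
    apply: lerD; first by rewrite ger0_norm ?subr_ge0 // lerD2r.
    rewrite wI addrAC subrr add0r normrM sgn mul1r ger0_norm //.
  have HS w' s' : inT L w' s' -> nm (y w') <= sup E.
    by move=> wT'; apply: ub_le_sup; [exists (G * nm (y (X3 +i* th1))) | exists w', s'].
  have S0 : 0 <= sup E by apply: le_trans (nm_ge0 (y w)) _; exact: HS wT.
  have S2 : sup E <= n%:R + (n * n)%:R * (K1 * expR q) + C0 * expR (- N%:R * X3) * sup E.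
    apply: ge_sup => // _ [w' [s' [wT' ->]]].
    rewrite -(subrK 1%:M (y _)); apply: le_trans (nmD _ _) _; rewrite nm1 addrC -addrA lerD2l.
    apply: le_trans (_ : (n * n)%:R * (K1 * expR (- M * X3) * expR q + K * (Kap + 1) * expR q * sup E * expR (- N%:R * X3) * Dl) <= _).
      apply: nm_le_entry => i j; have [h1 h2 _ _] := wT'.
      apply: (@spiral_entry (sup E) X3 i j w' s') => // s'' h3.
      have wT2 := inT_path _ _ _ i j _ wT' h3.
      by split; [have /andP[] := inT_Re _ _ _ wT2 | exact: HS wT2].
    rewrite mulrDr; apply: lerD.
      rewrite ler_wpM2l // ler_wpM2r ?expR_ge0 // ler_piMr // -[leRHS]expR0 ler_expR.
      by rewrite mulNr oppr_le0 mulr_ge0.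
    by rewrite le_eqVlt; apply/orP; left; apply/eqP; rewrite /C0; ring.
  have : C0 * expR (- N%:R * X3) * sup E <= 1 / 2 * sup E by rewrite ler_wpM2r.
  have := HS _ _ wT; rewrite /S1; move: S2.
  move: (C0 * expR (- N%:R * X3) * sup E) (sup E) (n%:R + (n * n)%:R * (K1 * expR q)) (nm (y w)).
  move=> a1 a2 a3 a4; lra.
(* The entry estimate is used with xi = Re w - Kap Dl, a lower bound for the real part along every
   spiral from [w]; this accounts for the factors in [Kap * Dl]. *)
exists ((n * n)%:R * (K1 * expR (M * (Kap * Dl)) * expR q + K * (Kap + 1) * expR q * S1 * expR (N%:R * (Kap * Dl)) * Dl)).
exists (X3 + Kap * Dl) => w s sD wI wX.
rewrite -[leRHS]mulrA; apply: nm_le_entry => i j.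
have wT : inT (complex.Re w + Kap * s) w s.
  split => //; case/andP: sD => s0 sD.
  have : Kap * s <= Kap * Dl by exact: ler_wpM2l.
  lra.
pose xi := complex.Re w - Kap * Dl.
apply: le_trans (@spiral_entry S1 xi i j w s S10 _ _ sD wI _) _.
- by apply: le_trans x03 _; rewrite lerBrDr.
- by apply: le_trans x13 _; rewrite lerBrDr.
- move=> s' s's; split; last exact: bound (inT_path _ _ _ i j _ wT s's).
  rewrite /xi lerD2l -mulNr mulrC.
  have := kapK i j; rewrite ler_norml => /andP[k1 k2].
  case/andP: s's => s'0 s's; case/andP: sD => s0 sD.
  have : s' * (- Kap) <= s' * kap i j by exact: ler_wpM2l.
  have : s' * Kap <= Dl * Kap by rewrite ler_wpM2r //; exact: le_trans sD.
  lra.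
rewrite mulrDl; apply: lerD.
  rewrite le_eqVlt; apply/orP; left; apply/eqP.
  have -> : expR (- M * xi) = expR (M * (Kap * Dl)) * expR (- M * complex.Re w).
    by rewrite -expRD; congr expR; rewrite /xi; ring.
  ring.
have -> : expR (- N%:R * xi) = expR (N%:R * (Kap * Dl)) * expR (- N%:R * complex.Re w).
  by rewrite -expRD; congr expR; rewrite /xi; ring.
have -> : K * (Kap + 1) * expR q * S1 * (expR (N%:R * (Kap * Dl)) * expR (- N%:R * complex.Re w)) * Dl =
  K * (Kap + 1) * expR q * S1 * expR (N%:R * (Kap * Dl)) * Dl * expR (- N%:R * complex.Re w) by ring.
apply: ler_wpM2l.
  exact: (mulr_ge0 (mulr_ge0 (mulr_ge0 (mulr_ge0 (mulr_ge0 K0 (addr_ge0 Kap0 ler01))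
    (expR_ge0 _)) S10) (expR_ge0 _)) D0).
rewrite ler_expR !mulNr lerN2; apply: ler_wpM2r => //.
apply: le_trans X30 (le_trans _ wX); rewrite lerDl; exact: mulr_ge0.
Qed.

End Rate.

Lemma spiral_extension :
  (forall i j, u 0 i - u 0 j = 0 \/ forall s, 0 <= s <= Dl ->
     complex.Re ((u 0 i - u 0 j) * cis (th1 + sg * s)) != 0) ->
  exists K2 X2 : R, forall (w : C) (s : R), 0 <= s <= Dl ->
    complex.Im w = th1 + sg * s -> X2 <= complex.Re w ->
    nm (y w - 1%:M) <= K2 * expR (- M * complex.Re w).
Proof.
move=> H.
have /choice[kap kapP] : forall ij : 'I_n * 'I_n, exists k : R, forall s, 0 <= s <= Dl ->
   0 <= complex.Re ((u 0 ij.1 - u 0 ij.2) * cis (th1 + sg * s) * (k -i* sg)).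
  by case=> i j; exact: spiral_rate.
apply: (@spiral_extension_rate (fun i j => kap (i, j)) (\sum_ij `|kap ij|)).
- by move=> i j s sD; exact: (kapP (i, j)).
- by move=> i j; rewrite (bigD1 (i, j)) //= lerDl; apply: sumr_ge0.
- by apply: sumr_ge0.
Qed.

End SpiralExtension.

(** * Truncated formal solutions *)

Section Reduction.
Variables (R : realType) (n : nat).
Local Notation C := (cplx R).

Lemma triangular_sum (V : zmodType) (G : nat -> nat -> V) N :
  \sum_(0 <= m < N.+1) \sum_(0 <= j < m.+1) G j (m - j)%N =
  \sum_(0 <= j < N.+1) \sum_(0 <= k < N.+1 - j) G j k.
Proof.
elim: N => [|N IH]; first by rewrite !big_nat1 ?subn0 ?subnn.
rewrite big_nat_recr //= IH [RHS]big_nat_recr //= [X in _ + X = _]big_nat_recr //=.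
rewrite subnn subSn // subnn big_nat1 addrA; congr (_ + _).
rewrite -big_split /=; apply: eq_big_nat => j /andP[_ jN].
by rewrite [in RHS]subSn 1?ltnW // big_nat_recr.
Qed.

Definition trunc (F : nat -> 'M[C]_n) (N : nat) (w : C) : 'M[C]_n :=
  1%:M + \sum_(1 <= j < N.+1) (cexp w) ^- j *: F j.

Lemma truncE F N w :
  trunc F N w = \sum_(0 <= k < N.+1) (cexp w) ^- k *: with_id F k.
Proof.
rewrite /trunc [RHS]big_ltn // expr0 invr1 scale1r /=; congr (_ + _).
by apply: eq_big_nat => -[|k].
Qed.

Definition dtrunc (F : nat -> 'M[C]_n) (N : nat) (w : C) : 'M[C]_n :=
  - \sum_(0 <= k < N.+1) (k%:R * (cexp w) ^- k) *: with_id F k.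

Lemma cexpVn (w : C) k : (cexp w) ^- k = cexp (- (k%:R * w)).
Proof. by rewrite cexpN cexpXn. Qed.

Lemma cn_cexpVn (w : C) k : cn ((cexp w) ^- k) = expR (- k%:R * complex.Re w).
Proof.
rewrite cexpVn cn_cexp ReN ReM; congr expR.
have -> : complex.Re (k%:R : C) = k%:R.
  by have -> : (k%:R : C) = (k%:R : R)%:C by rewrite rmorph_nat.
have -> : complex.Im (k%:R : C) = 0.
  by have -> : (k%:R : C) = (k%:R : R)%:C by rewrite rmorph_nat.
by rewrite mul0r subr0 mulNr.
Qed.

Lemma mder_sum p q (I : Type) (r : seq I) (f D : I -> C -> 'M[C]_(p, q)) w :
  (forall i, mder (f i) w (D i w)) ->
  mder (fun w => \sum_(i <- r) f i w) w (\sum_(i <- r) D i w).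
Proof.
move=> H; elim: r => [|i r IH].
  under eq_fun do rewrite big_nil.
  by rewrite big_nil; exact: mder_cst.
under eq_fun do rewrite big_cons.
by rewrite big_cons; exact: mderD.
Qed.

Lemma mderZ p q (f : C -> C) (df : C) (M : 'M[C]_(p, q)) (w : C) : is_derive w 1 f df ->
  mder (fun w => f w *: M) w (df *: M).
Proof.
move=> h i j; rewrite mxE; under eq_fun do rewrite mxE.
have := is_deriveM h (is_derive_cst (M i j) w 1).
by move/is_derive_eq; apply; rewrite scaler0 add0r /GRing.scale /= mulrC.
Qed.

Lemma mder_trunc F N w : mder (trunc F N) w (dtrunc F N w).
Proof.
have -> : trunc F N = (fun w => \sum_(0 <= k < N.+1) (cexp w) ^- k *: with_id F k).
  by apply/funext => z; exact: truncE.
rewrite /dtrunc -sumrN.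
apply: (@mder_sum n n nat _ (fun k w => (cexp w) ^- k *: with_id F k)
  (fun k w => - ((k%:R * (cexp w) ^- k) *: with_id F k))) => k.
rewrite -scaleNr; apply: mderZ.
under eq_fun do rewrite cexpVn.
have h : is_derive w 1 (fun w : C => - (k%:R * w)) (- k%:R).
  have := is_deriveN (is_deriveM (is_derive_cst (k%:R : C) w 1) (is_derive_id w 1)).
  by move/is_derive_eq; apply; rewrite scaler0 addr0 /GRing.scale /= mulr1.
have := is_derive_compC (is_derive_cexp _) h.
by move/is_derive_eq; apply; rewrite cexpVn mulrN mulrC.
Qed.

(** The recursion at order m couples the m-th coefficient with the (m-1)-st term H of the derivative
    part. Multiplication by z aligns the two, and everything cancels except the products of total
    degree above N and the term [H N], whose partner lies beyond the truncation. *)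
Lemma formal_remainder (Ah F : nat -> 'M[C]_n) (u b : 'rV[C]_n) N (w : C) :
  (forall m, (m <= N)%N ->
    (if m is k.+1 then with_id F k *m diag_mx b - k%:R *: with_id F k else 0)
      + with_id F m *m diag_mx u
    = \sum_(j < m.+1) Ah j *m with_id F (m - j)%N) ->
  cexp w *: ((\sum_(0 <= j < N.+1) (cexp w) ^- j *: Ah j) *m trunc F N w)
    - trunc F N w *m diag_mx (cexp w *: u + b) - dtrunc F N w =
  cexp w *: (\sum_(0 <= j < N.+1) \sum_(N.+1 - j <= k < N.+1)
      (cexp w) ^- (j + k) *: (Ah j *m with_id F k))
    - (cexp w) ^- N *: (with_id F N *m diag_mx b - N%:R *: with_id F N).
Proof.
move=> formal; set E := cexp w; have E0 : E != 0 by exact: cexp_neq0.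
have EV m : E * E ^- m.+1 = E ^- m.
  by rewrite exprS invfM mulrA divff // mul1r.
pose P := with_id F; pose H k := P k *m diag_mx b - k%:R *: P k.
have prod : (\sum_(0 <= j < N.+1) E ^- j *: Ah j) *m trunc F N w =
   \sum_(0 <= m < N.+1) E ^- m *: (\sum_(0 <= j < m.+1) Ah j *m P (m - j)%N) +
   \sum_(0 <= j < N.+1) \sum_(N.+1 - j <= k < N.+1) E ^- (j + k) *: (Ah j *m P k).
  have -> : \sum_(0 <= m < N.+1) E ^- m *: (\sum_(0 <= j < m.+1) Ah j *m P (m - j)%N) =
    \sum_(0 <= m < N.+1) \sum_(0 <= j < m.+1) E ^- (j + (m - j)) *: (Ah j *m P (m - j)%N).
    apply: eq_big_nat => m _; rewrite scaler_sumr; apply: eq_big_nat => j /andP[_ jm].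
    by rewrite subnKC.
  rewrite (triangular_sum (fun j k => E ^- (j + k) *: (Ah j *m P k))).
  rewrite -big_split /= truncE mulmx_suml; apply: eq_big_nat => j /andP[_ jN].
  rewrite mulmx_sumr -big_cat_nat ?leq_subr //=; apply: eq_big_nat => k _.
  by rewrite -scalemxAl -scalemxAr scalerA exprD invfM.
have low : E *: \sum_(0 <= m < N.+1) E ^- m *: (\sum_(0 <= j < m.+1) Ah j *m P (m - j)%N) =
   \sum_(0 <= k < N) E ^- k *: H k + E *: (trunc F N w *m diag_mx u).
  have -> : \sum_(0 <= m < N.+1) E ^- m *: (\sum_(0 <= j < m.+1) Ah j *m P (m - j)%N) =
    \sum_(0 <= m < N.+1) (E ^- m *: (if m is k.+1 then H k else 0) + E ^- m *: (P m *m diag_mx u)).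
    apply: eq_big_nat => m /andP[_ mN]; rewrite -scalerDr big_mkord; congr (_ *: _).
    by rewrite -formal.
  rewrite big_split /= scalerDr; congr (_ + _).
    rewrite big_ltn // scaler0 add0r big_add1 /= scaler_sumr.
    by apply: eq_big_nat => k _; rewrite scalerA EV.
  congr (_ *: _); rewrite truncE mulmx_suml; apply: eq_big_nat => k _.
  by rewrite scalemxAl.
have tb : trunc F N w *m diag_mx b + dtrunc F N w = \sum_(0 <= k < N.+1) E ^- k *: H k.
  rewrite truncE mulmx_suml /dtrunc -sumrN -big_split /=; apply: eq_big_nat => k _.
  by rewrite /H scalerBr scalemxAl scalerA mulrC.
have -> : diag_mx (E *: u + b) = E *: diag_mx u + diag_mx b.
  by rewrite linearD linearZ.
rewrite prod scalerDr low mulmxDr -scalemxAr.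
move: tb; rewrite big_nat_recr //=.
set Q := E *: \sum_(0 <= j < N.+1) _; set T := E *: (trunc F N w *m diag_mx u).
set Bt := trunc F N w *m diag_mx b; set D := dtrunc F N w.
set U := \sum_(0 <= k < N) _; set V := E ^- N *: H N => tb.
have -> : Q - V = Q - (U + V) + U by rewrite opprD addrA addrAC subrK.
rewrite -tb; clear tb; move: Q T Bt D U => Q T Bt D U.
by apply/matrixP => i j; rewrite !mxE; ring.
Qed.

End Reduction.

(** * The reduced system and its remainder *)

Section ReducedSystemOf.
Variables (R : realType) (n : nat).
Local Notation C := (cplx R).

Lemma expR_le1 (x : R) : x <= 0 -> expR x <= 1.
Proof. by move=> x0; rewrite -[leRHS]expR0 ler_expR. Qed.

Lemma sum_nat_le (a b : nat) (f : nat -> R) (c : R) : (forall k, (a <= k < b)%N -> f k <= c) ->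
  \sum_(a <= k < b) f k <= (b - a)%:R * c.
Proof.
move=> H; apply: le_trans (_ : \sum_(a <= k < b) c <= _); last first.
  by rewrite sumr_const_nat mulr_natl.
by rewrite big_nat_cond [leRHS]big_nat_cond; apply: ler_sum => k /andP[/H].
Qed.

Lemma sum_nat0_le (b : nat) (f : nat -> R) (c : R) : (forall k, (k < b)%N -> f k <= c) ->
  \sum_(0 <= k < b) f k <= b%:R * c.
Proof. by move=> H; rewrite -[b in leRHS]subn0; apply: sum_nat_le. Qed.

Lemma trunc_near1 (F : nat -> 'M[C]_n) (N : nat) (KF : R) (w : C) : 0 <= complex.Re w ->
  (forall k, (k <= N)%N -> nm (with_id F k) <= KF) ->
  nm (trunc F N w - 1%:M) <= N%:R * KF * expR (- complex.Re w).
Proof.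
move=> w0 HF; rewrite /trunc addrC addKr.
apply: le_trans (nm_sum _ _ _) _.
apply: le_trans (sum_nat_le (c := KF * expR (- complex.Re w)) _) _; last first.
  by rewrite subSS subn0 mulrA.
move=> [//|k] /andP[_ kN]; rewrite nmZ cn_cexpVn mulrC.
apply: ler_pM; rewrite ?nm_ge0 ?expR_ge0 //; first exact: (HF k.+1).
rewrite ler_expR mulNr lerN2 ler_peMl // -[leLHS](_ : 1%:R = _) // ler_nat //.
Qed.

(** The three groups in the constant belong to the tail of the series of the system, to the products
    of total degree above N, and to the last uncancelled term. In the first two, the factor e^w
    turns order N + 1 into order N. *)
Lemma remainder_estimate (Aw : C -> 'M[C]_n) (Ah F : nat -> 'M[C]_n) (u b : 'rV[C]_n)
  (N : nat) (KA Kr KF Kb : R) (w : C) :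
  0 <= KA -> 0 <= Kr -> 0 <= KF -> 0 <= Kb -> 0 <= complex.Re w ->
  (forall j, (j <= N)%N -> nm (Ah j) <= KA) ->
  (forall k, (k <= N)%N -> nm (with_id F k) <= KF) -> nm b <= Kb ->
  nm (Aw w - \sum_(0 <= j < N.+1) (cexp w) ^- j *: Ah j) <=
     Kr * expR (- N.+1%:R * complex.Re w) ->
  (forall m, (m <= N)%N ->
    (if m is k.+1 then with_id F k *m diag_mx b - k%:R *: with_id F k else 0)
      + with_id F m *m diag_mx u
    = \sum_(j < m.+1) Ah j *m with_id F (m - j)%N) ->
  nm (cexp w *: (Aw w *m trunc F N w) - trunc F N w *m diag_mx (cexp w *: u + b)
      - dtrunc F N w) <=
  (Kr * (N.+1%:R * KF) + (N.+1%:R * (N.+1%:R * (KA * KF))) + (KF * Kb + N%:R * KF))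
    * expR (- N%:R * complex.Re w).
Proof.
move=> KA0 Kr0 KF0 Kb0 w0 HA HF Hb Hr formal.
set x := complex.Re w in w0 Hr *.
set T := trunc F N w; set S := \sum_(0 <= j < N.+1) (cexp w) ^- j *: Ah j in Hr.
have -> : cexp w *: (Aw w *m T) - T *m diag_mx (cexp w *: u + b) - dtrunc F N w =
  cexp w *: ((Aw w - S) *m T) +
  (cexp w *: (S *m T) - T *m diag_mx (cexp w *: u + b) - dtrunc F N w).
  rewrite mulmxBl scalerBr.
  move: (cexp w *: (Aw w *m T)) (cexp w *: (S *m T)) (T *m diag_mx _) (dtrunc F N w) => a1 a2 a3 a4.
  by apply/matrixP => i j; rewrite !mxE; ring.
rewrite (formal_remainder w formal).
have eN : expR x * expR (- N.+1%:R * x) = expR (- N%:R * x).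
  by rewrite -expRD; congr expR; rewrite -natr1; ring.
have nT : nm T <= N.+1%:R * KF.
  rewrite /T truncE; apply: le_trans (nm_sum _ _ _) _.
  apply: sum_nat0_le => k kN.
  rewrite nmZ cn_cexpVn; apply: le_trans (HF k kN).
  by rewrite ler_piMl ?nm_ge0 // expR_le1 // mulNr oppr_le0 mulr_ge0.
have b1 : nm (cexp w *: ((Aw w - S) *m T)) <= Kr * (N.+1%:R * KF) * expR (- N%:R * x).
  rewrite nmZ cn_cexp -/x -eN; apply: le_trans (ler_wpM2l (expR_ge0 _) (nmM _ _)) _.
  apply: le_trans (_ : expR x * (Kr * expR (- N.+1%:R * x) * (N.+1%:R * KF)) <= _).
    by apply: ler_wpM2l; [exact: expR_ge0 | apply: ler_pM; rewrite ?nm_ge0].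
  by rewrite le_eqVlt; apply/orP; left; apply/eqP; ring.
have b2 : nm (cexp w *: (\sum_(0 <= j < N.+1) \sum_(N.+1 - j <= k < N.+1)
      (cexp w) ^- (j + k) *: (Ah j *m with_id F k))) <=
      N.+1%:R * (N.+1%:R * (KA * KF)) * expR (- N%:R * x).
  rewrite nmZ cn_cexp -/x.
  apply: le_trans (_ : expR x * (N.+1%:R * (N.+1%:R * (KA * KF * expR (- N.+1%:R * x)))) <= _).
    apply: ler_wpM2l; first exact: expR_ge0.
    apply: le_trans (nm_sum _ _ _) _;
    apply: sum_nat0_le => j jN.
    apply: le_trans (nm_sum _ _ _) _.
    have c0 : 0 <= KA * KF * expR (- N.+1%:R * x) by rewrite !mulr_ge0 ?expR_ge0.
    apply: le_trans (sum_nat_le (c := KA * KF * expR (- N.+1%:R * x)) _) _; last first.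
      by apply: ler_wpM2r => //; rewrite ler_nat leq_subr.
    move=> k /andP[k1 k2]; rewrite nmZ cn_cexpVn -/x mulrC.
    apply: ler_pM; rewrite ?nm_ge0 ?expR_ge0 //.
      apply: le_trans (nmM _ _) _; apply: ler_pM; rewrite ?nm_ge0 //; first exact: HA.
      exact: HF.
    rewrite ler_expR !mulNr lerN2 ler_wpM2r // ler_nat.
    by rewrite -leq_subLR.
  rewrite le_eqVlt; apply/orP; left; apply/eqP; rewrite -eN; ring.
have b3 : nm ((cexp w) ^- N *: (with_id F N *m diag_mx b - N%:R *: with_id F N)) <=
    (KF * Kb + N%:R * KF) * expR (- N%:R * x).
  rewrite nmZ cn_cexpVn -/x mulrC ler_wpM2r ?expR_ge0 //.
  apply: le_trans (nmB _ _) _; rewrite nmZ cn_nat; apply: lerD.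
    apply: le_trans (nmM _ _) _; apply: ler_pM; rewrite ?nm_ge0 //; first exact: HF.
    by apply: le_trans (nm_diag _) _.
  by apply: ler_wpM2l => //; exact: HF.
apply: le_trans (nmD _ _) _; rewrite [in leRHS]mulrDl [in leRHS]mulrDl -addrA.
by apply: lerD => //; apply: le_trans (nmB _ _) _; apply: lerD.
Qed.

(** This is the product rule for T^(-1) X with X = T y and T' = E A T - T D - rho: the terms in A
    cancel. *)
Lemma reduced_algebra (E : C) (Q T A D rho y : 'M[C]_n) : Q *m T = 1%:M ->
  - (Q *m (E *: (A *m T) - T *m D - rho) *m Q) *m (T *m y)
    + Q *m (E *: (A *m (T *m y)) - T *m y *m D) =
  D *m y - y *m D + Q *m rho *m y.
Proof.
move=> QT.
have h1 : Q *m (T *m y) = y by rewrite mulmxA QT mul1mx.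
have h2 : Q *m (T *m y *m D) = y *m D by rewrite mulmxA h1.
have h3 : (E *: (A *m T) - T *m D - rho) *m y = E *: (A *m (T *m y)) - T *m (D *m y) - rho *m y.
  by rewrite 2!mulmxBl -scalemxAl -!mulmxA.
have h4 : Q *m (T *m (D *m y)) = D *m y by rewrite mulmxA QT mul1mx.
rewrite mulNmx -[_ *m Q *m _]mulmxA h1 -[_ *m _ *m y]mulmxA h3 !mulmxBr h4 h2.
rewrite [Q *m (rho *m y)]mulmxA.
move: (Q *m (E *: _)) (D *m y) (Q *m rho *m y) (y *m D) => a1 a2 a3 a4.
by apply/matrixP => i j; rewrite !mxE; ring.
Qed.

Definition reduced (F : nat -> 'M[C]_n) (N : nat) (X : C -> 'M[C]_n) (w : C) : 'M[C]_n :=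
  invmx (trunc F N w) *m X w.

(** [x0] and [K] depend only on bounds for the data, so that one choice serves a neighbourhood of t
    = 0. *)
Lemma reduced_system (N : nat) (KA Kr KF Kb X0 : R) :
  0 <= KA -> 0 <= Kr -> 0 <= KF -> 0 <= Kb ->
  exists x0 K : R, [/\ 0 <= K, X0 <= x0, 0 <= x0 &
    forall (Aw : C -> 'M[C]_n) (Ah F : nat -> 'M[C]_n) (u b : 'rV[C]_n) (X : C -> 'M[C]_n),
    (forall j, (j <= N)%N -> nm (Ah j) <= KA) ->
    (forall k, (k <= N)%N -> nm (with_id F k) <= KF) -> nm b <= Kb ->
    (forall w : C, X0 <= complex.Re w ->
      nm (Aw w - \sum_(0 <= j < N.+1) (cexp w) ^- j *: Ah j) <=
        Kr * expR (- N.+1%:R * complex.Re w)) ->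
    (forall m, (m <= N)%N ->
      (if m is k.+1 then with_id F k *m diag_mx b - k%:R *: with_id F k else 0)
        + with_id F m *m diag_mx u
      = \sum_(j < m.+1) Ah j *m with_id F (m - j)%N) ->
    (forall w : C, X0 <= complex.Re w ->
      mder X w (cexp w *: (Aw w *m X w) - X w *m diag_mx (cexp w *: u + b))) ->
    (forall w : C, x0 <= complex.Re w -> nm (trunc F N w - 1%:M) <= 1 / 2) /\
    exists2 Rm : C -> 'M[C]_n, reduced_ode u b x0 (reduced F N X) Rm &
      remainder_bound x0 K N (reduced F N X) Rm].
Proof.
move=> KA0 Kr0 KF0 Kb0.
pose K1 := Kr * (N.+1%:R * KF) + (N.+1%:R * (N.+1%:R * (KA * KF))) + (KF * Kb + N%:R * KF).
have K10 : 0 <= K1 by rewrite /K1 !(addr_ge0, mulr_ge0).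
have D0 : 0 < 2 * (N%:R * KF) + 1 by rewrite ltr_wpDl // !mulr_ge0.
have ln0 : 0 <= ln (2 * (N%:R * KF) + 1) by rewrite ln_ge0 // lerDr !mulr_ge0.
pose xa := Num.max 0 X0 + ln (2 * (N%:R * KF) + 1).
have xa0 : 0 <= xa by rewrite addr_ge0 // le_max lexx.
have xaX : X0 <= xa by apply: le_trans (_ : Num.max 0 X0 <= _); rewrite ?le_max ?lexx ?orbT // lerDl.
(* The extra 1 leaves, around each point considered, a disc of radius 1 in which the truncation is
   still close to 1, as differentiating its inverse requires. *)
exists (xa + 1), (2 * n%:R * K1); split.
- by rewrite !mulr_ge0.
- by apply: le_trans xaX _; rewrite lerDl.
- by rewrite addr_ge0.
move=> Aw Ah F u b X HA HF Hb Hr formal HX.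
have near w : xa <= complex.Re w -> nm (trunc F N w - 1%:M) <= 1 / 2.
  move=> wx; apply: le_trans (trunc_near1 (le_trans xa0 wx) HF) _.
  apply: le_trans (_ : N%:R * KF * expR (- ln (2 * (N%:R * KF) + 1)) <= _).
    rewrite ler_wpM2l ?mulr_ge0 // ler_expR lerN2; apply: le_trans wx.
    by rewrite /xa lerDr le_max lexx.
  rewrite expRN lnK ?posrE // ler_pdivrMr //; move: (N%:R * KF) => z; lra.
split; first by move=> w wx; apply: near; apply: le_trans wx; rewrite lerDl.
pose rho w := cexp w *: (Aw w *m trunc F N w) - trunc F N w *m diag_mx (cexp w *: u + b)
      - dtrunc F N w.
exists (fun w => invmx (trunc F N w) *m rho w *m reduced F N X w).
- move=> w wx.
  have wxa : xa <= complex.Re w by apply: le_trans wx; rewrite lerDl.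
  have [U _] := unit_near1 (near w wxa).
  have hi : mder (fun w => invmx (trunc F N w)) w
     (- (invmx (trunc F N w) *m dtrunc F N w *m invmx (trunc F N w))).
    apply: (@mder_inv R n (trunc F N) w (dtrunc F N w) 1 (2 * n%:R) ltr01 _ (mder_trunc F N w)).
    move=> h h1; apply: unit_near1; apply: near.
    have := Re_le_cn h; rewrite ReD ler_norml => /andP[r1 _].
    by move: wx; lra.
  have := mderM hi (HX w (le_trans xaX wxa)); move/mder_eq; apply.
  have E : dtrunc F N w = cexp w *: (Aw w *m trunc F N w) - trunc F N w *m diag_mx (cexp w *: u + b) - rho w.
    by rewrite /rho opprB [RHS]addrC subrK.
  have XE : X w = trunc F N w *m reduced F N X w by rewrite /reduced mulKVmx.
  rewrite {1}E {1 2 3}XE; apply: reduced_algebra; exact: mulVmx.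
move=> w wx.
have wxa : xa <= complex.Re w by apply: le_trans wx; rewrite lerDl.
have [_ U] := unit_near1 (near w wxa).
apply: le_trans (nmM _ _) _; apply: ler_wpM2r; first exact: nm_ge0.
apply: le_trans (nmM _ _) _; rewrite -mulrA; apply: ler_pM; rewrite ?nm_ge0 //.
apply: (@remainder_estimate Aw Ah F u b N KA Kr KF Kb w) => //.
  exact: le_trans wxa.
by apply: Hr; exact: le_trans wxa.
Qed.

End ReducedSystemOf.

Section StripDerivative.
Variables (R : realType) (n : nat).
Local Notation C := (cplx R).

Lemma mder_expz (u : 'rV[C]_n) (w : C) :
  mder (expz u) w (expz u w *m diag_mx (cexp w *: u)).
Proof.
have h : mder (fun w => \row_a cexp (u 0 a * cexp w)) w
   (\row_a (cexp (u 0 a * cexp w) * (cexp w * u 0 a))).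
  move=> i j; rewrite mxE; under eq_fun do rewrite mxE.
  have h1 : is_derive w 1 (fun w => u 0 j * cexp w) (u 0 j * cexp w).
    have := is_deriveM (is_derive_cst (u 0 j) w 1) (is_derive_cexp w).
    by move/is_derive_eq; apply; rewrite scaler0 addr0.
  have := is_derive_compC (is_derive_cexp _) h1.
  by move/is_derive_eq; apply; rewrite [cexp w * _]mulrC.
apply: mder_eq (mder_diag h) _; rewrite /expz mulmx_diag; congr diag_mx.
by apply/rowP => j; rewrite !mxE.
Qed.

Lemma mder_zpow (b : 'rV[C]_n) (w : C) : mder (zpow b) w (zpow b w *m diag_mx b).
Proof.
have h : mder (fun w => \row_a cexp (b 0 a * w)) w
   (\row_a (cexp (b 0 a * w) * b 0 a)).
  move=> i j; rewrite mxE; under eq_fun do rewrite mxE.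
  have h1 : is_derive w 1 (fun w => b 0 j * w) (b 0 j).
    have := is_deriveM (is_derive_cst (b 0 j) w 1) (is_derive_id w 1).
    by move/is_derive_eq; apply; rewrite scaler0 addr0 /GRing.scale /= mulr1.
  exact: (is_derive_compC (is_derive_cexp _) h1).
apply: mder_eq (mder_diag h) _; rewrite /zpow mulmx_diag; congr diag_mx.
by apply/rowP => j; rewrite !mxE.
Qed.

Lemma mder_strip (G A : 'M[C]_n) (u b : 'rV[C]_n) (Y : C -> 'M[C]_n) (w : C) :
  G \in unitmx -> mder Y w (cexp w *: (A *m Y w)) ->
  mder (fun w => invmx G *m strip u b Y w) w
    (cexp w *: (hatA G A *m (invmx G *m strip u b Y w))
      - (invmx G *m strip u b Y w) *m diag_mx (cexp w *: u + b)).
Proof.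
move=> U HY.
have h := mderM (mder_cst (invmx G) w) (mderM (mderM HY (mder_expz (- u) w)) (mder_zpow (- b) w)).
apply: mder_eq h _; rewrite mul0mx add0r.
have comm (v v' : 'rV[C]_n) : diag_mx v *m diag_mx v' = diag_mx v' *m diag_mx v.
  by rewrite !mulmx_diag; congr diag_mx; apply/rowP => j; rewrite !mxE mulrC.
have -> : hatA G A *m (invmx G *m strip u b Y w) = invmx G *m (A *m Y w *m expz (- u) w *m zpow (- b) w).
  by rewrite /hatA /strip -!mulmxA mulKVmx // !mulmxA.
have -> : diag_mx (cexp w *: u + b) = diag_mx (cexp w *: u) + diag_mx b by rewrite linearD.
have -> : diag_mx (cexp w *: - u) = - diag_mx (cexp w *: u) by rewrite scalerN linearN.
have -> : diag_mx (- b) = - diag_mx b by rewrite linearN.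
have := comm (cexp w *: u) (\row_a cexp ((- b) 0 a * w)); rewrite -/(zpow (- b) w) /strip.
move: (diag_mx (cexp w *: u)) (diag_mx b) (expz (- u) w) (zpow (- b) w) (A *m Y w) => Du Db Ez Zp AY c.
move: (invmx G) (Y w) (cexp w) => Gi Yw e {HY comm}.
rewrite !mulmxDl !mulmxDr !mulmxN !mulNmx opprD addrA -!scalemxAl -!scalemxAr !mulmxA.
by rewrite mulmxN -!mulmxA c.
Qed.

Lemma asymptotic_trunc (D : set C) (F : nat -> 'M[C]_n) (X : C -> 'M[C]_n) (al be : R) :
  asymptotic_in D F X -> (forall w : C, al <= carg w <= be -> D w) ->
  forall N : nat, exists K r : R, 0 <= K /\ forall w : C, al <= complex.Im w <= be ->
    r <= complex.Re w -> nm (X w - trunc F N w) <= K * expR (- N.+1%:R * complex.Re w).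
Proof.
move=> H HD N; have [K [r [r0 HK]]] := H al be HD N.
exists ((n * n)%:R * `|K|), (ln r); split; first by rewrite mulr_ge0.
move=> w wI wr.
have wo : outside r (cexp w) by rewrite outsideE -[r]lnK // ler_expR.
have := HK w wI wo; rewrite -normrX -normfV normE cn_cexpVn -rmorphM /= => /nm_le_norm h.
apply: le_trans h _; rewrite -mulrA ler_wpM2l // ler_wpM2r ?expR_ge0 //.
exact: ler_norm.
Qed.

Lemma asymptotic_of_trunc (D : set C) (F : nat -> 'M[C]_n) (X : C -> 'M[C]_n) :
  (forall al be : R, (forall w : C, al <= carg w <= be -> D w) -> forall N : nat,
    exists K r : R, forall w : C, al <= complex.Im w <= be ->
      r <= complex.Re w -> nm (X w - trunc F N w) <= K * expR (- N.+1%:R * complex.Re w)) ->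
  asymptotic_in D F X.
Proof.
move=> H al be HD N; have [K [r HK]] := H al be HD N.
exists K, (expR r); split; first exact: expR_gt0.
move=> w wI; rewrite outsideE ler_expR => wr.
rewrite -normrX -normfV normE cn_cexpVn -rmorphM /=.
by apply: le_trans (norm_le_nm _) _; rewrite lecR; exact: HK.
Qed.

Lemma reduced_sub1 (F : nat -> 'M[C]_n) (N : nat) (X : C -> 'M[C]_n) (w : C) :
  nm (trunc F N w - 1%:M) <= 1 / 2 ->
  nm (reduced F N X w - 1%:M) <= 2 * n%:R * nm (X w - trunc F N w) /\
  nm (X w - trunc F N w) <= (n%:R + 1 / 2) * nm (reduced F N X w - 1%:M).
Proof.
move=> h; have [U hU] := unit_near1 h; split.
  have -> : reduced F N X w - 1%:M = invmx (trunc F N w) *m (X w - trunc F N w).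
    by rewrite mulmxBr mulVmx.
  by apply: le_trans (nmM _ _) _; rewrite ler_wpM2r ?nm_ge0.
have -> : X w - trunc F N w = trunc F N w *m (reduced F N X w - 1%:M).
  by rewrite mulmxBr mulmx1 /reduced mulKVmx.
apply: le_trans (nmM _ _) _; rewrite ler_wpM2r ?nm_ge0 //.
rewrite -(subrK 1%:M (trunc F N w)) addrC; apply: le_trans (nmD _ _) _.
by rewrite nm1 lerD2l.
Qed.

Lemma trunc_diff (F : nat -> 'M[C]_n) (N N' : nat) (KF : R) (w : C) : (N <= N')%N ->
  0 <= complex.Re w ->
  (forall k, (k <= N')%N -> nm (with_id F k) <= KF) ->
  nm (trunc F N' w - trunc F N w) <= N'%:R * KF * expR (- N.+1%:R * complex.Re w).
Proof.
move=> NN w0 HF; have -> : trunc F N' w - trunc F N w = \sum_(N.+1 <= j < N'.+1) (cexp w) ^- j *: F j.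
  rewrite /trunc opprD addrACA subrr add0r (@big_cat_nat _ _ _ N.+1 1 N'.+1) //=.
  by rewrite addrAC subrr add0r.
have K0 : 0 <= KF by apply: le_trans (HF 0%N _); rewrite ?nm_ge0.
apply: le_trans (nm_sum _ _ _) _.
apply: le_trans (sum_nat_le (c := KF * expR (- N.+1%:R * complex.Re w)) _) _; last first.
  by rewrite mulrA ler_wpM2r ?expR_ge0 // ler_wpM2r // ler_nat subSS leq_subr.
move=> [//|k] /andP[k1 k2]; rewrite nmZ cn_cexpVn mulrC.
apply: ler_pM; rewrite ?nm_ge0 ?expR_ge0 //; first exact: (HF k.+1).
by rewrite ler_expR !mulNr lerN2 ler_wpM2r // ler_nat.
Qed.

End StripDerivative.

(** * Cauchy estimates for series in 1/z *)

Section CauchyEstimates.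
Variables (R : realType).
Local Notation C := (cplx R).

Definition tendsto (s : nat -> C) (l : C) :=
  forall e : R, 0 < e -> exists m0, forall m, (m0 <= m)%N -> cn (s m - l) <= e.

Lemma geo_tail (q : R) (J m : nat) : 0 <= q -> q < 1 ->
  \sum_(J <= i < m) q ^+ i <= q ^+ J / (1 - q).
Proof.
move=> q0 q1; have d0 : 0 < 1 - q by rewrite subr_gt0.
have [mJ|Jm] := leqP m J.
  by rewrite big_geq // divr_ge0 ?exprn_ge0 // ltW.
rewrite ler_pdivlMr //; have -> : (\sum_(J <= i < m) q ^+ i) * (1 - q) = q ^+ J - q ^+ m.
  elim: m Jm => [//|m IH]; rewrite ltnS leq_eqVlt => /orP[/eqP <-|Jm].
    by rewrite big_nat1 exprSr; ring.
  by rewrite big_nat_recr ?(ltnW Jm) //= mulrDl IH // exprSr; ring.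
by rewrite lerBlDr lerDl exprn_ge0.
Qed.

Definition inv_partial (a : nat -> C) (z : C) (m : nat) : C := \sum_(0 <= i < m) z ^- i * a i.

Lemma series_tail (a : nat -> C) (z l : C) (Bd s : R) (J : nat) :
  0 <= Bd -> 0 <= s -> s < cn z -> (forall i, cn (a i) <= Bd * s ^+ i) ->
  tendsto (inv_partial a z) l ->
  cn (l - inv_partial a z J) <= Bd * ((s / cn z) ^+ J / (1 - s / cn z)).
Proof.
move=> B0 s0 sz Ha Hl.
have z0 : 0 < cn z by exact: le_lt_trans sz.
have q0 : 0 <= s / cn z by rewrite divr_ge0 // ltW.
have q1 : s / cn z < 1 by rewrite ltr_pdivrMr // mul1r.
apply/ler_addgt0Pr => e e0; have [m0 Hm] := Hl e e0.
pose m := maxn m0 J.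
have -> : l - inv_partial a z J = - (inv_partial a z m - l) + (inv_partial a z m - inv_partial a z J) by ring.
apply: le_trans (cnD _ _) _; rewrite cnN addrC; apply: lerD; last by apply: Hm; exact: leq_maxl.
rewrite /inv_partial (@big_cat_nat _ _ _ J 0 m) ?leq_maxr //= addrAC subrr add0r.
apply: le_trans (cn_sum _ _ _) _.
apply: le_trans (_ : Bd * \sum_(J <= i < m) (s / cn z) ^+ i <= _).
  rewrite mulr_sumr; apply: ler_sum => i _; rewrite cnM cnV cnX mulrC.
  apply: le_trans (ler_wpM2r _ (Ha i)) _; first by rewrite invr_ge0 exprn_ge0 ?cn_ge0.
  by rewrite exprMn exprVn mulrA.
by rewrite ler_wpM2l // geo_tail.
Qed.

Definition root1 (m : nat) : C := cis (2 * pi / m%:R).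

Lemma cisX (t : R) (k : nat) : (cis t : C) ^+ k = cis (k%:R * t).
Proof.
elim: k => [|k IH]; first by rewrite expr0 mul0r /cis cos0 sin0.
by rewrite exprS IH -cisD -natr1; congr cis; ring.
Qed.

Lemma cn_cis (t : R) : cn (cis t : C) = 1.
Proof. by apply/eqP; rewrite -sqrp_eq1 ?cn_ge0 // sqr_cn /= cos2Dsin2. Qed.

Lemma cis_neq1 (t : R) : 0 < t -> t < 2 * pi -> (cis t : C) != 1.
Proof.
move=> t0 tp; apply/eqP => -[c1 _].
have s0 : 0 < sin (t / 2) by apply: sin_gt0_pi; lra.
have : cos t = 1 - 2 * sin (t / 2) ^+ 2.
  have {1}-> : t = t / 2 + t / 2 by lra.
  by rewrite cosD -expr2 -expr2 cos2sin2; ring.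
rewrite c1; have := exprn_gt0 2 s0; lra.
Qed.

Lemma root1_pow (m : nat) : (0 < m)%N -> root1 m ^+ m = 1.
Proof.
move=> m0; rewrite cisX mulrC divfK ?pnatr_eq0 ?gtn_eqF //.
by rewrite mulrDl mul1r /cis -mulr2n cos2pi sin2pi.
Qed.

Lemma root1_neq1 (m d : nat) : (0 < d < m)%N -> root1 m ^+ d != 1.
Proof.
move=> /andP[d0 dm]; have pip := pi_gt0 R; have m0 : 0 < m%:R :> R by rewrite ltr0n (ltn_trans d0).
rewrite cisX; apply: cis_neq1; first by rewrite mulr_gt0 ?ltr0n // divr_gt0 // mulr_gt0.
by rewrite mulrA ltr_pdivrMr // mulrC ltr_pM2l ?mulr_gt0 // ltr_nat.
Qed.

Lemma root1_sum (m e : nat) : (0 < m)%N -> (0 < e < m + m)%N ->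
  \sum_(k < m) (root1 m ^+ k) ^+ e = if e == m then m%:R else 0.
Proof.
move=> m0 /andP[e0 e2]; case: eqP => [->|/eqP em].
  rewrite (eq_bigr (fun=> 1)) ?sumr_const ?card_ord // => k _.
  by rewrite -exprM mulnC exprM root1_pow // expr1n.
have ne1 : root1 m ^+ e != 1.
  have [lt|ge] := ltnP e m; first by apply: root1_neq1; rewrite e0.
  rewrite -(subnK ge) exprD root1_pow // mulr1; apply: root1_neq1.
  by rewrite subn_gt0 ltn_neqAle eq_sym em ge ltn_subLR.
have : (root1 m ^+ e - 1) * \sum_(k < m) (root1 m ^+ e) ^+ k = 0.
  by rewrite -subrX1 -exprM mulnC exprM root1_pow // expr1n subrr.
move/eqP; rewrite mulf_eq0 subr_eq0 (negPf ne1) /= => /eqP E.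
by rewrite -[RHS]E; apply: eq_bigr => k _; rewrite -!exprM mulnC.
Qed.

(** A discrete Cauchy formula: averaging a polynomial in 1/z of degree below J over J equidistant
    points of the circle isolates each coefficient exactly. *)
Lemma inv_partial_coeff (a : nat -> C) (rho : R) (J j : nat) (M : R) : 0 < rho -> (j < J)%N ->
  (forall th : R, 0 <= th <= 2 * pi -> cn (inv_partial a (rho%:C * cis th) J) <= M) ->
  cn (a j) <= M * rho ^+ j.
Proof.
move=> rho0 jJ HM; have J0 : (0 < J)%N by exact: leq_ltn_trans jJ.
have pip := pi_gt0 R.
pose S : C := \sum_(k < J) (root1 J ^+ k) ^+ j * inv_partial a (rho%:C * root1 J ^+ k) J.
have rc0 : (rho%:C : C) != 0 by rewrite -cn_gt0 cn_real gtr0_norm.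
have SE : S = J%:R * (rho%:C ^- j * a j).
  rewrite /S /inv_partial.
  under eq_bigr => k _ do rewrite mulr_sumr.
  rewrite exchange_big /=.
  (* For a J-th root of unity, the power -i equals the power J - i. The exponent j + (J - i) lies
     strictly between 0 and 2 J, so its sum over the roots vanishes unless i = j. *)
  transitivity (\sum_(0 <= i < J) (rho%:C ^- i * a i) * \sum_(k < J) (root1 J ^+ k) ^+ (j + (J - i))).
    apply: eq_big_nat => i /andP[_ iJ]; rewrite mulr_sumr; apply: eq_bigr => k _.
    have o1 : (root1 J ^+ k) ^+ J = 1 by rewrite -exprM mulnC exprM root1_pow // expr1n.
    have on0 : root1 J ^+ k != 0.
      by apply: expf_neq0; rewrite -cn_gt0 cn_cis.
    have -> : (rho%:C * root1 J ^+ k) ^- i = rho%:C ^- i * (root1 J ^+ k) ^+ (J - i).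
      rewrite exprMn invfM; congr (_ * _).
      by rewrite expfB_cond ?(negPf on0) ?o1 ?mul1r //= ltnW.
    by rewrite exprD; ring.
  rewrite big_mkord (bigD1 (Ordinal jJ)) //= [X in _ + X]big1 => [|i ij].
    have e1 : (j + (J - j))%N = J by rewrite subnKC // ltnW.
    rewrite e1 addr0 root1_sum // ?eqxx; last by clear -J0; lia.
    by ring.
  have iJ := ltn_ord i.
  have ne : nat_of_ord i != j by apply: contra ij => /eqP e; apply/eqP; apply: val_inj.
  rewrite root1_sum //; last by clear -iJ jJ; lia.
  case: eqP => [h|_]; last by rewrite mulr0.
  by exfalso; move/eqP: ne; apply; clear -iJ jJ h; lia.
have SM : cn S <= J%:R * M.
  rewrite /S; apply: le_trans (cn_sum _ _ _) _.
  apply: le_trans (_ : \sum_(k < J) M <= _); last by rewrite sumr_const card_ord mulr_natl.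
  apply: ler_sum => k _; rewrite cnM !cnX cn_cis !expr1n mul1r cisX.
  apply: HM; apply/andP; split.
    by rewrite !mulr_ge0 ?invr_ge0 // ltW.
  by rewrite mulrA ler_pdivrMr ?ltr0n // mulrC ler_wpM2l ?mulr_ge0 ?(ltW pip) // ler_nat ltnW.
move: SM; rewrite SE !cnM cn_nat cnV cnX cn_real gtr0_norm // ler_pM2l ?ltr0n //.
by rewrite mulrC ler_pdivrMr ?exprn_gt0.
Qed.

(** Convergence at the radius [N0] bounds [a i] by a constant times N0^i. On the larger circle the
    partial sums therefore approach [f] at a geometric rate, uniformly in the angle, and the
    discrete formula applies with an error tending to 0. *)
Lemma cauchy_estimate (a : nat -> C) (f : C -> C) (N0 rho M : R) (j : nat) :
  0 < N0 -> N0 < rho ->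
  (forall z, N0 <= cn z -> tendsto (inv_partial a z) (f z)) ->
  (forall th : R, 0 <= th <= 2 * pi -> cn (f (rho%:C * cis th)) <= M) ->
  cn (a j) <= M * rho ^+ j.
Proof.
move=> N00 Nr Hf HM; have rho0 : 0 < rho by exact: lt_trans Nr.
have [Bd B0 HB] : exists2 Bd : R, 0 <= Bd & forall i, cn (a i) <= Bd * N0 ^+ i.
  have cN : cn N0%:C = N0 by rewrite cn_real gtr0_norm.
  have [|m0 Hm0] := Hf N0%:C _ 1 ltr01; first by rewrite cN.
  pose B1 := \sum_(0 <= i < m0) (cn (a i) / N0 ^+ i).
  have B10 : 0 <= B1 by apply: sumr_ge0 => i _; rewrite divr_ge0 ?cn_ge0 ?exprn_ge0 // ltW.
  (* From [m0] on, a term of the series is a difference of two partial sums within 1 of the limit;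
     [B1] covers the earlier terms. *)
  exists (2 + B1); first by rewrite addr_ge0.
  move=> i; rewrite -ler_pdivrMr ?exprn_gt0 //.
  have [im|mi] := ltnP i m0.
    apply: le_trans (_ : B1 <= _); last by rewrite lerDr.
    rewrite /B1 big_mkord (bigD1 (Ordinal im)) //= lerDl; apply: sumr_ge0 => k _.
    by rewrite divr_ge0 ?cn_ge0 ?exprn_ge0 // ltW.
  apply: le_trans (_ : 2 <= _); last by rewrite lerDl.
  have -> : cn (a i) / N0 ^+ i = cn ((inv_partial a N0%:C i.+1 - f N0%:C) - (inv_partial a N0%:C i - f N0%:C)).
    have -> : (inv_partial a N0%:C i.+1 - f N0%:C) - (inv_partial a N0%:C i - f N0%:C) = N0%:C ^- i * a i.
      by rewrite /inv_partial big_nat_recr //=; ring.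
    by rewrite cnM cnV cnX cN mulrC.
  apply: le_trans (cnB _ _) _; rewrite (_ : 2 = 1 + 1) //.
  by apply: lerD; apply: Hm0 => //; exact: leqW.
set q := N0 / rho.
have q0 : 0 <= q by rewrite divr_ge0 // ltW.
have q1 : q < 1 by rewrite ltr_pdivrMr // mul1r.
rewrite -ler_pdivrMr ?exprn_gt0 //; apply/ler_addgt0Pr => e e0.
have [J jJ HJ] : exists2 J, (j < J)%N & Bd * (q ^+ J / (1 - q)) <= e.
  have c0 : 0 < e * (1 - q) / (1 + Bd) by rewrite divr_gt0 ?ltr_pwDl // mulr_gt0 ?subr_gt0.
  have := @cvg_expr R q; rewrite ger0_norm // => /(_ q1) /cvgrPdist_le /(_ _ c0) [J0 _ HJ0].
  exists (maxn j.+1 J0); first exact: leq_maxl.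
  have /HJ0 : (J0 <= maxn j.+1 J0)%N by exact: leq_maxr.
  rewrite /= sub0r normrN ger0_norm ?exprn_ge0 // => h.
  rewrite mulrA ler_pdivrMr ?subr_gt0 //.
  apply: le_trans (_ : (1 + Bd) * q ^+ (maxn j.+1 J0) <= _).
    by rewrite ler_wpM2r ?exprn_ge0 // lerDr.
  by rewrite mulrC -ler_pdivlMr // ltr_pwDl.
rewrite ler_pdivrMr ?exprn_gt0 //.
apply: (@inv_partial_coeff a rho J) => // th hth.
have cz : cn (rho%:C * cis th) = rho by rewrite cnM cn_cis mulr1 cn_real gtr0_norm.
have t1 : cn (f (rho%:C * cis th) - inv_partial a (rho%:C * cis th) J) <= e.
  apply: le_trans HJ; have := @series_tail a (rho%:C * cis th) (f (rho%:C * cis th)) Bd N0 J B0 (ltW N00).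
  by rewrite cz; apply => //; apply: Hf; rewrite cz ltW.
rewrite -[inv_partial _ _ _](subKr (f (rho%:C * cis th))); apply: le_trans (cnB _ _) _.
by apply: lerD => //; exact: HM.
Qed.

End CauchyEstimates.

(** * Limits at the coalescence point *)

Section Tends.
Variables (R : realType) (T : Type) (F : set_system T).
Context {FF : Filter F}.
Local Notation C := (cplx R).

Lemma tends_cst p q (l : 'M[C]_(p, q)) : tends F (fun=> l) l.
Proof. by move=> e e0; apply: filterE => t /=; rewrite subrr nm0 ltW. Qed.

Lemma tends_ext p q (f g : T -> 'M[C]_(p, q)) l : F [set t | f t = g t] ->
  tends F f l -> tends F g l.
Proof. by move=> H hf e /hf; apply: filterS2 H => t /= <-. Qed.

Lemma tends_bounded p q (f : T -> 'M[C]_(p, q)) l : tends F f l ->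
  F [set t | nm (f t) <= nm l + 1].
Proof.
move=> /(_ 1 ltr01); apply: filterS => t /= h.
by rewrite -(subrK l (f t)) addrC; apply: le_trans (nmD _ _) _; rewrite lerD2l.
Qed.

Lemma tendsD p q (f g : T -> 'M[C]_(p, q)) l m : tends F f l -> tends F g m ->
  tends F (fun t => f t + g t) (l + m).
Proof.
move=> hf hg e e0; have e2 : 0 < e / 2 by rewrite divr_gt0.
apply: filterS2 (hf _ e2) (hg _ e2) => t /= h1 h2.
have -> : f t + g t - (l + m) = (f t - l) + (g t - m) by rewrite opprD addrACA.
by apply: le_trans (nmD _ _) _; rewrite (splitr e) lerD.
Qed.

Lemma tendsN p q (f : T -> 'M[C]_(p, q)) l : tends F f l -> tends F (fun t => - f t) (- l).
Proof.
move=> hf e /hf; apply: filterS => t /=; apply: le_trans.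
by rewrite -opprD nmN.
Qed.

Lemma tendsM p q r (f : T -> 'M[C]_(p, q)) (g : T -> 'M[C]_(q, r)) l m :
  tends F f l -> tends F g m -> tends F (fun t => f t *m g t) (l *m m).
Proof.
move=> hf hg e e0.
have D1 : 0 < nm m + 1 by rewrite ltr_wpDl ?nm_ge0.
have D2 : 0 < nm l + 1 by rewrite ltr_wpDl ?nm_ge0.
have e1 : 0 < e / 2 / (nm m + 1) by rewrite !divr_gt0.
have e2 : 0 < e / 2 / (nm l + 1) by rewrite !divr_gt0.
apply: filterS3 (hf _ e1) (hg _ e2) (tends_bounded hg) => t /= h1 h2 h3.
have -> : f t *m g t - l *m m = (f t - l) *m g t + l *m (g t - m).
  by rewrite mulmxBl mulmxBr addrA subrK.
apply: le_trans (nmD _ _) _; rewrite (splitr e); apply: lerD.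
  apply: le_trans (nmM _ _) _.
  by apply: le_trans (ler_pM (nm_ge0 _) (nm_ge0 _) h1 h3) _; rewrite divfK // lt0r_neq0.
apply: le_trans (nmM _ _) _.
apply: le_trans (_ : (nm l + 1) * (e / 2 / (nm l + 1)) <= _).
  by apply: ler_pM; rewrite ?nm_ge0 // lerDl.
by rewrite mulrC divfK // lt0r_neq0.
Qed.

Lemma tendsZ p q (a : C) (f : T -> 'M[C]_(p, q)) l : tends F f l ->
  tends F (fun t => a *: f t) (a *: l).
Proof.
move=> hf e e0; have D1 : 0 < cn a + 1 by rewrite ltr_wpDl ?cn_ge0.
have /hf : 0 < e / (cn a + 1) by rewrite divr_gt0.
apply: filterS => t /= h; rewrite -scalerBr nmZ.
apply: le_trans (_ : (cn a + 1) * (e / (cn a + 1)) <= _).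
  by apply: ler_pM; rewrite ?cn_ge0 ?nm_ge0 // lerDl.
by rewrite mulrC divfK // lt0r_neq0.
Qed.

Lemma tends_sum p q (I : Type) (r : seq I) (P : pred I) (f : I -> T -> 'M[C]_(p, q)) l :
  (forall i, P i -> tends F (f i) (l i)) ->
  tends F (fun t => \sum_(i <- r | P i) f i t) (\sum_(i <- r | P i) l i).
Proof.
move=> H; elim: r => [|i r IH].
  rewrite big_nil; under eq_fun do rewrite big_nil; exact: tends_cst.
rewrite big_cons; under eq_fun do rewrite big_cons.
by case: ifP => Pi //; apply: tendsD => //; exact: H.
Qed.

Lemma tends_entry p q (f : T -> 'M[C]_(p, q)) (l : 'M[C]_(p, q)) :
  (forall i j, forall e : R, 0 < e -> F [set t | cn (f t i j - l i j) <= e]) -> tends F f l.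
Proof.
move=> H e e0; have D0 : 0 < (p * q).+1%:R :> R by rewrite ltr0n.
have h : \forall t \near F, forall ij : 'I_p * 'I_q,
    cn (f t ij.1 ij.2 - l ij.1 ij.2) <= e / (p * q).+1%:R.
  by apply: filter_forall => -[i j]; apply: H; rewrite divr_gt0.
apply: filterS h => t /= h.
apply: le_trans (@nm_le_entry _ _ _ _ (e / (p * q).+1%:R) _) _.
  by move=> i j; rewrite !mxE; exact: (h (i, j)).
by rewrite mulrCA ger_pMr // ler_pdivrMr // mul1r ler_nat.
Qed.

Lemma entry_tends p q (f : T -> 'M[C]_(p, q)) (l : 'M[C]_(p, q)) i j : tends F f l ->
  forall e : R, 0 < e -> F [set t | cn (f t i j - l i j) <= e].
Proof.
move=> H e /H; apply: filterS => t /=; apply: le_trans.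
by have := nm_entry (f t - l) i j; rewrite !mxE.
Qed.

Lemma tends_diag n (f : T -> 'rV[C]_n) l : tends F f l ->
  tends F (fun t => diag_mx (f t)) (diag_mx l).
Proof.
move=> H; apply: tends_entry => i j e e0.
have [->|ij] := eqVneq i j.
  by apply: filterS (entry_tends 0 j H e0) => t /=; rewrite !mxE eqxx !mulr1n.
by apply: filterE => t /=; rewrite !mxE (negPf ij) !mulr0n subrr cn0 ltW.
Qed.

Lemma tends_inv n (f : T -> 'M[C]_n) l : l \in unitmx -> tends F f l ->
  F [set t | f t \in unitmx] /\ tends F (fun t => invmx (f t)) (invmx l).
Proof.
move=> U hf; set K := nm (invmx l) * (2 * n%:R).
have h1 : F [set t | f t \in unitmx /\ nm (invmx (f t)) <= K].
  have : tends F (fun t => f t *m invmx l) 1%:M.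
    by rewrite -(mulmxV U); apply: tendsM => //; exact: tends_cst.
  move=> /(_ (1 / 2)); rewrite divr_gt0 // => /(_ isT); apply: filterS => t /=.
  move=> /unit_near1[U1 h].
  have Uf : f t \in unitmx by rewrite unitmx_mul unitmx_inv U andbT in U1.
  split=> //; have -> : invmx (f t) = invmx l *m invmx (f t *m invmx l).
    by rewrite -[LHS]mulmx1 -(mulmxV U1) !mulmxA mulVmx // mul1mx.
  by apply: le_trans (nmM _ _) _; rewrite ler_wpM2l ?nm_ge0.
split; first by apply: filterS h1 => t [].
move=> e e0.
have K0 : 0 <= K by rewrite !mulr_ge0 ?nm_ge0.
have D0 : 0 < K * nm (invmx l) + 1 by rewrite ltr_wpDl // mulr_ge0 ?nm_ge0.
have /hf : 0 < e / (K * nm (invmx l) + 1) by rewrite divr_gt0.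
apply: filterS2 h1 => t /= [Uf hK] h.
have -> : invmx (f t) - invmx l = - (invmx (f t) *m (f t - l) *m invmx l).
  by rewrite mulmxBr mulmxBl mulVmx // mul1mx -mulmxA mulmxV // mulmx1 opprB.
rewrite nmN; apply: le_trans (nmM _ _) _.
apply: le_trans (_ : K * (e / (K * nm (invmx l) + 1)) * nm (invmx l) <= _).
  rewrite ler_wpM2r ?nm_ge0 //; apply: le_trans (nmM _ _) _.
  by apply: ler_pM; rewrite ?nm_ge0.
rewrite mulrAC mulrA [_ * e]mulrC -mulrA ger_pMr // ler_pdivrMr // mul1r lerDl //.
Qed.

End Tends.

Section TendsProper.
Variables (R : realType) (T : Type) (F : set_system T).
Context {FF : ProperFilter F}.
Local Notation C := (cplx R).

Lemma tends_near_le p q (f : T -> 'M[C]_(p, q)) l (c : R) :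
  tends F f l -> F [set t | nm (f t) <= c] -> nm l <= c.
Proof.
move=> hf hc; apply/ler_addgt0Pr => e e0.
have h : F ([set t | nm (f t - l) <= e] `&` [set t | nm (f t) <= c]).
  by apply: filterI => //; exact: hf.
have [t [/= h1 h2]] := filter_ex h.
rewrite -(subKr (f t) l); apply: le_trans (nmB _ _) _.
by apply: lerD => //; rewrite nm_distC in h1 *.
Qed.

Lemma tends_unique p q (f : T -> 'M[C]_(p, q)) l m :
  tends F f l -> tends F f m -> l = m.
Proof.
move=> hl hm; apply/eqP; rewrite -subr_eq0; apply/eqP; apply: nm_eq0.
have h : tends F (fun t => f t - f t) (l - m) by apply: tendsD => //; exact: tendsN.
apply: (tends_near_le h); apply: filterE => t /=; by rewrite subrr nm0.
Qed.

End TendsProper.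

Section NearIn.
Variables (R : realType) (n : nat).
Local Notation C := (cplx R).
Implicit Types D : set 'rV[C]_n.

(** Radii are real and measured by [nm], and 0 is not removed. The punctured neighbourhoods of the
    theorem appear only in its last step. *)
Definition near_in D : set_system 'rV[C]_n :=
  [set P | exists2 d : R, 0 < d & forall t, D t -> nm t < d -> P t].

Global Instance near_in_filter D : Filter (near_in D).
Proof.
split; first by exists 1.
- move=> P Q [d d0 HP] [e e0 HQ]; exists (Order.min d e); first by rewrite lt_min d0.
  by move=> t Dt; rewrite lt_min => /andP[h1 h2]; split; [exact: HP | exact: HQ].
- by move=> P Q PQ [d d0 HP]; exists d => // t Dt h; apply: PQ; exact: HP.
Qed.

Lemma near_in_proper D : (forall d : R, 0 < d -> exists2 t, D t & nm t < d) ->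
  ProperFilter (near_in D).
Proof.
move=> H; split; last exact: near_in_filter.
by move=> [d d0 Hd]; have [t Dt h] := H d d0; exact: (Hd t Dt h).
Qed.

Lemma near_in_sub D D' P : D' `<=` D -> near_in D P -> near_in D' P.
Proof. by move=> DD [d d0 HP]; exists d => // t /DD; exact: HP. Qed.

Lemma near_in_and D P Q : near_in D P -> near_in D Q -> near_in D (P `&` Q).
Proof. exact: filterI. Qed.

Lemma near_in_imp D P Q : near_in D P -> (forall t, D t -> P t -> Q t) -> near_in D Q.
Proof. by move=> [d d0 H] PQ; exists d => // t Dt h; apply: PQ => //; exact: H. Qed.

Lemma near_in_bounded D p q (f : 'rV[C]_n -> 'M[C]_(p, q)) l : tends (near_in D) f l ->
  near_in D [set t | nm (f t) <= nm l + 1].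
Proof. exact: tends_bounded. Qed.

Lemma tends_near_in_id D : tends (near_in D) id 0.
Proof. by move=> e e0; exists e => // t _ h; rewrite /= subr0 ltW. Qed.

Lemma holomorphic_on_cont (V W : normedModType C) (D : set V) (f : V -> W) (x0 : V) :
  holomorphic_on D f -> D x0 -> forall e : R, 0 < e -> exists2 d : R, 0 < d &
  forall x, D x -> ball x0 (d%:C : C) x -> `|f x0 - f x| <= e%:C :> C.
Proof.
move=> [U [g [oU DU dg gf]]] Dx0 e e0.
have cg : {for x0, continuous g} by apply: differentiable_continuous; apply: dg; exact: DU.
have /cvgrPdist_le := cg; move=> /(_ (e%:C : C)); rewrite ltcR => /(_ e0).
move=> /nbhs_ballP[_ /posC[d d0 ->] Hd]; exists d => // x Dx hx.
by have := Hd x hx; rewrite /= !gf.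
Qed.

Lemma ball_nm (t t0 : 'rV[C]_n) (d : R) : nm (t - t0) < d -> ball t0 (d%:C : C) t.
Proof.
move=> h; rewrite -ball_normE /ball_ /= -opprB normrN.
by apply: le_lt_trans (norm_le_nm _) _; rewrite ltcR.
Qed.

Lemma holomorphic_tends (D : set 'rV[C]_n) p q (f : 'rV[C]_n -> 'M[C]_(p, q)) :
  holomorphic_on D f -> D 0 -> tends (near_in D) f (f 0).
Proof.
move=> hf D0 e e0.
have N0 : 0 < (p * q).+1%:R :> R by rewrite ltr0n.
have [d d0 Hd] := holomorphic_on_cont hf D0 (divr_gt0 e0 N0).
exists d => // t Dt ht; rewrite /= nm_distC.
apply: le_trans (nm_le_norm (Hd t Dt _)) _; first by apply: ball_nm; rewrite subr0.
by rewrite mulrCA ger_pMr // ler_pdivrMr // mul1r ler_nat.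
Qed.

(** Compactness of [a, b]: if near each point the property holds for all small [dl], one [dl] works
    everywhere. In the uses below [dl] is a radius in t, or the inverse of a bound. *)
Lemma segment_uniform (P : R -> R -> Prop) (a b : R) :
  (forall th0, a <= th0 <= b -> exists2 d : R, 0 < d &
     forall th dl, `|th - th0| < d -> 0 < dl -> dl < d -> P dl th) ->
  exists2 dl : R, 0 < dl & forall th, a <= th <= b -> P dl th.
Proof.
move=> H.
have := (@segment_compact R a b); rewrite compact_near_coveringP.
move=> /(_ R (0^'+) (fun dl th => P dl th) _) [].
  move=> th0; rewrite /= in_itv /= => /H[d d0 Hd].
  exists ([set th | `|th - th0| < d], [set dl | 0 < dl < d]).
    split => /=.
      apply/nbhs_ballP; exists d => //= x; by rewrite /ball /= distrC.
    near=> dl; apply/andP; split; near: dl; [exact: nbhs_right_gt | exact: nbhs_right_lt].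
  by move=> [th dl] /= [h1 /andP[h2 h3]]; exact: Hd.
move=> d /= d0 Hd; exists (d / 2); first by rewrite divr_gt0.
move=> th hth; apply: (Hd (d / 2)) => /=; last by rewrite in_itv.
  by rewrite sub0r normrN gtr0_norm ?divr_gt0 //; lra.
by rewrite divr_gt0.
Unshelve. all: by end_near. Qed.

End NearIn.

(** * Cells near the coalescence point *)

Section Cells.
Variables (R : realType) (n : nat).
Local Notation C := (cplx R).
Variables (u0 : 'rV[C]_n) (ttau eps0 : R).
Hypothesis eps0_gt0 : 0 < eps0.

Let PD : set 'rV[C]_n := polydisc eps0.
Let CD : set 'rV[C]_n := cell_domain eps0 u0 ttau.

(* Re ((u_a - u_b) e^(i ttau)), whose zeros for a <> b make up the
   coalescence and crossing loci. *)
Definition gap (t : 'rV[C]_n) (a b : 'I_n) : R :=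
  complex.Re (((u0 + t) 0 a - (u0 + t) 0 b) * cis ttau).

Lemma sin_intpi (m : int) : sin (m%:~R * pi : R) = 0.
Proof.
have nat_case k : sin (k%:R * pi : R) = 0.
  elim: k => [|k IH]; first by rewrite mul0r sin0.
  by rewrite -natr1 mulrDl mul1r sinDpi IH oppr0.
case: m => k; first exact: nat_case.
by rewrite NegzE mulrNz mulNr sinN nat_case oppr0.
Qed.

Lemma cos_intpi_neq0 (m : int) : cos (m%:~R * pi : R) != 0.
Proof.
apply/eqP => h; have := cos2Dsin2 (m%:~R * pi : R).
by rewrite h sin_intpi expr0n /= addr0 => /eqP; rewrite eq_sym oner_eq0.
Qed.

Lemma cisN_mul (x : R) : cis x * cis (- x) = 1 :> C.
Proof. by rewrite -cisD subrr /cis cos0 sin0. Qed.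

Lemma cell_domainP t : CD t <-> PD t /\ forall a b, a != b -> gap t a b != 0.
Proof.
have pip := pi_gt0 R; split.
  move=> [tP tX]; split=> // a b ab; apply/eqP => g0; apply: tX.
  have [e|ne] := eqVneq ((u0 + t) 0 a) ((u0 + t) 0 b).
    by left; split=> //; exists a, b.
  right; split=> //; exists a, b; split=> //.
  set x := (u0 + t) 0 a - (u0 + t) 0 b.
  have x0 : x != 0 by rewrite subr_eq0.
  pose y := x * cis ttau.
  have xE : x = y * cis (- ttau) by rewrite /y -mulrA cisN_mul mulr1.
  have yR : complex.Re y = 0 by exact: g0.
  have yI : complex.Im y != 0.
    apply: contra x0 => /eqP yI; rewrite xE.
    by have -> : y = 0 by [exact: cplx_eqP]; rewrite mul0r.
  have [yp|yn] := ltP 0 (complex.Im y).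
    (* As [eta_of ttau] is 3 pi / 2 - ttau, the integers -1 and -2 produce the arguments pi / 2 -
       ttau and - pi / 2 - ttau. *)
    exists (-1); exists (complex.Im y) => //.
    have -> : eta_of ttau + (-1)%:~R * pi = pi / 2 + - ttau.
      by rewrite /eta_of mulrNz mulNr mul1r; lra.
    rewrite cisD mulrA xE; congr (_ * _); clearbody y; apply: cplx_eqP;
      by rewrite ?ReM ?ImM /= cos_pihalf sin_pihalf; rewrite ?yR; ring.
  exists (-2); exists (- complex.Im y); first by rewrite oppr_gt0 lt_def eq_sym yI.
  have -> : eta_of ttau + (-2)%:~R * pi = - (pi / 2) + - ttau.
    by rewrite /eta_of mulrNz mulNr; have -> : (2%:~R : R) = 2 by []; lra.
  rewrite cisD mulrA xE; congr (_ * _); clearbody y; apply: cplx_eqP;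
    by rewrite ?ReM ?ImM /= cosN sinN cos_pihalf sin_pihalf; rewrite ?yR; ring.
move=> [tP H]; split=> // -[[_ [a [b [ab e]]]]|[_ [a [b [ne [m [r r0 e]]]]]]].
  by have := H a b ab; rewrite /gap e subrr mul0r eqxx.
have ab : a != b by apply: contra ne => /eqP ->.
have := H a b ab; rewrite /gap e -mulrA -cisD.
have -> : eta_of ttau + m%:~R * pi + ttau = (pi + m%:~R * pi) + pi / 2.
  by rewrite /eta_of; lra.
rewrite ReM /= mul0r subr0 cosDpihalf addrC sinDpi sin_intpi oppr0 oppr0 mulr0.
by rewrite eqxx.
Qed.

Lemma gap_turn t a b (k : int) :
  complex.Re (((u0 + t) 0 a - (u0 + t) 0 b) * cis (ttau + k%:~R * pi)) =
  gap t a b * cos (k%:~R * pi).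
Proof.
rewrite cisD mulrA ReM /gap /=.
by rewrite sin_intpi mulr0 subr0.
Qed.

Lemma stokes_neq t (k : int) theta : CD t -> stokes_direction (u0 + t) theta ->
  theta != ttau + k%:~R * pi.
Proof.
move=> /cell_domainP[_ H] [a [b [ne e]]]; apply/eqP => te; move: e; rewrite te gap_turn.
move/eqP; rewrite mulf_eq0 (negPf (cos_intpi_neq0 k)) orbF.
by apply/negP/H; apply: contra ne => /eqP ->.
Qed.

Lemma sector_half_plane t (k : int) (w : C) : CD t ->
  ttau + k%:~R * pi - pi <= carg w <= ttau + k%:~R * pi ->
  sector_at (u0 + t) ttau k w.
Proof.
move=> tD /andP[w1 w2] theta st; split=> h.
  by apply: le_lt_trans w2 _; rewrite lt_def h andbT; exact: stokes_neq st.
apply: lt_le_trans w1; rewrite lt_def eq_sym.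
have -> : ttau + k%:~R * pi - pi = ttau + (k - 1)%:~R * pi.
  by rewrite rmorphB /= mulrBl mul1r addrA.
apply/andP; split; first by rewrite eq_sym; have := stokes_neq (k - 1) tD st; rewrite eq_sym.
apply: le_trans h _; rewrite rmorphB /= mulrBl mul1r; lra.
Qed.

Lemma gap_affine t1 t2 (s : R) a b :
  gap (t1 + s%:C *: (t2 - t1)) a b = gap t1 a b + s * (gap t2 a b - gap t1 a b).
Proof.
rewrite /gap !mxE.
set x1 := t1 0 a; set x2 := t1 0 b; set y1 := t2 0 a; set y2 := t2 0 b.
set v1 := u0 0 a; set v2 := u0 0 b; set c := cis ttau.
have -> : (v1 + (x1 + s%:C * (y1 - x1)) - (v2 + (x2 + s%:C * (y2 - x2)))) * c =
  (v1 + x1 - (v2 + x2)) * c +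
  s%:C * ((v1 + y1 - (v2 + y2)) * c - (v1 + x1 - (v2 + x2)) * c) by ring.
by rewrite ReD [complex.Re (s%:C * _)]ReM /= mul0r subr0 ReD ReN.
Qed.

Lemma polydisc_convex t1 t2 (s : R) : PD t1 -> PD t2 -> 0 <= s <= 1 ->
  PD (t1 + s%:C *: (t2 - t1)).
Proof.
rewrite /PD /polydisc /= => h1 h2 /andP[s0 s1].
have -> : t1 + s%:C *: (t2 - t1) = (1 - s)%:C *: t1 + s%:C *: t2.
  apply/rowP => j; rewrite !mxE.
  have -> : ((1 - s)%:C : C) = 1 - s%:C by rewrite rmorphB rmorph1.
  by ring.
apply: le_trans (ler_normD _ _) _; rewrite !normrZ !normE !cn_real.
rewrite !ger0_norm ?subr_ge0 //.
have -> : (eps0%:C : C) = (1 - s)%:C * eps0%:C + s%:C * eps0%:C.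
  by rewrite -!rmorphM -rmorphD /=; congr (_%:C); ring.
by apply: lerD; apply: ler_wpM2l => //; rewrite ler0c ?subr_ge0.
Qed.

Lemma segment_continuous t1 t2 : continuous (fun s : R => t1 + s%:C *: (t2 - t1) : 'rV[C]_n).
Proof.
move=> s; apply/cvgrPdist_le => _ /posC[e e0 ->].
have [K K0 KE] := real_norm (t2 - t1).
have D0 : 0 < K + 1 by rewrite ltr_wpDl.
apply/nbhs_ballP; exists (e / (K + 1)); first by rewrite /= divr_gt0.
move=> s'; rewrite /ball /= => h.
have -> : t1 + s%:C *: (t2 - t1) - (t1 + s'%:C *: (t2 - t1)) = (s - s')%:C *: (t2 - t1).
  by rewrite opprD addrACA subrr add0r -scalerBl rmorphB.
rewrite normrZ normE cn_real KE -rmorphM /= lecR.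
apply: le_trans (_ : e / (K + 1) * (K + 1) <= _); last by rewrite divfK // lt0r_neq0.
by apply: ler_pM => //; [exact: ltW | rewrite lerDl].
Qed.

Lemma segment_component t1 t2 :
  (forall s : R, 0 <= s <= 1 -> CD (t1 + s%:C *: (t2 - t1))) ->
  connected_component CD t1 t2.
Proof.
move=> H; pose f (s : R) : 'rV[C]_n := t1 + s%:C *: (t2 - t1).
have f0 : f 0 = t1 by rewrite /f scale0r addr0.
have f1 : f 1 = t2 by rewrite /f scale1r addrC subrK.
have cf : connected (f @` [set` `[0 : R, 1]]).
  apply: connected_continuous_connected; first exact: segment_connected.
  exact/continuous_subspaceT/segment_continuous.
apply: (@connected_component_max _ CD (f @` [set` `[0 : R, 1]]) t1) => //.
- by exists 0; [rewrite /= in_itv /= lexx ler01 | exact: f0].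
- by move=> x [s]; rewrite /= in_itv /= => /H hs <-.
by exists 1; [rewrite /= in_itv /= lexx ler01 | exact: f1].
Qed.

(** On the cell domain the gaps of distinct indices are nonzero, so one bit per pair records their
    signs. The type of patterns is finite, which allows a filter to be intersected over all of
    them. *)
Definition sign_pattern (t : 'rV[C]_n) : {ffun 'I_n * 'I_n -> bool} :=
  [ffun ij => 0 < gap t ij.1 ij.2].

(** The gaps are affine in t and the polydisc is convex, so no gap vanishes on the segment between
    two points with the same signs. *)
Lemma same_pattern_component t1 t2 : CD t1 -> CD t2 -> sign_pattern t1 = sign_pattern t2 ->
  connected_component CD t1 t2.
Proof.
move=> /cell_domainP[p1 h1] /cell_domainP[p2 h2] E; apply: segment_component => s s01.
apply/cell_domainP; split; first exact: polydisc_convex.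
move=> a b ab; rewrite gap_affine; case/andP: s01 => s0 s1.
have := congr1 (fun p : {ffun 'I_n * 'I_n -> bool} => p (a, b)) E; rewrite !ffunE /=.
have := h1 a b ab; have := h2 a b ab; move: (gap t1 a b) (gap t2 a b) => g1 g2 n2 n1.
clear E p1 p2 h1 h2; case: (ltP 0 g1) => c1 /esym; last first.
  move/negbT; rewrite -leNgt => c2; apply/eqP.
  have {}c1 : g1 < 0 by rewrite lt_def eq_sym n1.
  have {}c2 : g2 < 0 by rewrite lt_def eq_sym n2.
  by move=> h; nra.
by move=> c2; apply/eqP => h; nra.
Qed.

Lemma gap_near : near_in PD [set t | forall a b, gap 0 a b != 0 -> 0 < gap 0 a b * gap t a b].
Proof.
have : \forall t \near near_in PD, forall ij : 'I_n * 'I_n,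
    gap 0 ij.1 ij.2 != 0 -> 0 < gap 0 ij.1 ij.2 * gap t ij.1 ij.2.
  apply: filter_forall => -[a b] /=.
  have [g0|g0] := eqVneq (gap 0 a b) 0; first by exists 1.
  exists (`|gap 0 a b| / 4); first by rewrite divr_gt0 ?normr_gt0.
  move=> t _ ht _.
  have h : `|gap t a b - gap 0 a b| <= `|gap 0 a b| / 2.
    apply: le_trans (_ : nm t + nm t <= _); last by move: ht; lra.
    have -> : gap t a b - gap 0 a b = complex.Re ((t 0 a - t 0 b) * cis ttau).
      by rewrite /gap -ReN -ReD -mulrBl !mxE; congr (complex.Re (_ * _)); ring.
    apply: le_trans (Re_le_cn _) _; rewrite cnM cn_cis mulr1.
    by apply: le_trans (cnB _ _) _; apply: lerD; exact: nm_entry.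
  move: h g0; move: (gap t a b) (gap 0 a b) => g g0 h g00.
  have -> : g0 * g = g0 ^+ 2 + g0 * (g - g0) by ring.
  have h2 : `|g0 * (g - g0)| <= `|g0| ^+ 2 / 2.
    by rewrite normrM expr2 -mulrA ler_wpM2l.
  rewrite real_normK ?num_real // in h2; move: h2; rewrite ler_norml => /andP[h2 _].
  have : 0 < g0 ^+ 2 by rewrite exprn_even_gt0.
  lra.
by move/near_in_imp; apply => t _ h a b; exact: (h (a, b)).
Qed.

Lemma gap_scale t (s : R) a b : gap (s%:C *: t) a b = gap 0 a b + s * (gap t a b - gap 0 a b).
Proof. by rewrite -gap_affine add0r subr0. Qed.

(** When t is shrunk towards 0, a gap that vanishes at 0 is multiplied by s, and any other keeps its
    sign because t is already close to 0; so the cell accumulates at 0. The second part reduces a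
    limit within the cell domain to limits along cells, by finiteness of the sign patterns. *)
Lemma near_in_cells : exists2 d1 : R, 0 < d1 &
  (forall t (s : R), CD t -> nm t < d1 -> 0 < s <= 1 ->
     connected_component CD t (s%:C *: t)) /\
  (forall P : set 'rV[C]_n,
    (forall t0, CD t0 -> nm t0 < d1 -> near_in (connected_component CD t0) P) ->
    near_in CD P).
Proof.
have [d1 d10 H1] := gap_near; exists d1 => //; split.
  move=> t s tD td /andP[s0 s1].
  have /cell_domainP[tP tg] := tD; have gn := H1 t tP td.
  have key a b : a != b -> (0 < gap (s%:C *: t) a b) = (0 < gap t a b) /\ gap (s%:C *: t) a b != 0.
    move=> ab; rewrite gap_scale; have := tg a b ab; have := gn a b.
    have [->|g0] := eqVneq (gap 0 a b) 0.
      move=> _ h; rewrite add0r subr0 pmulr_rgt0 //; split=> //.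
      by rewrite mulf_neq0 // gt_eqF.
    move=> /(_ isT); move: (gap 0 a b) (gap t a b) g0 => g0 g g00 h gn0.
    case: (ltP 0 g0) => c.
      have g1 : 0 < g by rewrite -(pmulr_rgt0 _ c).
      have : 0 < g0 + s * (g - g0) by nra.
      by move=> e; rewrite e g1; split=> //; rewrite gt_eqF.
    have {}c : g0 < 0 by rewrite lt_def eq_sym g00.
    have g1 : g < 0 by rewrite -(nmulr_rgt0 _ c).
    have e : g0 + s * (g - g0) < 0 by nra.
    by rewrite ltNge (ltW e) ltNge (ltW g1); split=> //; rewrite lt_eqF.
  apply: same_pattern_component => //.
    apply/cell_domainP; split.
      have := @polydisc_convex 0 t s _ tP; rewrite add0r subr0; apply.
        by rewrite /PD /polydisc /= normr0 lecR ltW.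
      by rewrite s1 ltW.
    by move=> a b /key[].
  apply/ffunP => -[a b]; rewrite !ffunE /=.
  have [->|ab] := eqVneq a b; first by rewrite /gap !subrr.
  by have [-> _] := key a b ab.
move=> P HP.
have : \forall t \near near_in CD, forall p : {ffun 'I_n * 'I_n -> bool}, sign_pattern t = p -> P t.
  apply: filter_forall => p.
  have [[t0 [t0D t0d t0p]]|no] := pselect (exists t0, [/\ CD t0, nm t0 < d1 & sign_pattern t0 = p]).
    have [d d0 Hd] := HP t0 t0D t0d; exists d => // t tD td tp; apply: Hd => //.
    by apply: same_pattern_component => //; rewrite t0p.
  by exists d1 => // t tD td tp; exfalso; apply: no; exists t.
by move/near_in_imp; apply => t _ h; exact: (h (sign_pattern t)).
Qed.

Lemma near_in_component_proper t : CD t ->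
  (forall s : R, 0 < s <= 1 -> connected_component CD t (s%:C *: t)) ->
  ProperFilter (near_in (connected_component CD t)).
Proof.
move=> tD H; apply: near_in_proper => d d0.
have D0 : 0 < nm t + 1 by rewrite ltr_wpDl ?nm_ge0.
pose s := Order.min 1 (d / (nm t + 1)).
have s0 : 0 < s by rewrite lt_min ltr01 divr_gt0.
exists (s%:C *: t); first by apply: H; rewrite s0 ge_min lexx.
rewrite nmZ cn_real gtr0_norm //.
apply: lt_le_trans (_ : s * (nm t + 1) <= _); first by rewrite ltr_pM2l // ltrDl.
apply: le_trans (_ : d / (nm t + 1) * (nm t + 1) <= _); last by rewrite divfK // lt0r_neq0.
by rewrite ler_wpM2r ?(ltW D0) // ge_min lexx orbT.
Qed.

Lemma cell_domain_near0 (d : R) : 0 < d -> exists2 t, CD t & nm t < d.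
Proof.
move=> d0; have [d1 d10 H1] := gap_near.
(* In this direction the gap of a and b moves at the rate a - b, so every gap that vanishes at 0
   becomes nonzero. *)
pose v : 'rV[C]_n := \row_a ((a%:R : C) * cis (- ttau)).
pose K := nm v + 1.
have K0 : 0 < K by rewrite ltr_wpDl ?nm_ge0.
pose m := Order.min d (Order.min d1 eps0).
have m0 : 0 < m by rewrite !lt_min d0 d10.
pose et := m / K.
have et0 : 0 < et by rewrite divr_gt0.
have tn : nm (et%:C *: v) < m.
  rewrite nmZ cn_real gtr0_norm //.
  apply: lt_le_trans (_ : et * K <= _); first by rewrite ltr_pM2l // ltrDl.
  by rewrite divfK // lt0r_neq0.
have : nm (et%:C *: v) < m by []; rewrite !lt_min => /and3P[n1 n2 n3].
exists (et%:C *: v) => //.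
have tP : PD (et%:C *: v).
  by rewrite /PD /polydisc /=; apply: le_trans (norm_le_nm _) _; rewrite lecR ltW.
apply/cell_domainP; split=> // a b ab.
have := H1 _ tP n2 a b.
have [g0 _|_ /(_ isT)] := eqVneq (gap 0 a b) 0; last first.
  by apply: contraTneq => ->; rewrite mulr0 ltxx.
rewrite gap_scale g0 add0r subr0 mulf_neq0 ?(gt_eqF et0) //.
have -> : gap v a b = gap 0 a b + (a%:R - b%:R).
  rewrite /gap !mxE addr0.
  have -> : (u0 0 a + a%:R * cis (- ttau) - (u0 0 b + b%:R * cis (- ttau))) * cis ttau =
    (u0 0 a - u0 0 b) * cis ttau + (a%:R - b%:R) * (cis ttau * cis (- ttau)) :> C by ring.
  rewrite cisN_mul mulr1 ReD addr0; congr (_ + _).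
  have -> : (a%:R - b%:R : C) = (a%:R - b%:R : R)%:C by rewrite rmorphB !rmorph_nat.
  by [].
rewrite g0 add0r subr_eq0 eqr_nat.
by apply: contra ab => /eqP e; apply/eqP/val_inj.
Qed.

End Cells.

(** * Uniqueness of solutions with given asymptotics *)

Section LinearSystem.
Variables (R : realType) (n : nat).
Local Notation C := (cplx R).
Variables (x0 : R) (a : C -> 'M[C]_n).
Hypothesis a_cont : forall w : C, x0 <= complex.Re w -> forall e : R, 0 < e ->
  exists2 d : R, 0 < d & forall h, cn h < d -> x0 <= complex.Re (w + h) ->
    nm (a (w + h) - a w) <= e.

Lemma a_bounded (w d : C) : x0 <= complex.Re w -> x0 <= complex.Re (w + d) ->
  exists M : R, forall s : R, 0 <= s <= 1 -> nm (a (seg w d s)) <= M.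
Proof.
move=> h0 h1.
have [|dl dl0 H] := @segment_uniform R (fun dl s => 0 <= s <= 1 -> nm (a (seg w d s)) <= dl^-1) 0 1.
  move=> s0 s01; have sx := seg_Re_ge s01 h0 h1.
  have [e e0 He] := a_cont sx ltr01.
  pose K := nm (a (seg w d s0)) + 1.
  have K0 : 0 < K by rewrite ltr_wpDl ?nm_ge0.
  have D0 : 0 < cn d + 1 by rewrite ltr_wpDl ?cn_ge0.
  exists (Order.min (e / (cn d + 1)) K^-1); first by rewrite lt_min divr_gt0 //= invr_gt0.
  move=> s dl; rewrite lt_min => /andP[hs _] dl0; rewrite lt_min => /andP[_ hdl] s01'.
  apply: le_trans (_ : K <= _); last by rewrite -[K]invrK lef_pV2 ?posrE ?invr_gt0 // ltW.
  have E : seg w d s = seg w d s0 + (s - s0)%:C * d.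
    by rewrite !segE rmorphB /=; ring.
  have sx' := seg_Re_ge s01' h0 h1.
  rewrite -(subrK (a (seg w d s0)) (a (seg w d s))) addrC.
  apply: le_trans (nmD _ _) _; rewrite lerD2l {1}E; apply: He; last by rewrite -E.
  rewrite cnM cn_real.
  apply: le_lt_trans (_ : `|s - s0| * (cn d + 1) < _).
    by rewrite ler_wpM2l // lerDl.
  by rewrite -ltr_pdivlMr.
by exists dl^-1 => s s01; exact: H.
Qed.

Lemma linear_ode_unique p (f : C -> 'M[C]_(n, p)) (w0 : C) :
  (forall w : C, x0 <= complex.Re w -> mder f w (a w *m f w)) ->
  x0 <= complex.Re w0 -> f w0 = 0 ->
  forall w : C, x0 <= complex.Re w -> f w = 0.
Proof.
move=> Hf hw0 f0 w hw; pose d := w - w0.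
have wE : w = w0 + d by rewrite addrC subrK.
have hwd : x0 <= complex.Re (w0 + d) by rewrite -wE.
have [M HM] := a_bounded hw0 hwd.
have [G G0 HG] := gronwall n p (M * cn d).
apply: nm_eq0; rewrite wE; apply: le_trans (_ : G * nm (f w0) <= _); last by rewrite f0 nm0 mulr0.
apply: (HG f (fun w => a w *m f w)) => s s01.
have sx := seg_Re_ge s01 hw0 hwd; split; first exact: Hf.
rewrite [M * _ * _]mulrAC ler_wpM2r ?cn_ge0 //; apply: le_trans (nmM _ _) _.
by rewrite ler_wpM2r ?nm_ge0 //; exact: HM.
Qed.

Lemma mder_mulr p (f : C -> 'M[C]_n) (Q : 'M[C]_(n, p)) (w : C) :
  mder f w (a w *m f w) -> mder (fun w => f w *m Q) w (a w *m (f w *m Q)).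
Proof.
move=> h; have := mderM h (mder_cst Q w); rewrite mulmx0 addr0.
by move/mder_eq; apply; rewrite mulmxA.
Qed.

(** If Q spans the kernel of [f w], then f Q is a solution vanishing at [w], hence everywhere;
    invertibility at [w1] gives Q = 0. *)
Lemma unit_propagates (f : C -> 'M[C]_n) (w1 : C) :
  (forall w : C, x0 <= complex.Re w -> mder f w (a w *m f w)) ->
  x0 <= complex.Re w1 -> f w1 \in unitmx ->
  forall w : C, x0 <= complex.Re w -> f w \in unitmx.
Proof.
move=> Hf hw1 U w hw; rewrite -row_full_unit -cokermx_eq0; apply/eqP.
set Q := cokermx (f w).
have h0 : f w *m Q = 0 by exact: mulmx_coker.
have := @linear_ode_unique n (fun w => f w *m Q) w _ hw h0 w1 hw1.
move=> /(_ _) h; have {}h : f w1 *m Q = 0.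
  by apply: h => z hz; apply: mder_mulr; exact: Hf.
by rewrite -(mulKmx U Q) h mulmx0.
Qed.

End LinearSystem.

Section Uniqueness.
Variables (R : realType) (n : nat).
Local Notation C := (cplx R).

Lemma strip_conj (u b : 'rV[C]_n) (M : 'M[C]_n) (Z : C -> 'M[C]_n) (w : C) :
  strip u b (fun w => Z w *m M) w =
  strip u b Z w *m \matrix_(i, j) (cexp ((u 0 i - u 0 j) * cexp w + (b 0 i - b 0 j) * w) * M i j).
Proof.
rewrite /strip; set E := expz (- u) w; set P := zpow (- b) w.
have -> : \matrix_(i, j) (cexp ((u 0 i - u 0 j) * cexp w + (b 0 i - b 0 j) * w) * M i j) =
   zpow b w *m expz u w *m M *m E *m P.
  apply/matrixP => i j; rewrite mxE /E /P /zpow /expz.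
  rewrite mul_mx_diag mxE mul_mx_diag mxE -mulmxA mul_diag_mx mxE mul_diag_mx !mxE.
  have -> : (u 0 i - u 0 j) * cexp w + (b 0 i - b 0 j) * w =
    b 0 i * w + u 0 i * cexp w + - u 0 j * cexp w + - b 0 j * w by ring.
  by rewrite !cexpD; ring.
have PE : P *m zpow b w = 1%:M.
  rewrite /P /zpow mulmx_diag; apply/matrixP => i j; rewrite !mxE; congr (_ *+ _).
  by rewrite -cexpD mulNr addNr cexp0.
have EE : E *m expz u w = 1%:M.
  rewrite /E /expz mulmx_diag; apply/matrixP => i j; rewrite !mxE; congr (_ *+ _).
  by rewrite -cexpD mulNr addNr cexp0.
rewrite !mulmxA -[Z w *m E *m P *m zpow b w]mulmxA PE mulmx1.
by rewrite -[Z w *m E *m expz u w]mulmxA EE mulmx1.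
Qed.

(* Z2 = Z1 M with M constant; the entries of M - 1 appear in the asymptotics with
   factors exp ((u_i - u_j) z) z^(b_i - b_j), which do not decay exponentially on
   one of the two boundary directions of the half-plane. *)
Lemma asymptotic_unique (N0 : R) (A : C -> 'M[C]_n) (u b : 'rV[C]_n)
  (F : nat -> 'M[C]_n) (th : R) (D D' : set C) (Z1 Z2 : C -> 'M[C]_n) :
  0 < N0 ->
  (forall w : C, ln N0 <= complex.Re w -> forall e : R, 0 < e ->
    exists2 d : R, 0 < d & forall h, cn h < d -> ln N0 <= complex.Re (w + h) ->
    nm (cexp (w + h) *: A (cexp (w + h)) - cexp w *: A (cexp w)) <= e) ->
  (forall w : C, th - pi <= carg w <= th -> D w) ->
  (forall w : C, th - pi <= carg w <= th -> D' w) ->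
  canonical_solution N0 A 1%:M u b F D Z1 ->
  canonical_solution N0 A 1%:M u b F D' Z2 ->
  forall w : C, outside N0 (cexp w) -> Z2 w = Z1 w.
Proof.
move=> N00 a_cont HD HD' [f1 as1] [f2 as2].
have pip := pi_gt0 R.
have outE w := @outside_ln R N0 w N00.
pose a w := cexp w *: A (cexp w).
have d1 (w : C) : ln N0 <= complex.Re w -> mder Z1 w (a w *m Z1 w) /\ Z1 w \in unitmx.
  rewrite -outE => /f1[h U]; split => //; move/mderP: h => h; apply: mder_eq h _.
  by rewrite /a scalemxAl.
have d2 (w : C) : ln N0 <= complex.Re w -> mder Z2 w (a w *m Z2 w).
  rewrite -outE => /f2[h _]; move/mderP: h => h; apply: mder_eq h _.
  by rewrite /a scalemxAl.
pose w1 : C := ln N0 +i* 0.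
have hw1 : ln N0 <= complex.Re w1 by [].
have [_ U1] := d1 w1 hw1.
pose M := invmx (Z1 w1) *m Z2 w1.
have Z2E (w : C) : ln N0 <= complex.Re w -> Z2 w = Z1 w *m M.
  move=> hw; apply/eqP; rewrite -subr_eq0; apply/eqP.
  apply: (@linear_ode_unique R n (ln N0) a a_cont n (fun w => Z2 w + - (Z1 w *m M)) w1) => //.
    move=> z hz; have h := mderD (d2 z hz) (mderN (mder_mulr M (d1 z hz).1)).
    by apply: mder_eq h _; rewrite mulmxDr mulmxN.
  by rewrite /M mulKVmx // subrr.
suff M1 : M = 1%:M by move=> w; rewrite outE => /Z2E ->; rewrite M1 mulmx1.
pose B := nm b + nm b.
have B0 : 0 <= B by rewrite addr_ge0 ?nm_ge0.
(* In a suitable direction the factor in front of an entry of M - 1 is at least a constant times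
   |z|^(-B). The transition matrix [J] differs from 1 by O(|z|^(-N-1)), so order N >= B leaves a
   bound tending to 0. *)
pose N := Num.bound B.
have BN : B <= N%:R by rewrite ltW // archi_boundP.
have [K1 [r1 [K10 H1]]] := asymptotic_trunc as1 HD N.
have [K2 [r2 [K20 H2]]] := asymptotic_trunc as2 HD' N.
pose KF := \sum_(k < N.+1) nm (with_id F k).
have HF k : (k <= N)%N -> nm (with_id F k) <= KF.
  move=> kN; rewrite /KF (bigD1 (Ordinal (kN : (k < N.+1)%N))) //= lerDl.
  by apply: sumr_ge0 => j _; exact: nm_ge0.
have KF0 : 0 <= KF by apply: sumr_ge0 => j _; exact: nm_ge0.
set X1 := fun w => invmx 1%:M *m strip u b Z1 w in H1.
set X2 := fun w => invmx 1%:M *m strip u b Z2 w in H2.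
pose J w : 'M[C]_n := \matrix_(i, j) (cexp ((u 0 i - u 0 j) * cexp w + (b 0 i - b 0 j) * w) * M i j).
have X2E (w : C) : ln N0 <= complex.Re w -> X2 w = X1 w *m J w.
  move=> hw; rewrite /X2 /X1 -mulmxA -strip_conj; congr (_ *m _).
  by rewrite /strip Z2E.
have X1near : exists r3 : R, forall w : C, th - pi <= complex.Im w <= th -> r3 <= complex.Re w ->
   nm (X1 w - 1%:M) <= 1 / 2.
  pose Q := 2 * (K1 + N%:R * KF) + 1.
  have Q1 : 1 <= Q by rewrite lerDr !mulr_ge0 // addr_ge0 // mulr_ge0.
  have Q0 : 0 < Q by exact: lt_le_trans Q1.
  exists (Num.max r1 (ln Q)) => w wI; rewrite ge_max => /andP[wr wQ].
  have w0 : 0 <= complex.Re w by apply: le_trans wQ; exact: ln_ge0.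
  have -> : X1 w - 1%:M = (X1 w - trunc F N w) + (trunc F N w - 1%:M) by rewrite addrA subrK.
  apply: le_trans (nmD _ _) _.
  apply: le_trans (lerD (H1 w wI wr) (trunc_near1 w0 HF)) _.
  apply: le_trans (_ : (K1 + N%:R * KF) * expR (- complex.Re w) <= _).
    rewrite [leRHS]mulrDl; apply: lerD => //.
    by rewrite ler_wpM2l // ler_expR mulNr lerN2 ler_peMl // ler1n.
  apply: le_trans (_ : (K1 + N%:R * KF) * expR (- ln Q) <= _).
    by rewrite ler_wpM2l ?addr_ge0 ?mulr_ge0 // ler_expR lerN2.
  rewrite expRN lnK ?posrE // ler_pdivrMr // /Q; lra.
have [r3 H3] := X1near.
have Jnear : exists K r : R, [/\ 0 <= K & forall w : C, th - pi <= complex.Im w <= th ->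
    r <= complex.Re w -> nm (J w - 1%:M) <= K * expR (- N.+1%:R * complex.Re w)].
  exists (2 * n%:R * (K1 + K2)), (Num.max (Num.max r1 r2) (Num.max r3 (ln N0))); split.
    by rewrite !mulr_ge0 // addr_ge0.
  move=> w wI; rewrite !ge_max => /andP[/andP[wr1 wr2] /andP[wr3 wr]].
  have [U hU] := unit_near1 (H3 w wI wr3).
  have -> : J w - 1%:M = invmx (X1 w) *m (X2 w - X1 w).
    move: (X2E w wr) U; move: (X1 w) (X2 w) (J w) => x1 x2 jw -> Ux.
    by rewrite mulmxBr mulVmx // mulKmx.
  apply: le_trans (nmM _ _) _; rewrite -mulrA; apply: ler_pM; rewrite ?nm_ge0 //.
  have -> : X2 w - X1 w = (X2 w - trunc F N w) - (X1 w - trunc F N w).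
    by rewrite opprB addrA subrK.
  apply: le_trans (nmB _ _) _; rewrite mulrDl addrC.
  by apply: lerD; [exact: H1 | exact: H2].
have [K [r [K0 HJ]]] := Jnear.
apply/eqP; rewrite -subr_eq0; apply/eqP/matrixP => i j; rewrite [RHS]mxE.
apply/eqP; rewrite -cn_eq0 eq_le cn_ge0 andbT; apply/ler_addgt0Pr => e e0; rewrite add0r.
have [th' [thI thc]] : exists th', th - pi <= th' <= th /\
    0 <= complex.Re ((u 0 i - u 0 j) * cis th').
  have [h|h] := leP 0 (complex.Re ((u 0 i - u 0 j) * cis th)).
    by exists th; split=> //; apply/andP; split; lra.
  exists (th - pi); split; first by apply/andP; split; lra.
  have -> : cis (th - pi) = - cis th :> C.
    rewrite cisD; have -> : cis (- pi) = -1 :> C.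
      by rewrite /cis cosN sinN cospi sinpi oppr0; apply: cplx_eqP; rewrite /= ?oppr0.
    by rewrite mulrN1.
  by rewrite mulrN ReN oppr_ge0 ltW.
pose K' := K * expR (B * `|th'|) + 1.
have K'0 : 0 < K' by rewrite ltr_wpDl // mulr_ge0 ?expR_ge0.
pose x := Num.max (Num.max r 0) (ln (K' / e)).
pose w : C := x +i* th'.
have hw : complex.Re w = x by [].
have x0 : 0 <= x by rewrite /x !le_max lexx orbT.
have := HJ w thI _; rewrite hw => /(_ _) HJw.
have {}HJw : nm (J w - 1%:M) <= K * expR (- N.+1%:R * x) by apply: HJw; rewrite /x !le_max lexx.
have := le_trans (nm_entry _ i j) HJw.
have -> : (J w - 1%:M) i j = cexp ((u 0 i - u 0 j) * cexp w + (b 0 i - b 0 j) * w) * (M - 1%:M) i j.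
  rewrite !mxE; have [->|ij] := eqVneq i j.
    by rewrite !subrr !mul0r addr0 cexp0 !mul1r.
  by rewrite mulr0n !subr0.
rewrite cnM cn_cexp => h.
have low : expR (- (B * (x + `|th'|))) <=
    expR (complex.Re ((u 0 i - u 0 j) * cexp w + (b 0 i - b 0 j) * w)).
  rewrite ler_expR ReD.
  have h1 : 0 <= complex.Re ((u 0 i - u 0 j) * cexp w).
    rewrite cexpE /= mulrCA ReM /= mul0r subr0 mulr_ge0 ?expR_ge0 //.
  have h2 : `|complex.Re ((b 0 i - b 0 j) * w)| <= B * (x + `|th'|).
    apply: le_trans (Re_le_cn _) _; rewrite cnM; apply: ler_pM; rewrite ?cn_ge0 //.
      by apply: le_trans (cnB _ _) _; apply: lerD; exact: nm_entry.
    by apply: le_trans (cn_le_ReIm _) _; rewrite /= ger0_norm.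
  move: h2; rewrite ler_norml => /andP[h2 _].
  by apply: le_trans h2 _; rewrite lerDr.
have h4 : expR (- (B * (x + `|th'|))) * cn ((M - 1%:M) i j) <= K * expR (- N.+1%:R * x).
  by apply: le_trans h; rewrite ler_wpM2r ?cn_ge0.
rewrite expRN ler_pdivrMl ?expR_gt0 // in h4; apply: le_trans h4 _.
apply: le_trans (_ : K * expR (B * `|th'|) * expR (- x) <= _).
  rewrite mulrCA -mulrA ler_wpM2l // -!expRD ler_expR -natr1.
  have : B * x <= N%:R * x by rewrite ler_wpM2r.
  lra.
apply: le_trans (_ : K' * expR (- ln (K' / e)) <= _).
  apply: ler_pM; rewrite ?mulr_ge0 ?expR_ge0 //; first by rewrite lerDl.
  by rewrite ler_expR lerN2 /x !le_max lexx orbT.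
by rewrite expRN lnK ?posrE ?divr_gt0 // invf_div mulrC divfK // lt0r_neq0.
Qed.

End Uniqueness.

(** * Canonical solutions near the coalescence point *)

Section NearCoalescence.
Variables (R : realType) (n : nat).
Local Notation C := (cplx R).
Variables (u0 : 'rV[C]_n) (ttau eps0 N0 : R) (A : C -> 'rV[C]_n -> 'M[C]_n)
  (Aj : nat -> 'rV[C]_n -> 'M[C]_n) (G0 : 'rV[C]_n -> 'M[C]_n) (F : nat -> 'rV[C]_n -> 'M[C]_n).
Hypotheses (eps0_gt0 : 0 < eps0) (N0_gt0 : 0 < N0).
Hypothesis A_hol : holomorphic_on
     [set p : C * 'rV[C]_n | outside N0 p.1 /\ polydisc eps0 p.2]
     (fun p => A p.1 p.2).
Hypothesis A_series : forall z t, outside N0 z -> polydisc eps0 t ->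
     series (fun j => z ^- j *: Aj j t) @ \oo --> A z t.
Hypothesis G0_hol : holomorphic_on (polydisc eps0) G0.
Hypothesis G0_unit : forall t, polydisc eps0 t -> G0 t \in unitmx.
Hypothesis G0_0 : G0 0 = 1%:M.
Hypothesis F_formal : forall t, polydisc eps0 t -> ~ coalescence_locus eps0 u0 t ->
     formal_solution (Aj ^~ t) (G0 t) (u0 + t) (F ^~ t).
Hypothesis F_hol : forall j, (0 < j)%N -> holomorphic_on (polydisc eps0) (F j).

Let PD : set 'rV[C]_n := polydisc eps0.
Let CD : set 'rV[C]_n := cell_domain eps0 u0 ttau.
Let bt (t : 'rV[C]_n) : 'rV[C]_n := B1 (G0 t) (Aj 1%N t).
(** The summand 1 leaves room for t near 0, where [nm (bt t) <= Kb]; [B] then bounds the differences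
    of the exponents. *)
Let Kb : R := nm (bt 0) + 1.
Let B : R := Kb + Kb.
(** Radius of the circle that carries the Cauchy estimates; it exceeds [N0], so that the series
    converges geometrically there. *)
Let rho := N0 + 1.

Lemma polydisc0 : PD 0.
Proof. by rewrite /PD /polydisc /= normr0 lecR ltW. Qed.

Lemma A_cont (z0 : C) : N0 <= cn z0 -> forall e : R, 0 < e -> exists2 d : R, 0 < d &
  forall z t, N0 <= cn z -> PD t -> cn (z - z0) < d -> nm t < d ->
    nm (A z t - A z0 0) <= e.
Proof.
move=> hz0 e e0; have D0 : 0 < (n * n).+1%:R :> R by rewrite ltr0n.
have := holomorphic_on_cont A_hol (x0 := (z0, 0)) _ (divr_gt0 e0 D0).
case=> [|d d0 Hd]; first by split; [rewrite /outside /= cn_ge | exact: polydisc0].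
exists d => // z t hz ht zd td; rewrite nm_distC.
have /nm_le_norm : `|A z0 0 - A z t| <= (e / (n * n).+1%:R)%:C :> C.
  apply: (Hd (z, t)); first by split => //; rewrite /outside /= cn_ge.
  split => /=; last by apply: ball_nm; rewrite subr0.
  by rewrite /ball /= distrC cn_lt.
move/le_trans; apply; rewrite mulrCA ger_pMr // ler_pdivrMr // mul1r ler_nat //.
Qed.

Lemma cis_cont (th0 e : R) : 0 < e -> exists2 d : R, 0 < d & forall th, `|th - th0| < d ->
  cn (cis th - cis th0 : C) <= e.
Proof.
move=> e0; pose z0 : C := 0 +i* th0.
have [d d0 Hd] := is_derive_contP (is_derive_cexp z0) e0; exists d => // th hth.
pose k : C := 0 +i* (th - th0).
have ck : cn k = `|th - th0| by rewrite /cn /= expr0n /= add0r sqrtr_sqr.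
have := Hd k; rewrite ck !cexpE.
have -> : complex.Re (z0 + k) = 0 by rewrite ReD /= addr0.
have -> : complex.Im (z0 + k) = th by rewrite ImD /= addrC subrK.
by rewrite expR0 !mul1r; apply.
Qed.

Let rho0 : 0 < rho. Proof. by rewrite addr_gt0. Qed.

Lemma cn_circle (th : R) : cn (rho%:C * cis th) = rho.
Proof. by rewrite cnM cn_cis mulr1 cn_real gtr0_norm. Qed.

Lemma N0_circle (th : R) : N0 <= cn (rho%:C * cis th).
Proof. by rewrite cn_circle lerDl. Qed.

Lemma circle_local (th0 e : R) : 0 < e -> exists2 d : R, 0 < d & forall th t,
  `|th - th0| < d -> PD t -> nm t < d ->
  nm (A (rho%:C * cis th) t - A (rho%:C * cis th0) 0) <= e.
Proof.
move=> e0; have [d d0 Hd] := A_cont (N0_circle th0) e0.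
have [d1 d10 H1] := @cis_cont th0 (d / rho / 2) (divr_gt0 (divr_gt0 d0 rho0) (ltr0Sn _ 1)).
exists (Order.min d d1); first by rewrite lt_min d0.
move=> th t; rewrite lt_min => /andP[_ /H1 h1] ht; rewrite lt_min => /andP[td _].
apply: Hd => //; first exact: N0_circle.
rewrite -mulrBr cnM cn_real gtr0_norm //.
apply: le_lt_trans (ler_wpM2l (ltW rho0) h1) _.
have -> : rho * (d / rho / 2) = d / 2 by field; rewrite lt0r_neq0.
lra.
Qed.

Lemma circle_tends (e : R) : 0 < e -> near_in PD [set t | forall th, 0 <= th <= 2 * pi ->
  nm (A (rho%:C * cis th) t - A (rho%:C * cis th) 0) <= e].
Proof.
move=> e0; have e2 : 0 < e / 2 by rewrite divr_gt0.
have [|dl dl0 Hdl] := @segment_uniform R (fun dl th => forall t, PD t -> nm t < dl ->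
   nm (A (rho%:C * cis th) t - A (rho%:C * cis th) 0) <= e) 0 (2 * pi).
  move=> th0 _; have [d d0 Hd] := circle_local th0 e2.
  exists d => // th dl hth dl0 dld t ht td.
  have h1 := Hd th t hth ht (lt_trans td dld).
  have h2 := Hd th 0 hth polydisc0; rewrite nm0 in h2.
  have -> : A (rho%:C * cis th) t - A (rho%:C * cis th) 0 =
    (A (rho%:C * cis th) t - A (rho%:C * cis th0) 0) - (A (rho%:C * cis th) 0 - A (rho%:C * cis th0) 0).
    by rewrite opprB addrA subrK.
  by apply: le_trans (nmB _ _) _; rewrite (splitr e); apply: lerD => //; exact: h2.
by exists dl => // t ht td th hth; exact: Hdl.
Qed.

Lemma circle_bound : exists2 M : R, 0 <= M & forall th, 0 <= th <= 2 * pi ->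
  nm (A (rho%:C * cis th) 0) <= M.
Proof.
have [|dl dl0 Hdl] := @segment_uniform R (fun dl th =>
   nm (A (rho%:C * cis th) 0) <= dl^-1) 0 (2 * pi).
  move=> th0 _; have [d d0 Hd] := circle_local th0 (@ltr01 R).
  pose M := 1 + nm (A (rho%:C * cis th0) 0).
  have M0 : 0 < M by rewrite ltr_pwDl ?nm_ge0.
  exists (Order.min d M^-1); first by rewrite lt_min d0 invr_gt0.
  move=> th dl; rewrite lt_min => /andP[h1 _] dl0; rewrite lt_min => /andP[_ h2].
  apply: le_trans (_ : M <= _).
    rewrite -(subrK (A (rho%:C * cis th0) 0) (A (rho%:C * cis th) 0)).
    apply: le_trans (nmD _ _) _; rewrite lerD2r; apply: Hd => //; first exact: polydisc0.
    by rewrite nm0.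
  by rewrite -[M]invrK lef_pV2 ?posrE ?invr_gt0 // ltW.
by exists dl^-1; [rewrite invr_ge0 ltW | exact: Hdl].
Qed.

Lemma series_tendsto (z : C) t (a b : 'I_n) : N0 <= cn z -> PD t ->
  tendsto (inv_partial (fun j => Aj j t a b) z) (A z t a b).
Proof.
move=> hz ht e e0.
have hz' : outside N0 z by rewrite /outside /= cn_ge.
have /cvgrPdist_le := A_series hz' ht; move=> /(_ (e%:C : C)); rewrite ltcR => /(_ e0).
case=> m0 _ Hm; exists m0 => m /Hm /=; rewrite cn_distC -cn_le; apply: le_trans.
apply: le_trans (entry_le_norm _ a b); rewrite mxE [in X in _ <= `|X|]mxE /series /= summxE.
rewrite le_eqVlt; apply/orP; left; apply/eqP; congr (`|_ - _|); rewrite /inv_partial.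
by apply: eq_bigr => i _; rewrite mxE.
Qed.

(** The Cauchy estimate is applied to the difference of the series at t and at 0, whose sum is
    uniformly small on the circle. *)
Lemma Aj_tends j : tends (near_in PD) (Aj j) (Aj j 0).
Proof.
apply: tends_entry => a b e e0.
have e1 : 0 < e / rho ^+ j by rewrite divr_gt0 // exprn_gt0.
have H := circle_tends e1.
apply: near_in_imp H _ => t tP /= Ht.
have := @cauchy_estimate R (fun j => Aj j t a b - Aj j 0 a b)
  (fun z => A z t a b - A z 0 a b) N0 rho (e / rho ^+ j) j N0_gt0.
rewrite divfK ?lt0r_neq0 ?exprn_gt0 //; apply; first by rewrite ltrDl.
  move=> z hz e' e'0; have e2 : 0 < e' / 2 by rewrite divr_gt0.
  have [m1 H1] := series_tendsto a b hz tP e2.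
  have [m2 H2] := series_tendsto a b hz polydisc0 e2.
  exists (maxn m1 m2) => m; rewrite geq_max => /andP[/H1 h1 /H2 h2].
  have -> : inv_partial (fun j => Aj j t a b - Aj j 0 a b) z m - (A z t a b - A z 0 a b) =
    (inv_partial (fun j => Aj j t a b) z m - A z t a b) - (inv_partial (fun j => Aj j 0 a b) z m - A z 0 a b).
    rewrite /inv_partial; under eq_bigr do rewrite mulrBr.
    by rewrite sumrB; ring.
  by apply: le_trans (cnB _ _) _; rewrite (splitr e') lerD.
move=> th hth; apply: le_trans (Ht th hth).
by have := nm_entry (A (rho%:C * cis th) t - A (rho%:C * cis th) 0) a b; rewrite !mxE.
Qed.

(** Cauchy's estimates bound the coefficients by a constant times rho^j; for |z| >= 2 rho the tail
    is geometric with ratio at most 1/2, and [M] depends neither on t nor on N. *)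
Lemma A_remainder : exists2 M : R, 0 <= M & near_in PD [set t | forall (N : nat) (z : C),
  2 * rho <= cn z ->
  nm (A z t - \sum_(0 <= j < N.+1) z ^- j *: Aj j t) <= M * rho ^+ N.+1 * (cn z)^-1 ^+ N.+1].
Proof.
have [M0 M00 HM0] := circle_bound.
exists ((n * n)%:R * (2 * (M0 + 1))); first by rewrite !mulr_ge0 // addr_ge0.
have H := circle_tends (@ltr01 R).
apply: near_in_imp H _ => t tP /= Ht N z hz.
have Mt th : 0 <= th <= 2 * pi -> nm (A (rho%:C * cis th) t) <= M0 + 1.
  move=> hth; rewrite -(subrK (A (rho%:C * cis th) 0) (A _ t)) addrC.
  apply: le_trans (nmD _ _) _; apply: lerD; [exact: HM0 | exact: Ht].
have r1 : rho < cn z by apply: lt_le_trans hz; have := rho0; lra.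
have z0 : 0 < cn z by exact: lt_trans r1.
have Nr : N0 < rho by rewrite ltrDl.
rewrite -!mulrA; apply: nm_le_entry => a b.
have ca i : cn (Aj i t a b) <= (M0 + 1) * rho ^+ i.
  apply: (@cauchy_estimate R (fun j => Aj j t a b) (fun z => A z t a b) N0 rho) => //.
    by move=> z' hz'; exact: series_tendsto.
  by move=> th hth; apply: le_trans (Mt th hth); exact: nm_entry.
have := @series_tail R (fun j => Aj j t a b) z (A z t a b) (M0 + 1) rho N.+1 _ (ltW rho0) r1 ca.
move=> /(_ _ _) h; rewrite !mxE summxE.
have -> : \sum_(0 <= i < N.+1) (z ^- i *: Aj i t) a b = inv_partial (fun j => Aj j t a b) z N.+1.
  by apply: eq_bigr => i _; rewrite mxE.
apply: le_trans (h _ _) _.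
- by rewrite addr_ge0.
- by apply: series_tendsto => //; apply: le_trans (ltW Nr) (ltW r1).
have q2 : rho / cn z <= 1 / 2.
  by rewrite ler_pdivrMr //; have := hz; lra.
have d0 : 0 < 1 - rho / cn z by move: q2; move: (rho / cn z) => q; lra.
rewrite [2 * _]mulrC -!mulrA ler_wpM2l ?addr_ge0 //.
rewrite ler_pdivrMr // exprMn.
have q0 : 0 <= rho ^+ N.+1 * (cn z)^-1 ^+ N.+1.
  by rewrite mulr_ge0 ?exprn_ge0 ?invr_ge0 // ltW.
rewrite [rho ^+ N.+1 * (_ * 2)]mulrA.
by move: q0 q2; move: (rho / cn z) (rho ^+ N.+1 * _) => q p p0 q2; nra.
Qed.

Lemma G0_tends : tends (near_in PD) G0 1%:M.
Proof. by rewrite -G0_0; apply: holomorphic_tends => //; exact: polydisc0. Qed.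

Lemma hatA_tends (f : 'rV[C]_n -> 'M[C]_n) l : tends (near_in PD) f l ->
  tends (near_in PD) (fun t => hatA (G0 t) (f t)) l.
Proof.
move=> hf; have -> : l = hatA 1%:M l by rewrite /hatA invmx1 mul1mx mulmx1.
have [_ hi] := tends_inv (unitmx1 _ _) G0_tends.
by apply: tendsM; [apply: tendsM | exact: G0_tends].
Qed.

Lemma B1_tends : tends (near_in PD) (fun t => B1 (G0 t) (Aj 1%N t)) (B1 (G0 0) (Aj 1%N 0)).
Proof.
apply: tends_entry => i a e e0; rewrite G0_0.
apply: near_in_imp (entry_tends a a (hatA_tends (Aj_tends 1%N)) e0) _ => t _ /=.
by rewrite /B1 ![(\row__ _) _ _]mxE /hatA invmx1 mul1mx mulmx1.
Qed.

Lemma F_tends k : tends (near_in PD) (fun t => with_id (F ^~ t) k) (with_id (F ^~ 0) k).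
Proof.
case: k => [|k]; first exact: tends_cst.
by apply: holomorphic_tends; [exact: F_hol | exact: polydisc0].
Qed.

Lemma tends_bounded_upto (f : nat -> 'rV[C]_n -> 'M[C]_n) (l : nat -> 'M[C]_n) (N : nat) :
  (forall k, tends (near_in PD) (f k) (l k)) ->
  exists2 K : R, 0 <= K & near_in PD [set t | forall k, (k <= N)%N -> nm (f k t) <= K].
Proof.
move=> H; exists (\sum_(k < N.+1) (nm (l k) + 1)).
  by apply: sumr_ge0 => k _; rewrite addr_ge0 ?nm_ge0.
have : \forall t \near near_in PD, forall k : 'I_N.+1, nm (f k t) <= nm (l k) + 1.
  by apply: filter_forall => k; exact: tends_bounded (H k).
move/near_in_imp; apply => t _ /= h k kN; apply: le_trans (h (Ordinal (kN : (k < N.+1)%N))) _.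
rewrite (bigD1 (Ordinal (kN : (k < N.+1)%N))) //= lerDl; apply: sumr_ge0 => j _.
by rewrite addr_ge0 ?nm_ge0.
Qed.

Definition data_bound (N : nat) (KA Kr KF Kb X0 : R) (t : 'rV[C]_n) : Prop :=
  [/\ forall j, (j <= N)%N -> nm (hatA (G0 t) (Aj j t)) <= KA,
      forall k, (k <= N)%N -> nm (with_id (F ^~ t) k) <= KF,
      nm (B1 (G0 t) (Aj 1%N t)) <= Kb &
      forall w : C, X0 <= complex.Re w ->
        nm (hatA (G0 t) (A (cexp w) t) - \sum_(0 <= j < N.+1) (cexp w) ^- j *: hatA (G0 t) (Aj j t))
          <= Kr * expR (- N.+1%:R * complex.Re w)].

(** The bounds hold on the polydisc near 0, and so at t = 0 itself, where the same reduction is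
    applied to the limit solution. *)
Lemma uniform_data (N : nat) : exists KA Kr KF X0 : R,
  [/\ 0 <= KA, 0 <= Kr, 0 <= KF &
    near_in PD (data_bound N KA Kr KF (nm (B1 (G0 0) (Aj 1%N 0)) + 1) X0)].
Proof.
have [KA KA0 HA] := tends_bounded_upto N (fun j => hatA_tends (Aj_tends j)).
have [KF KF0 HF] := tends_bounded_upto N F_tends.
have [M M0 HM] := A_remainder.
have [_ hi] := tends_inv (unitmx1 _ _) G0_tends.
pose Kg : R := n%:R + 1; pose Kg' : R := nm (invmx (1%:M : 'M[C]_n)) + 1.
exists KA, (Kg' * (M * rho ^+ N.+1) * Kg), KF, (ln (2 * rho)); split => //.
  by rewrite !mulr_ge0 ?addr_ge0 ?nm_ge0 ?exprn_ge0 // ltW.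
have h1 := near_in_and HA HF.
have h2 := near_in_and (near_in_bounded B1_tends) HM.
have h3 := near_in_and (near_in_bounded G0_tends) (near_in_bounded hi).
have h := near_in_and h1 (near_in_and h2 h3).
apply: (near_in_imp h) => t _ [[/= a1 a2] [[/= a3 a4] [/= a5 a6]]].
split => // w wX; rewrite nm1 in a5.
have -> : hatA (G0 t) (A (cexp w) t) - \sum_(0 <= j < N.+1) (cexp w) ^- j *: hatA (G0 t) (Aj j t) =
   hatA (G0 t) (A (cexp w) t - \sum_(0 <= j < N.+1) (cexp w) ^- j *: Aj j t).
  rewrite /hatA mulmxBr mulmxBl; congr (_ - _).
  rewrite mulmx_sumr mulmx_suml; apply: eq_bigr => j _.
  by rewrite -scalemxAr -scalemxAl.
apply: le_trans (nmM _ _) _; apply: le_trans (ler_pM (nm_ge0 _) (nm_ge0 _) (nmM _ _) (lexx _)) _.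
have z2 : 2 * rho <= cn (cexp w).
  by rewrite cn_cexp -[2 * rho]lnK ?posrE ?mulr_gt0 // ler_expR.
have eE : (expR (complex.Re w))^-1 ^+ N.+1 = expR (- N.+1%:R * complex.Re w).
  by rewrite -expRN -expRM_natl mulNr mulrN.
have := a4 N _ z2; rewrite cn_cexp eE => a7.
apply: le_trans (_ : Kg' * (M * rho ^+ N.+1 * expR (- N.+1%:R * complex.Re w)) * Kg <= _).
  apply: ler_pM; [by rewrite mulr_ge0 ?nm_ge0 | exact: nm_ge0 | | exact: a5].
  by apply: ler_pM; rewrite ?nm_ge0.
by rewrite le_eqVlt; apply/orP; left; apply/eqP; ring.
Qed.

Lemma CD_PD : CD `<=` PD.
Proof. by move=> t []. Qed.

Lemma Kb_ge0 : 0 <= Kb.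
Proof. by rewrite addr_ge0 ?nm_ge0. Qed.

Lemma B_ge0 : 0 <= B.
Proof. by rewrite addr_ge0 ?Kb_ge0. Qed.

Lemma strip_system (t : 'rV[C]_n) (u b : 'rV[C]_n) (Z : C -> 'M[C]_n) (w : C) : PD t ->
  mder Z w (cexp w *: (A (cexp w) t *m Z w)) ->
  mder (fun w => invmx (G0 t) *m strip u b Z w) w
    (cexp w *: (hatA (G0 t) (A (cexp w) t) *m (invmx (G0 t) *m strip u b Z w))
      - (invmx (G0 t) *m strip u b Z w) *m diag_mx (cexp w *: u + b)).
Proof. by move=> tP; apply: mder_strip; exact: G0_unit. Qed.

(** The canonical asymptotics of [Z], with constants depending on t, only supply the qualitative
    decay at the ends of the lines. The condition on N makes the final exponent N - 3 B - 1 at least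
    1. *)
Lemma uniform_estimate (N : nat) (eps : R) : 0 < eps -> eps <= pi / 2 -> 3 * B + 2 <= N%:R ->
  exists X1 K1 : R, near_in CD [set t | forall (k : int) (Z : C -> 'M[C]_n),
    canonical_solution N0 (A ^~ t) (G0 t) (u0 + t) (bt t) (F ^~ t)
      (sector_at (u0 + t) ttau k) Z ->
    forall w : C, X1 <= complex.Re w ->
      ttau + k%:~R * pi - pi + eps <= complex.Im w <= ttau + k%:~R * pi - eps ->
      nm (invmx (G0 t) *m strip (u0 + t) (bt t) Z w - trunc (F ^~ t) N w) <=
        K1 * expR (- (N%:R - 3 * B - 1) * complex.Re w)].
Proof.
move=> e0 ep BN.
have [KA [Kr [KF [X0 [KA0 Kr0 KF0 data]]]]] :=
  uniform_data N.
have [x0 [K [K0 x0X x00 red]]] :=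
  @reduced_system R n N KA Kr KF Kb (Num.max X0 (ln N0)) KA0 Kr0 KF0 Kb_ge0.
have x0X0 : X0 <= x0 by apply: le_trans x0X; rewrite le_max lexx.
have x0N : ln N0 <= x0 by apply: le_trans x0X; rewrite le_max lexx orbT.
have BN2 : 2 * B + 2 <= N%:R.
  by apply: le_trans BN; rewrite lerD2r ler_wpM2r ?B_ge0 // ler_nat.
have [X1 [K1 est]] := @half_plane_estimate R n N B K x0 eps B_ge0 K0 x00 e0 ep BN2.
exists (Num.max X1 x0), ((n%:R + 1 / 2) * K1).
apply: near_in_imp (near_in_sub CD_PD data) _ => t tD [HA HF Hb Hr] k Z [fZ aZ] w.
rewrite ge_max => /andP[wX wx0] wI.
have tP : PD t by exact: CD_PD.
have tnc : ~ coalescence_locus eps0 u0 t by case: tD => _ nX h; apply: nX; left.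
have formal := F_formal tP tnc.
set X := fun w => invmx (G0 t) *m strip (u0 + t) (bt t) Z w in aZ.
have XX : X0 <= Num.max X0 (ln N0) by rewrite le_max lexx.
have sys (z : C) : Num.max X0 (ln N0) <= complex.Re z ->
    mder X z (cexp z *: (hatA (G0 t) (A (cexp z) t) *m X z) - X z *m diag_mx (cexp z *: (u0 + t) + bt t)).
  rewrite ge_max => /andP[_ zN]; apply: strip_system => //.
  by apply/mderP; have [|h _] := fZ z; first by rewrite (outside_ln _ N0_gt0).
have [near [Rm ode Rb]] := red (fun w => hatA (G0 t) (A (cexp w) t))
  (fun j => hatA (G0 t) (Aj j t)) (F ^~ t) (u0 + t) (bt t) X HA HF Hb
  (fun w h => Hr w (le_trans XX h)) (fun m _ => formal m) sys.
have bB i j : cn (bt t 0 i - bt t 0 j) <= B.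
  by apply: le_trans (cnB _ _) _; apply: lerD; apply: le_trans (nm_entry _ _ _) Hb.
have sec := @sector_half_plane R n u0 ttau eps0 t k.
have [K' [r' [K'0 dec]]] := asymptotic_trunc aZ (fun w h => sec w tD h) N.
have [h1 h2] := reduced_sub1 X (near w wx0).
apply: le_trans h2 _; rewrite -mulrA ler_wpM2l ?addr_ge0 //.
apply: (est (u0 + t) (bt t) _ Rm (ttau + k%:~R * pi)) => //.
exists (2 * n%:R * K'), (Num.max r' x0); split; first by rewrite !mulr_ge0.
move=> z zI; rewrite ge_max => /andP[zr zx].
have [h3 _] := reduced_sub1 X (near z zx); apply: le_trans h3 _.
rewrite -[leRHS]mulrA ler_wpM2l ?mulr_ge0 //; apply: le_trans (dec z zI zr) _.
rewrite ler_wpM2l // ler_expR !mulNr lerN2 ler_wpM2r //; first exact: le_trans zx.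
rewrite -natr1 lerD2r; apply: le_trans BN.
by rewrite ler_wpDr // ler_peMl ?B_ge0 ?ler1n.
Qed.

Lemma tends_CD p q (f : 'rV[C]_n -> 'M[C]_(p, q)) l (D : set 'rV[C]_n) : D `<=` PD ->
  tends (near_in PD) f l -> tends (near_in D) f l.
Proof. by move=> DP H e /H; exact: near_in_sub. Qed.

Lemma tends_u0 (D : set 'rV[C]_n) : tends (near_in D) (fun t => u0 + t) u0.
Proof.
by rewrite -[X in tends _ _ X]addr0; apply: tendsD; [exact: tends_cst | exact: tends_near_in_id].
Qed.

(* t = 0 lies on the coalescence locus: the identities hold there as limits. *)
Lemma formal0 : formal_solution (Aj ^~ 0) (G0 0) u0 (F ^~ 0).
Proof.
have FF : ProperFilter (near_in CD).
  by apply: near_in_proper => d; exact: cell_domain_near0.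
move=> m.
have tF k : tends (near_in CD) (fun t => with_id (F ^~ t) k) (with_id (F ^~ 0) k).
  by apply: tends_CD (@CD_PD) _; exact: F_tends k.
have tb : tends (near_in CD) bt (bt 0).
  by apply: tends_CD (@CD_PD) _; exact: (B1_tends).
pose f (t : 'rV[C]_n) := (if m is k.+1 then with_id (F ^~ t) k *m diag_mx (bt t) - k%:R *: with_id (F ^~ t) k else 0)
      + with_id (F ^~ t) m *m diag_mx (u0 + t).
apply: (@tends_unique R _ (near_in CD) FF n n f).
  apply: tendsD; last by apply: tendsM; [exact: tF | apply: tends_diag; exact: tends_u0].
  case: (m) => [|k]; first exact: tends_cst.
  apply: tendsD; first by apply: tendsM; [exact: tF | exact: tends_diag].
  by apply: tendsN; apply: tendsZ; exact: tF.
have h : tends (near_in CD) (fun t => \sum_(j < m.+1) hatA (G0 t) (Aj j t) *m with_id (F ^~ t) (m - j)%N)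
   (\sum_(j < m.+1) hatA (G0 0) (Aj j 0) *m with_id (F ^~ 0) (m - j)%N).
  apply: tends_sum => j _; apply: tendsM; last exact: tF.
  apply: tends_CD (@CD_PD) _.
  have -> : hatA (G0 0) (Aj j 0) = Aj j 0 by rewrite G0_0 /hatA invmx1 mul1mx mulmx1.
  apply: (hatA_tends).
  exact: (Aj_tends).
apply: tends_ext h; exists 1 => // t tD _ /=.
have tP : PD t by exact: CD_PD.
have tnc : ~ coalescence_locus eps0 u0 t by case: tD => _ nX hh; apply: nX; left.
by rewrite -(F_formal tP tnc m).
Qed.

(** Spirals start at distance [eps] inside the half-plane, where the limit bound is available, and
    run outwards past its edges; the last hypothesis keeps Stokes rays away from their range. The
    second conclusion provides one point of invertibility, from which the limit is seen to be
    fundamental. *)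
Lemma limit_asymptotic (th eps : R) (D0 : set C) (Z : C -> 'M[C]_n) :
  0 < eps -> eps <= pi / 2 ->
  (forall w : C, ln N0 <= complex.Re w -> mder Z w (cexp w *: (A (cexp w) 0 *m Z w))) ->
  (forall N : nat, 3 * B + 2 <= N%:R -> exists X1 K1 : R, forall w : C, X1 <= complex.Re w ->
      th - pi + eps <= complex.Im w <= th - eps ->
      nm (invmx (G0 0) *m strip u0 (bt 0) Z w - trunc (F ^~ 0) N w) <=
        K1 * expR (- (N%:R - 3 * B - 1) * complex.Re w)) ->
  (forall al be : R, al <= be -> (forall w : C, al <= carg w <= be -> D0 w) ->
     forall theta, stokes_direction u0 theta ->
       ~ (th - eps <= theta <= Num.max be th) /\
       ~ (Num.min al (th - pi) <= theta <= th - pi + eps)) ->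
  asymptotic_in D0 (F ^~ 0) (fun w => invmx (G0 0) *m strip u0 (bt 0) Z w) /\
  (exists2 w1 : C, ln N0 <= complex.Re w1 & Z w1 \in unitmx).
Proof.
move=> e0 ep HZ Hest Hgap.
have pip := pi_gt0 R.
have B0 := B_ge0.
have P0 : PD 0 by exact: polydisc0.
set X := fun w => invmx (G0 0) *m strip u0 (bt 0) Z w.
have level (N : nat) : 3 * B + 2 <= N%:R -> exists x0 K KF : R, [/\ 0 <= K, 0 <= x0, ln N0 <= x0,
     (forall k, (k <= N)%N -> nm (with_id (F ^~ 0) k) <= KF) &
     (forall w : C, x0 <= complex.Re w -> nm (trunc (F ^~ 0) N w - 1%:M) <= 1 / 2) /\
     exists2 Rm : C -> 'M[C]_n, reduced_ode u0 (bt 0) x0 (reduced (F ^~ 0) N X) Rm &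
       remainder_bound x0 K N (reduced (F ^~ 0) N X) Rm].
  move=> BN.
  have [KA [Kr [KF [X0 [KA0 Kr0 KF0 [d d0 data]]]]]] :=
    uniform_data N.
  have [x0 [K [K0 x0X x00 red]]] :=
    @reduced_system R n N KA Kr KF Kb (Num.max X0 (ln N0)) KA0 Kr0 KF0 Kb_ge0.
  have [|HA HF Hb Hr] := data 0 P0; first by rewrite nm0.
  exists x0, K, KF.
  have XX : X0 <= Num.max X0 (ln N0) by rewrite le_max lexx.
  have sys (z : C) : Num.max X0 (ln N0) <= complex.Re z ->
      mder X z (cexp z *: (hatA (G0 0) (A (cexp z) 0) *m X z) - X z *m diag_mx (cexp z *: u0 + bt 0)).
    by rewrite ge_max => /andP[_ zN]; apply: strip_system => //; exact: HZ.
  have [near rest] := red (fun w => hatA (G0 0) (A (cexp w) 0))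
    (fun j => hatA (G0 0) (Aj j 0)) (F ^~ 0) u0 (bt 0) X HA HF Hb
    (fun w h => Hr w (le_trans XX h)) (fun m _ => formal0 m) sys.
  by split => //; apply: le_trans x0X; rewrite le_max lexx orbT.
split.
  apply: asymptotic_of_trunc => al be HD N'.
  have [albe|bal] := leP al be; last first.
    by exists 0, 0 => w /andP[h1 h2]; have := le_trans h1 h2; rewrite leNgt bal.
  (* Asymptotics of order N' are read off from a longer truncation, long enough that N - 3 B - 1 >=
     N' + 1; the terms in between are of the right order by [trunc_diff]. *)
  pose N := (Num.bound (3 * B + 2) + N'.+1)%N.
  have NB : N'.+1%:R + (3 * B + 2) <= N%:R.
    by rewrite /N natrD addrC lerD2r ltW // archi_boundP // addr_ge0 ?mulr_ge0.
  have BN : 3 * B + 2 <= N%:R by apply: le_trans NB; rewrite lerDr.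
  have N'N : (N' <= N)%N by rewrite (leq_trans (leqnSn N')) // leq_addl.
  pose M := N%:R - 3 * B - 1.
  have M1 : N'.+1%:R <= M by rewrite /M; move: NB; move: (N%:R : R) (N'.+1%:R : R) => a1 a2; lra.
  have M0 : 0 <= M by exact: le_trans M1.
  have MN : M <= N%:R by rewrite /M; move: (N%:R : R) => a1; lra.
  have N1 : 1 <= N%:R :> R by apply: le_trans BN; lra.
  have [x0 [K [KF [K0 x00 x0N HF [near [Rm ode Rb]]]]]] := level N BN.
  have [X1 [K1 est]] := Hest N BN.
  set y := reduced (F ^~ 0) N X in ode Rb.
  have ybase (w : C) : Num.max X1 x0 <= complex.Re w ->
      th - pi + eps <= complex.Im w <= th - eps ->
      nm (y w - 1%:M) <= 2 * n%:R * `|K1| * expR (- M * complex.Re w).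
    rewrite ge_max => /andP[wX wx] wI.
    have [h1 _] := reduced_sub1 X (near w wx); apply: le_trans h1 _.
    rewrite -[leRHS]mulrA ler_wpM2l ?mulr_ge0 //; apply: le_trans (est w wX wI) _.
    by rewrite ler_wpM2r ?expR_ge0 // ler_norm.
  have bB i j : cn (bt 0 0 i - bt 0 0 j) <= B.
    by apply: le_trans (cnB _ _) _; apply: lerD; apply: le_trans (nm_entry _ _ _) _; rewrite /Kb lerDl.
  have K10 : 0 <= 2 * n%:R * `|K1| by rewrite !mulr_ge0.
  have stokes (theta : R) (i j : 'I_n) : u0 0 i - u0 0 j != 0 ->
      complex.Re ((u0 0 i - u0 0 j) * cis theta) = 0 -> stokes_direction u0 theta.
    by move=> h1 h2; exists i, j; split=> //; rewrite -subr_eq0.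
  have [Ku [Xu up]] : exists K2 X2 : R, forall (w : C) (s : R), 0 <= s <= Num.max be th - (th - eps) ->
      complex.Im w = th - eps + 1 * s -> X2 <= complex.Re w ->
      nm (y w - 1%:M) <= K2 * expR (- M * complex.Re w).
    apply: (@spiral_extension R n u0 (bt 0) y Rm N B K x0 M (th - eps) 1 _
      (2 * n%:R * `|K1|) (Num.max X1 x0)) => //.
    - by rewrite subr_ge0; apply: le_trans (_ : th <= _); rewrite ?le_max ?lexx ?orbT //; lra.
    - by rewrite expr1n.
    - by move=> w wI wx; apply: ybase => //; rewrite wI; apply/andP; split; lra.
    move=> i j; have [->|ne] := eqVneq (u0 0 i - u0 0 j) 0; [by left | right].
    move=> s /andP[s0 s1]; apply/eqP => h.
    have [h1 _] := Hgap al be albe HD _ (stokes _ i j ne h); apply: h1.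
    by rewrite mul1r; apply/andP; split; lra.
  have [Kd [Xd down]] : exists K2 X2 : R, forall (w : C) (s : R), 0 <= s <= (th - pi + eps) - Num.min al (th - pi) ->
      complex.Im w = th - pi + eps + -1 * s -> X2 <= complex.Re w ->
      nm (y w - 1%:M) <= K2 * expR (- M * complex.Re w).
    apply: (@spiral_extension R n u0 (bt 0) y Rm N B K x0 M (th - pi + eps) (-1) _
      (2 * n%:R * `|K1|) (Num.max X1 x0)) => //.
    - by rewrite subr_ge0; apply: le_trans (_ : _ <= th - pi) _; rewrite ?ge_min ?lexx ?orbT //; lra.
    - by rewrite sqrrN expr1n.
    - by move=> w wI wx; apply: ybase => //; rewrite wI; apply/andP; split; lra.
    move=> i j; have [->|ne] := eqVneq (u0 0 i - u0 0 j) 0; [by left | right].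
    move=> s /andP[s0 s1]; apply/eqP => h.
    have [_ h1] := Hgap al be albe HD _ (stokes _ i j ne h); apply: h1.
    by rewrite mulN1r; apply/andP; split; lra.
  exists ((n%:R + 1 / 2) * (2 * n%:R * `|K1| + `|Ku| + `|Kd|) + N%:R * KF).
  exists (Num.max (Num.max X1 x0) (Num.max Xu Xd)) => w /andP[w1 w2].
  rewrite ge_max => /andP[wX]; rewrite ge_max => /andP[wu wd].
  have wx0 : x0 <= complex.Re w by move: wX; rewrite ge_max => /andP[].
  have w0 : 0 <= complex.Re w by exact: le_trans wx0.
  have ew : expR (- M * complex.Re w) <= expR (- N'.+1%:R * complex.Re w).
    by rewrite ler_expR !mulNr lerN2 ler_wpM2r.
  have ybound : nm (y w - 1%:M) <= (2 * n%:R * `|K1| + `|Ku| + `|Kd|) * expR (- M * complex.Re w).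
    have weak (k1 : R) : nm (y w - 1%:M) <= k1 * expR (- M * complex.Re w) ->
        k1 <= 2 * n%:R * `|K1| + `|Ku| + `|Kd| ->
        nm (y w - 1%:M) <= (2 * n%:R * `|K1| + `|Ku| + `|Kd|) * expR (- M * complex.Re w).
      by move=> h1 h2; apply: le_trans h1 _; rewrite ler_wpM2r ?expR_ge0.
    have kb : be <= Num.max be th by rewrite le_max lexx.
    have ka : Num.min al (th - pi) <= al by rewrite ge_min lexx.
    have nu := normr_ge0 Ku; have nd := normr_ge0 Kd.
    have lu := ler_norm Ku; have ld := ler_norm Kd.
    have [c1|c1] := leP (th - eps) (complex.Im w).
      apply: (weak Ku); last by apply: le_trans lu _; rewrite addrAC lerDr addr_ge0.
      apply: (up w (complex.Im w - (th - eps))) => //; last by rewrite mul1r addrC subrK.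
      by rewrite subr_ge0 c1 lerD2r (le_trans w2 kb).
    have [c2|c2] := leP (complex.Im w) (th - pi + eps).
      apply: (weak Kd); last by apply: le_trans ld _; rewrite lerDr addr_ge0.
      apply: (down w ((th - pi + eps) - complex.Im w)) => //; last by rewrite mulN1r opprB addrC subrK.
      by rewrite subr_ge0 c2 lerD2l lerN2 (le_trans ka w1).
    apply: (weak (2 * n%:R * `|K1|)); last by rewrite -addrA lerDl addr_ge0.
    by apply: ybase => //; apply/andP; split; exact: ltW.
  have -> : X w - trunc (F ^~ 0) N' w = (X w - trunc (F ^~ 0) N w) + (trunc (F ^~ 0) N w - trunc (F ^~ 0) N' w).
    by rewrite addrA subrK.
  apply: le_trans (nmD _ _) _; rewrite [leRHS]mulrDl; apply: lerD; last exact: trunc_diff.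
  have [_ h2] := reduced_sub1 X (near w wx0); apply: le_trans h2 _.
  rewrite -[leRHS]mulrA ler_wpM2l ?addr_ge0 //; apply: le_trans ybound _.
  by rewrite ler_wpM2l // !addr_ge0.
pose N := Num.bound (3 * B + 2).
have BN : 3 * B + 2 <= N%:R by rewrite ltW // archi_boundP // addr_ge0 ?mulr_ge0.
have [x0 [K [KF [K0 x00 x0N HF [near _]]]]] := level N BN.
have [X1 [K1 est]] := Hest N BN.
(* Chosen so that at |z| >= Q the bound on the reduced solution minus 1 is at most 1/2. *)
pose Q := 2 * (2 * n%:R * `|K1|) + 1.
have Q1 : 1 <= Q by rewrite lerDr !mulr_ge0.
have Q0 : 0 < Q by exact: lt_le_trans Q1.
pose x := Num.max (Num.max X1 x0) (ln Q).
pose w1 : C := x +i* (th - pi / 2).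
have x1 : X1 <= complex.Re w1 by rewrite /= /x !le_max lexx.
have x2 : x0 <= complex.Re w1 by rewrite /= /x !le_max lexx orbT.
have x3 : ln Q <= complex.Re w1 by rewrite /= /x !le_max lexx orbT.
have wI : th - pi + eps <= complex.Im w1 <= th - eps by rewrite /=; apply/andP; split; lra.
exists w1; first exact: le_trans x2.
have [h1 _] := reduced_sub1 X (near w1 x2).
have Uy : reduced (F ^~ 0) N X w1 \in unitmx.
  apply: (unit_near1 _).1; apply: le_trans h1 _.
  apply: le_trans (ler_wpM2l _ (est w1 x1 wI)) _; first by rewrite mulr_ge0.
  apply: le_trans (_ : 2 * n%:R * (`|K1| * expR (- ln Q)) <= _).
    rewrite ler_wpM2l ?mulr_ge0 //; apply: le_trans (ler_wpM2r (expR_ge0 _) (ler_norm K1)) _.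
    rewrite ler_wpM2l // ler_expR mulNr lerN2.
    apply: le_trans (_ : 1 * complex.Re w1 <= _); first by rewrite mul1r.
    rewrite ler_wpM2r //; first exact: le_trans x2.
    by move: BN; move: (N%:R : R) => a1; lra.
  rewrite expRN lnK ?posrE // mulrA ler_pdivrMr // /Q; move: (2 * n%:R * `|K1|) => z; lra.
have [Ut _] := unit_near1 (near w1 x2).
have UX : X w1 \in unitmx.
  have -> : X w1 = trunc (F ^~ 0) N w1 *m reduced (F ^~ 0) N X w1 by rewrite /reduced mulKVmx.
  by rewrite unitmx_mul Ut.
by move: UX; rewrite /X /strip !unitmx_mul => /andP[_ /andP[/andP[]]].
Qed.

Lemma system_cont (w : C) : ln N0 <= complex.Re w -> forall e : R, 0 < e -> exists2 dl : R, 0 < dl &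
  near_in PD [set t | forall h, cn h < dl -> ln N0 <= complex.Re (w + h) ->
    nm (cexp (w + h) *: A (cexp (w + h)) t - cexp w *: A (cexp w) 0) <= e].
Proof.
move=> hw e e0; pose z0 := cexp w; pose A0 := A z0 0.
have out z : ln N0 <= complex.Re z -> N0 <= cn (cexp z).
  by move=> h; rewrite cn_cexp -[N0]lnK ?posrE // ler_expR.
have E1 : 0 < cn z0 + 1 by rewrite ltr_wpDl ?cn_ge0.
have E2 : 0 < nm A0 + 1 by rewrite ltr_wpDl ?nm_ge0.
have e10 : 0 < e / 2 / (cn z0 + 1) by rewrite !divr_gt0.
have [d d0 Hd] := A_cont (out w hw) e10.
pose e2 := Num.min 1 (Num.min (e / 2 / (nm A0 + 1)) (d / 2)).
have e20 : 0 < e2 by rewrite !lt_min ltr01 !divr_gt0.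
have [dl dl0 Hdl] := is_derive_contP (is_derive_cexp w) e20.
exists dl => //; exists d => // t tP td h hdl hw'.
have := Hdl h hdl; rewrite -/z0 !le_min => /and3P[g1 g2 g3].
have -> : cexp (w + h) *: A (cexp (w + h)) t - z0 *: A z0 0 =
   cexp (w + h) *: (A (cexp (w + h)) t - A0) + (cexp (w + h) - z0) *: A0.
  by rewrite scalerBr scalerBl addrA subrK.
apply: le_trans (nmD _ _) _; rewrite !nmZ (splitr e); apply: lerD.
  apply: le_trans (_ : (cn z0 + 1) * (e / 2 / (cn z0 + 1)) <= _); last first.
    by rewrite mulrC divfK // lt0r_neq0.
  apply: ler_pM; rewrite ?cn_ge0 ?nm_ge0 //.
    by rewrite -(subrK z0 (cexp (w + h))) addrC; apply: le_trans (cnD _ _) _; rewrite lerD2l.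
  apply: Hd => //; first exact: out.
  by apply: le_lt_trans g3 _; lra.
apply: le_trans (_ : e / 2 / (nm A0 + 1) * (nm A0 + 1) <= _); last by rewrite divfK // lt0r_neq0.
by apply: ler_pM; rewrite ?cn_ge0 ?nm_ge0 // lerDl.
Qed.

Lemma system0_cont (w : C) : ln N0 <= complex.Re w -> forall e : R, 0 < e ->
  exists2 d : R, 0 < d & forall h, cn h < d -> ln N0 <= complex.Re (w + h) ->
    nm (cexp (w + h) *: A (cexp (w + h)) 0 - cexp w *: A (cexp w) 0) <= e.
Proof.
move=> hw e e0; have [dl dl0 [d d0 Hd]] := system_cont hw e0.
exists dl => // h; apply: Hd; [exact: polydisc0 | by rewrite nm0].
Qed.

Lemma cexp_tends (D : set 'rV[C]_n) (v : 'rV[C]_n -> 'rV[C]_n) l (w : C) :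
  tends (near_in D) v l ->
  tends (near_in D) (fun t => diag_mx (\row_a cexp (v t 0 a * w))) (diag_mx (\row_a cexp (l 0 a * w))).
Proof.
move=> H; apply: tends_diag; apply: tends_entry => i a e e0.
have [d d0 Hd] := is_derive_contP (is_derive_cexp (l 0 a * w)) e0.
have K0 : 0 < cn w + 1 by rewrite ltr_wpDl ?cn_ge0.
have d2 : 0 < d / 2 / (cn w + 1) by rewrite !divr_gt0.
apply: near_in_imp (entry_tends 0 a H d2) _ => t _ /= h; rewrite !mxE.
have := Hd ((v t 0 a - l 0 a) * w).
have -> : l 0 a * w + (v t 0 a - l 0 a) * w = v t 0 a * w by ring.
apply.
rewrite cnM; apply: le_lt_trans (_ : d / 2 / (cn w + 1) * (cn w + 1) < _).
  by apply: ler_pM; rewrite ?cn_ge0 // lerDl.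
by rewrite divfK ?lt0r_neq0 //; lra.
Qed.

Lemma strip_tends (D : set 'rV[C]_n) (Z : 'rV[C]_n -> C -> 'M[C]_n) (Z0 : C -> 'M[C]_n) (w : C) :
  D `<=` PD -> tends (near_in D) (Z ^~ w) (Z0 w) ->
  tends (near_in D) (fun t => invmx (G0 t) *m strip (u0 + t) (bt t) (Z t) w)
    (invmx (G0 0) *m strip u0 (bt 0) Z0 w).
Proof.
move=> DP HZ.
have hG : tends (near_in D) (fun t => invmx (G0 t)) (invmx (G0 0)).
  apply: tends_CD DP _; rewrite G0_0; apply: (tends_inv (unitmx1 _ _) _).2.
  exact: (G0_tends).
apply: tendsM => //; apply: tendsM; first apply: tendsM => //.
  by apply: (@cexp_tends D (fun t => - (u0 + t)) (- u0)); apply: tendsN; exact: tends_u0.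
apply: (@cexp_tends D (fun t => - bt t) (- bt 0)); apply: tendsN.
by apply: tends_CD DP _; exact: (B1_tends).
Qed.

Lemma trunc_tends (D : set 'rV[C]_n) (N : nat) (w : C) : D `<=` PD ->
  tends (near_in D) (fun t => trunc (F ^~ t) N w) (trunc (F ^~ 0) N w).
Proof.
move=> DP; apply: tendsD; first exact: tends_cst.
rewrite big_nat; under eq_fun do rewrite big_nat.
apply: tends_sum => -[//|j] _; apply: tendsZ.
by apply: tends_CD DP _; exact: (F_tends j.+1).
Qed.

(** The constants of [uniform_estimate] are free of t, so its bound passes to the limit at each [w]
    separately, and the convergence along the cell may be merely pointwise. *)
Lemma limit_canonical (c : set 'rV[C]_n) (k : int) (Yk : C -> 'rV[C]_n -> 'M[C]_n)
  (eps : R) (D0 : set C) :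
  ProperFilter (near_in c) -> c `<=` CD ->
  (forall t, c t -> canonical_solution N0 (A ^~ t) (G0 t) (u0 + t) (bt t) (F ^~ t)
     (sector_at (u0 + t) ttau k) (fun w => Yk w t)) ->
  (forall w, outside N0 (cexp w) -> exists2 Yc : 'rV[C]_n -> 'M[C]_n,
       holomorphic_on (polydisc eps0) Yc & forall t, c t -> Yc t = Yk w t) ->
  0 < eps -> eps <= pi / 2 ->
  (forall al be : R, al <= be -> (forall w : C, al <= carg w <= be -> D0 w) ->
     forall theta, stokes_direction u0 theta ->
       ~ (ttau + k%:~R * pi - eps <= theta <= Num.max be (ttau + k%:~R * pi)) /\
       ~ (Num.min al (ttau + k%:~R * pi - pi) <= theta <= ttau + k%:~R * pi - pi + eps)) ->
  exists2 Yo : C -> 'M[C]_n,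
    canonical_solution N0 (A ^~ 0) 1%:M u0 (bt 0) (F ^~ 0) D0 Yo &
    forall w, outside N0 (cexp w) -> tends (near_in c) (Yk w) (Yo w).
Proof.
move=> FF cCD Hcan Hcont e0 ep Hgap.
have cP : c `<=` PD by move=> t /cCD; exact: CD_PD.
have [L HL] : exists L : C -> 'M[C]_n, forall w, ln N0 <= complex.Re w -> tends (near_in c) (Yk w) (L w).
  have : forall w : C, exists l, ln N0 <= complex.Re w -> tends (near_in c) (Yk w) l.
    (* Off the domain 0 is a placeholder, overwritten by [extend] below. *)
    move=> w; have [hw|_] := leP (ln N0) (complex.Re w); last by exists 0.
    have [|Yc hol E] := Hcont w; first by rewrite (outside_ln _ N0_gt0).
    exists (Yc 0) => _.
    have h := tends_CD cP (holomorphic_tends hol (polydisc0)).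
    by apply: tends_ext h; exists 1 => // t tc _; exact: E.
  by move=> /choice[L HL]; exists L.
pose a t w := cexp w *: A (cexp w) t.
have HY : near_in c [set t | forall w : C, ln N0 <= complex.Re w ->
     mder (fun w => Yk w t) w (a t w *m Yk w t)].
  exists 1 => // t /Hcan[f _] _ w hw.
  have [|h _] := f w; first by rewrite (outside_ln _ N0_gt0).
  by move/mderP: h => h; apply: mder_eq h _; rewrite scalemxAl.
have Ha (w : C) : ln N0 <= complex.Re w -> forall e : R, 0 < e -> exists2 dl : R, 0 < dl &
     near_in c [set t | forall h, cn h < dl -> ln N0 <= complex.Re (w + h) ->
        nm (a t (w + h) - a 0 w) <= e].
  move=> hw e e'0; have [dl dl0 H] := system_cont hw e'0.
  by exists dl => //; exact: near_in_sub H.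
have HLder := limit_solution FF HY Ha HL.
pose D w := a 0 w *m L w.
have Dcont (w : C) : ln N0 <= complex.Re w -> forall e : R, 0 < e -> exists2 dl : R, 0 < dl &
    forall h, cn h < dl -> ln N0 <= complex.Re (w + h) -> nm (D (w + h) - D w) <= e.
  move=> hw e e'0; pose S := nm (a 0 w) + 1; pose T := nm (L w) + 1.
  have S0 : 0 < S by rewrite ltr_wpDl ?nm_ge0.
  have T0 : 0 < T by rewrite ltr_wpDl ?nm_ge0.
  pose e1 := Num.min 1 (e / 2 / T).
  have e10 : 0 < e1 by rewrite lt_min ltr01 !divr_gt0.
  have [d1 d10 H1] := system0_cont hw e10.
  have [d2 d20 H2] := HLder w hw 1 ltr01.
  pose Q := 1 + nm (a 0 w *m L w).
  have Q0 : 0 < Q by rewrite ltr_pwDl ?nm_ge0.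
  have e30 : 0 < e / 2 / S / Q by rewrite !divr_gt0.
  exists (Num.min d1 (Num.min d2 (e / 2 / S / Q))); first by rewrite !lt_min d10 d20.
  move=> h; rewrite !lt_min => /and3P[/H1 h1 /H2 h2 h3] hx.
  have {}h1 := h1 hx; have {}h2 := h2 hx.
  have lip : nm (L (w + h) - L w) <= e / 2 / S.
    rewrite -(subrK (h *: (a 0 w *m L w)) (L (w + h) - L w)).
    apply: le_trans (nmD _ _) _; rewrite nmZ; apply: le_trans (lerD h2 (lexx _)) _.
    rewrite mul1r -[X in X + _]mulr1 -mulrDr -ler_pdivlMr //; exact: ltW.
  have -> : D (w + h) - D w = a 0 (w + h) *m (L (w + h) - L w) + (a 0 (w + h) - a 0 w) *m L w.
    by rewrite /D mulmxBr mulmxBl addrA subrK.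
  apply: le_trans (nmD _ _) _; rewrite (splitr e); apply: lerD; apply: le_trans (nmM _ _) _.
    apply: le_trans (_ : S * (e / 2 / S) <= _); last by rewrite mulrC divfK // lt0r_neq0.
    apply: ler_pM; rewrite ?nm_ge0 //.
    rewrite -(subrK (a 0 w) (a 0 (w + h))) addrC; apply: le_trans (nmD _ _) _; rewrite lerD2l.
    by apply: le_trans h1 _; rewrite ge_min lexx.
  apply: le_trans (_ : e / 2 / T * T <= _); last by rewrite divfK // lt0r_neq0.
  apply: ler_pM; rewrite ?nm_ge0 //; last by rewrite lerDl.
  by apply: le_trans h1 _; rewrite ge_min lexx orbT.
pose Yo := extend (ln N0) L D.
have YoE (w : C) : ln N0 <= complex.Re w -> Yo w = L w by exact: extendE.
have HYo (w : C) : ln N0 <= complex.Re w -> mder Yo w (a 0 w *m Yo w).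
  by move=> hw; rewrite YoE //; apply: mder_extend.
have Hest (N : nat) : 3 * B + 2 <= N%:R -> exists X1 K1 : R, forall w : C, X1 <= complex.Re w ->
      ttau + k%:~R * pi - pi + eps <= complex.Im w <= ttau + k%:~R * pi - eps ->
      nm (invmx (G0 0) *m strip u0 (bt 0) Yo w - trunc (F ^~ 0) N w) <=
        K1 * expR (- (N%:R - 3 * B - 1) * complex.Re w).
  move=> BN.
  have [X1 [K1 est]] := uniform_estimate e0 ep BN.
  exists (Num.max X1 (ln N0)), K1 => w; rewrite ge_max => /andP[w1 wN] wI.
  have h1 : tends (near_in c) (fun t => invmx (G0 t) *m strip (u0 + t) (bt t) (fun w => Yk w t) w)
      (invmx (G0 0) *m strip u0 (bt 0) Yo w).
    by apply: (strip_tends cP (Z := fun t w => Yk w t)); rewrite YoE //; exact: HL.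
  have h2 := tendsD h1 (tendsN (trunc_tends N w cP)).
  have h3 : near_in c [set t | nm (invmx (G0 t) *m strip (u0 + t) (bt t) (fun w => Yk w t) w - trunc (F ^~ t) N w) <= K1 * expR (- (N%:R - 3 * B - 1) * complex.Re w)].
    apply: near_in_imp (near_in_sub cCD est) _ => t tc /= h.
    exact: (h k (fun w => Yk w t) (Hcan t tc) w w1 wI).
  by have := tends_near_le (h2 (near_in_filter c) (near_in_filter c)) h3; apply.
have HYo' (w : C) : ln N0 <= complex.Re w -> mder Yo w (cexp w *: (A (cexp w) 0 *m Yo w)).
  by move=> /HYo h; apply: mder_eq h _; rewrite /a scalemxAl.
have [asym [w1 w1N U1]] := limit_asymptotic e0 ep HYo' Hest Hgap.
exists Yo; last by move=> w; rewrite (outside_ln _ N0_gt0) => hw; rewrite YoE //; exact: HL.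
split; last by rewrite -G0_0.
move=> w; rewrite (outside_ln _ N0_gt0) => hw; split; first by apply/mderP; exact: HYo'.
exact: (unit_propagates system0_cont HYo w1N U1).
Qed.

End NearCoalescence.

(** * Stokes rays at t = 0 around the half-plane *)

Section Labelled.
Variables (R : realType) (n : nat).
Local Notation C := (cplx R).

Lemma labelling_gap (s : nat) (lam : 'I_s -> C) (blk : 'I_n -> 'I_s) (u0 : 'rV[C]_n)
  (ttau : R) (tau : int -> R) (mu nu : int) :
  (forall a, u0 0 a = lam (blk a)) ->
  ((1 < s)%N -> stokes_labelling u0 tau mu nu ttau) ->
  exists eps : R, [/\ 0 < eps, eps <= pi / 2 & forall k : nat,
    let th := ttau + (k%:Z)%:~R * pi in
    (forall w : C, th - pi <= carg w <= th -> sector0 s tau (nu + k%:Z * mu) w) /\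
    (forall al be : R, al <= be ->
      (forall w : C, al <= carg w <= be -> sector0 s tau (nu + k%:Z * mu) w) ->
      forall theta, stokes_direction u0 theta ->
       ~ (th - eps <= theta <= Num.max be th) /\
       ~ (Num.min al (th - pi) <= theta <= th - pi + eps))].
Proof.
move=> u0E tauP; have pip := pi_gt0 R.
have [s1|s1] := ltnP 1 s; last first.
  (* With at most one eigenvalue there are no Stokes rays, and any admissible [eps] does. *)
  exists (pi / 2); split; [by lra | by [] | move=> k th; split].
    by move=> w _; rewrite /sector0 /= ltnNge s1.
  move=> al be _ _ theta [a [b [ne _]]]; exfalso; move/eqP: ne; apply.
  rewrite !u0E; congr lam; apply: val_inj.
  have val0 (i : 'I_s) : val i = 0%N.
    by apply/eqP; rewrite -leqn0 -ltnS; exact: leq_trans (ltn_ord i) s1.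
  by rewrite !val0.
have [mono stokesP per /andP[t1 t2]] := tauP s1.
(* Half of the distance from [ttau] to the neighbouring Stokes directions, so that [ttau - eps]
   stays strictly between them; capped to leave a nonempty subsector. *)
pose eps := Num.min (pi / 2) (Num.min (ttau - tau nu) (tau (nu + 1) - ttau)) / 2.
have e0 : 0 < eps.
  by rewrite divr_gt0 // !lt_min !subr_gt0 t1 t2 !andbT; lra.
have : 2 * eps <= Num.min (pi / 2) (Num.min (ttau - tau nu) (tau (nu + 1) - ttau)).
  by rewrite mulrC divfK.
rewrite !le_min => /and3P[ep e1 e2].
have mono_le i j : i <= j -> tau i <= tau j.
  by rewrite le_eqVlt => /orP[/eqP ->|/mono/ltW].
have shift sg (k : nat) : tau (sg + k%:Z * mu) = tau sg + (k%:Z)%:~R * pi.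
  elim: k => [|k IH]; first by rewrite !mul0r !addr0.
  have -> : sg + (k.+1)%:Z * mu = (sg + k%:Z * mu) + mu.
    by rewrite -addn1 PoszD mulrDl mul1r addrA.
  by rewrite per IH -!pmulrn -addrA -[k.+1%:R in RHS]natr1 mulrDl mul1r.
have between (sg : int) (k : nat) : ~ (tau nu + (k%:Z)%:~R * pi < tau sg < tau (nu + 1) + (k%:Z)%:~R * pi).
  rewrite -!shift => /andP[h1 h2].
  have l1 : nu + k%:Z * mu < sg.
    by rewrite ltNge; apply/negP => /mono_le h; move: h1; rewrite ltNge h.
  have l2 : sg < nu + 1 + k%:Z * mu.
    by rewrite ltNge; apply/negP => /mono_le h; move: h2; rewrite ltNge h.
  by move: l1 l2; rewrite addrAC ltzD1 => l1 l2; have := lt_le_trans l1 l2; rewrite ltxx.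
exists eps; split => //; first by lra.
move=> k th.
have sE w : sector0 s tau (nu + k%:Z * mu) w <->
    tau nu + (k%:Z)%:~R * pi - pi < carg w < tau (nu + 1) + (k%:Z)%:~R * pi.
  have -> : tau (nu + 1) + (k%:Z)%:~R * pi = tau (nu + k%:Z * mu + 1) by rewrite -shift addrAC.
  rewrite /sector0 /= shift; split; [by apply | by move=> h _].
split.
  move=> w /andP[w1 w2]; apply/sE; rewrite /th in w1 w2; apply/andP; split; lra.
move=> al be albe HD theta /stokesP[sg ->].
have /sE/andP[/= a1 _] : sector0 s tau (nu + k%:Z * mu) (0 +i* al).
  by apply: HD; rewrite /= lexx.
have /sE/andP[_ /= b1] : sector0 s tau (nu + k%:Z * mu) (0 +i* be).
  by apply: HD; rewrite /= lexx andbT.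
split=> /andP[h1 h2].
  apply: (between sg k); rewrite /th in h1 h2; apply/andP; split; first by lra.
  by apply: le_lt_trans h2 _; rewrite gt_max b1; lra.
(* A shift by [mu] adds pi and brings a ray near the lower edge of the half-plane into the same gap
   as above. *)
apply: (between (sg + mu) k); rewrite per; rewrite /th in h1 h2; apply/andP; split.
  have : tau nu + (k%:Z)%:~R * pi - pi < Num.min al (ttau + (k%:Z)%:~R * pi - pi) by rewrite lt_min a1; lra.
  by move=> h; have := lt_le_trans h h1; lra.
lra.
Qed.

End Labelled.

(** * Convergence of the Stokes matrices *)

Theorem corollary14p2 (R : realType) (n : nat) (n_gt0 : (0 < n)%N)
  (* Lambda(0) = lam_1 I_(p_1) (+) ... (+) lam_s I_(p_s); blk a is the block
     containing the index a *)
  (s : nat) (lam : 'I_s -> cplx R) (blk : 'I_n -> 'I_s)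
  (lam_inj : injective lam)
  (blk_mono : forall a b : 'I_n, (a <= b)%N -> (blk a <= blk b)%N)
  (blk_surj : forall i : 'I_s, exists a, blk a = i)
  (u0 : 'rV[cplx R]_n) (u0E : forall a, u0 0 a = lam (blk a))
  (* admissible direction and labelling of the Stokes rays of Lambda(0) *)
  (ttau : R) (ttau_adm : admissible u0 ttau)
  (tau : int -> R) (mu nu : int)
  (tauP : (1 < s)%N -> stokes_labelling u0 tau mu nu ttau)
  (* radius of the polydisc *)
  (eps0 : R) (eps0_gt0 : 0 < eps0)
  (eps0_lt : forall i j : 'I_s, i != j -> eps0 < delta_ lam ttau i j)
  (* the system *)
  (N0 : R) (N0_gt0 : 0 < N0)
  (A : cplx R -> 'rV[cplx R]_n -> 'M[cplx R]_n)
  (Aj : nat -> 'rV[cplx R]_n -> 'M[cplx R]_n)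
  (A_hol : holomorphic_on
     [set p : cplx R * 'rV[cplx R]_n | outside N0 p.1 /\ polydisc eps0 p.2]
     (fun p => A p.1 p.2))
  (A_series : forall z t, outside N0 z -> polydisc eps0 t ->
     series (fun j => z ^- j *: Aj j t) @ \oo --> A z t)
  (G0 : 'rV[cplx R]_n -> 'M[cplx R]_n)
  (G0_hol : holomorphic_on (polydisc eps0) G0)
  (G0_unit : forall t, polydisc eps0 t -> G0 t \in unitmx)
  (G0_0 : G0 0 = 1%:M)
  (G0_diag : forall t, polydisc eps0 t ->
     hatA (G0 t) (Aj 0%N t) = diag_mx (u0 + t))
  (* formal solution, and hypothesis 1) *)
  (F : nat -> 'rV[cplx R]_n -> 'M[cplx R]_n)
  (F_formal : forall t, polydisc eps0 t -> ~ coalescence_locus eps0 u0 t ->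
     formal_solution (Aj ^~ t) (G0 t) (u0 + t) (F ^~ t))
  (F_hol : forall j, (0 < j)%N -> holomorphic_on (polydisc eps0) (F j))
  (* Y c k w t is Y_(nu + k mu)(z, t; ttau, c) at z = e^w, for t in c *)
  (Y : set 'rV[cplx R]_n -> int -> cplx R -> 'rV[cplx R]_n -> 'M[cplx R]_n)
  (Y_canonical : forall c k, is_cell eps0 u0 ttau c -> forall t, c t ->
     canonical_solution N0 (A ^~ t) (G0 t) (u0 + t) (B1 (G0 t) (Aj 1%N t))
       (F ^~ t) (sector_at (u0 + t) ttau k) (fun w => Y c k w t))
  (Y_hol : forall c k, is_cell eps0 u0 ttau c ->
     forall w, outside N0 (cexp w) -> holomorphic_on c (Y c k w))
  (* hypothesis 2) *)
  (Y_cont : forall c k, is_cell eps0 u0 ttau c ->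
     forall w, outside N0 (cexp w) ->
     exists2 Yc : 'rV[cplx R]_n -> 'M[cplx R]_n,
       holomorphic_on (polydisc eps0) Yc & forall t, c t -> Yc t = Y c k w t)
  (* St k t is the Stokes matrix S_(nu + k mu)(t), k = 0, 1 *)
  (St : nat -> 'rV[cplx R]_n -> 'M[cplx R]_n)
  (St_stokes : forall k, (k < 2)%N ->
     forall c, is_cell eps0 u0 ttau c -> forall t, c t ->
     stokes_matrix N0 ((Y c k%:Z)^~ t) ((Y c k.+1%:Z)^~ t) (St k t)) :
  exists (Yo : nat -> cplx R -> 'M[cplx R]_n) (So : nat -> 'M[cplx R]_n),
    let canonical0 k := canonical_solution N0 (A ^~ 0) 1%:M u0
      (B1 (G0 0) (Aj 1%N 0)) (F ^~ 0) (sector0 s tau (nu + k%:Z * mu)) in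
    [/\ (forall k, (k < 3)%N -> canonical0 k (Yo k) /\
           forall Z, canonical0 k Z ->
             forall w, outside N0 (cexp w) -> Z w = Yo k w),
        (forall k, (k < 2)%N -> stokes_matrix N0 (Yo k) (Yo k.+1) (So k))
      & (forall k, (k < 2)%N ->
           St k t @[t --> within (cell_domain eps0 u0 ttau) (0 : 'rV[cplx R]_n)^'] --> So k)].
Proof.
have N0out w : outside N0 (cexp w) = (ln N0 <= complex.Re w) by exact: outside_ln.
pose CD := cell_domain eps0 u0 ttau.
have CDP : CD `<=` polydisc eps0 by exact: CD_PD.
have [d1 d10 [ray cells]] := near_in_cells u0 ttau eps0_gt0.
have [t0 t0D t0d] := cell_domain_near0 u0 ttau eps0_gt0 d10.
have [eps [e0 ep gap]] := labelling_gap u0E tauP.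
pose D0 (k : nat) := sector0 s tau (nu + k%:Z * mu) : set (cplx R).
pose canonical0 (k : nat) := canonical_solution N0 (A ^~ 0) 1%:M u0
  (B1 (G0 0) (Aj 1%N 0)) (F ^~ 0) (D0 k).
have cell t : CD t -> is_cell eps0 u0 ttau (connected_component CD t) by exists t.
have cCD t : connected_component CD t `<=` CD by exact: connected_component_sub.
have proper t : CD t -> nm t < d1 -> ProperFilter (near_in (connected_component CD t)).
  by move=> tD td; apply: near_in_component_proper => // r; exact: ray.
have limit t (k : nat) : CD t -> nm t < d1 -> exists2 Yk, canonical0 k Yk &
    forall w, outside N0 (cexp w) ->
      tends (near_in (connected_component CD t)) (Y (connected_component CD t) k%:Z w) (Yk w).
  move=> tD td; have [_ hgap] := gap k.
  exact: (limit_canonical eps0_gt0 N0_gt0 A_hol A_series G0_hol G0_unit G0_0 F_formal F_hol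
    (proper t tD td) (cCD t) (Y_canonical _ k%:Z (cell t tD)) (Y_cont _ k%:Z (cell t tD)) e0 ep hgap).
(* Limits along different cells are canonical in one and the same sector, so they coincide; this
   makes [Yo] independent of the cell in [cellY]. *)
have unique k Z1 Z2 : canonical0 k Z1 -> canonical0 k Z2 ->
    forall w, outside N0 (cexp w) -> Z2 w = Z1 w.
  have [hsec _] := gap k; move=> c1 c2.
  apply: (asymptotic_unique N0_gt0 _ hsec hsec c1 c2).
  exact: (system0_cont eps0_gt0 N0_gt0 A_hol).
have /choice[Yo HYo] : forall k, exists Yk, canonical0 k Yk.
  by move=> k; have [Yk] := limit t0 k t0D t0d; exists Yk.
have cellY t k w : CD t -> nm t < d1 -> outside N0 (cexp w) ->
    tends (near_in (connected_component CD t)) (Y (connected_component CD t) k%:Z w) (Yo k w).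
  move=> tD td hw; have [Yk cYk lim] := limit t k tD td.
  by rewrite (unique k _ _ cYk (HYo k) w hw); exact: lim.
pose w0 : cplx R := ln N0 +i* 0.
have w0out : outside N0 (cexp w0) by rewrite N0out.
have U k w : outside N0 (cexp w) -> Yo k w \in unitmx by move=> hw; have [/(_ w hw)[]] := HYo k.
(* Stokes matrices do not depend on z, so one point [w0] determines the limit; the relation at the
   other points then follows from uniqueness of limits. *)
pose So k := invmx (Yo k w0) *m Yo k.+1 w0.
have cellS t k : (k < 2)%N -> CD t -> nm t < d1 ->
    tends (near_in (connected_component CD t)) (St k) (So k).
  move=> k2 tD td.
  have FF := proper t tD td.
  have h : tends (near_in (connected_component CD t))
      (fun t' => invmx (Y (connected_component CD t) k%:Z w0 t') *m
        Y (connected_component CD t) k.+1%:Z w0 t') (So k).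
    apply: tendsM; last exact: cellY.
    exact: (tends_inv (U k w0 w0out) (cellY t k w0 tD td w0out)).2.
  apply: tends_ext h; exists 1 => // t' ct' _ /=.
  have [f _] := Y_canonical _ k%:Z (cell t tD) t' ct'.
  rewrite (St_stokes k k2 _ (cell t tD) t' ct' w0 w0out) mulKmx //.
  by have [] := f w0 w0out.
exists Yo, So => can; split.
- by move=> k _; split=> [|Z cZ]; [exact: HYo | exact: (unique k _ _ (HYo k) cZ)].
- move=> k k2 w hw; have FF := proper t0 t0D t0d.
  apply: tends_unique (cellY t0 k.+1 w t0D t0d hw) _.
  have h : tends (near_in (connected_component CD t0))
      (fun t => Y (connected_component CD t0) k%:Z w t *m St k t) (Yo k w *m So k).
    by apply: tendsM; [exact: cellY | exact: cellS].
  apply: tends_ext h; exists 1 => // t ct _ /=.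
  by rewrite (St_stokes k k2 _ (cell t0 t0D) t ct w hw).
move=> k k2; apply/cvgrPdist_le => _ /posC[e e'0 ->].
have [d d0 Hd] : near_in CD [set t | nm (St k t - So k) <= e].
  by apply: cells => t tD td; exact: cellS.
(* [nm] of a row is at most n times its sup norm; n + 1 keeps the divisor positive and the
   inequality strict. *)
have D1 : 0 < d / n.+1%:R by rewrite divr_gt0.
have : \forall t \near (0 : 'rV[cplx R]_n), nm t < d.
  apply/nbhs_ballP; exists ((d / n.+1%:R)%:C : cplx R); first by rewrite /= ltcR.
  move=> t; rewrite -ball_normE /ball_ /= sub0r normrN => /ltW/nm_le_norm h.
  apply: le_lt_trans h _; rewrite mul1n mulrA ltr_pdivrMr // mulrC ltr_pM2l //.
  by rewrite ltr_nat.
rewrite /within /=; apply: (@filterS _ _ (nbhs_filter (0 : 'rV[cplx R]_n))) => t td _ tD.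
rewrite distrC; apply: le_trans (norm_le_nm _) _; rewrite lecR.
exact: Hd.
Qed.
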